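(* Let $n$ learners, graph $\mathcal{G}$, communication matrix $P$, $\omega$-contractive compressor $\mathcal{C}$, convex set $\mathcal{X}\subseteq\mathbb{R}^d$ and loss functions $f_{t,i}$ be as in the context, and assume: (A1) $P$ satisfies the communication-matrix assumption; (A2) every $f_{t,i}$ is convex over $\mathcal{X}$; (A4) $\|\nabla f_{t,i}(\mathbf{x})\|\le G$ on $\mathcal{X}$; (A6) $r\mathcal{B}\subseteq\mathcal{X}\subseteq R\mathcal{B}$ with $\mathcal{B}$ the closed unit ball. Run Top-DOBD-2 with $$\gamma=\frac{\omega\rho}{2\rho\beta^2+4\beta^2+(2-\omega)(\beta^2+2\beta)\rho+\rho^2},\ L_1=\Big\lceil\frac{2\ln(14n)}{\gamma\rho}\Big\rceil,\ L_2=\Big\lceil\frac{\ln(8n)}{\omega}\Big\rceil,\ L=L_1+L_2,$$ $\eta_b=\eta=\frac{R}{dG\sqrt{LT}}$, $\zeta=\frac{\epsilon}{r}$, $\epsilon=cT^{-1/2}$, where $c$ is a constant such that $\epsilon\le r$. Then for every $i\in[n]$, $$\mathbb{E}[R_2(T,i)]\le O\big(\omega^{-1/2}\rho^{-1}dn\sqrt{\ln n}\sqrt T\big).$$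
   Context: D-OCO with two-point bandit feedback: $n$ learners are nodes of an undirected graph $\mathcal{G}=([n],E)$; $\mathcal{N}_i$ is the set of neighbors of $i$ together with $i$. In each round $t$, learner $i$ plays two points $\mathbf{x}_{i,1}(t),\mathbf{x}_{i,2}(t)\in\mathcal{X}$ and observes only $f_{t,i}(\mathbf{x}_{i,1}(t))$ and $f_{t,i}(\mathbf{x}_{i,2}(t))$. Regret: $R_2(T,i)=\sum_{t=1}^T\sum_{j=1}^n\frac{f_{t,j}(\mathbf{x}_{i,1}(t))+f_{t,j}(\mathbf{x}_{i,2}(t))}{2}-\min_{\mathbf{x}\in\mathcal{X}}\sum_{t=1}^T\sum_{j=1}^n f_{t,j}(\mathbf{x})$. Communication-matrix assumption: $P$ symmetric, doubly stochastic, positive semidefinite, $0<P_{ij}<1$ only if $(i,j)\in E$ or $i=j$ (zero otherwise), second largest singular value $\sigma_2(P)<1$; $\rho=1-\sigma_2(P)$, $\beta=\|I_n-P\|_2$. Compressor: random map $\mathcal{C}$ with $\mathbb{E}_{\mathcal{C}}\|\mathcal{C}(\mathbf{x})-\mathbf{x}\|^2\le(1-\omega)\|\mathbf{x}\|^2$, $\omega\in(0,1]$, independent randomness at each use. $\mathcal{X}_\zeta=(1-\zeta)\mathcal{X}$, $\Pi_{\mathcal{X}_\zeta}$ Euclidean projection onto it. Algorithm Top-DOBD-2 (parameters $\gamma,\eta_b,L_1,L_2$, $L=L_1+L_2$, $\zeta,\epsilon$; $T$ a multiple of $L$). Blocks $b=1,\dots,T/L$, block $b$ = rounds $(b-1)L+1,\dots,bL$.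 In every round $t$ of block $b$, learner $i$ samples $\mathbf{u}_{t,i}$ uniformly from $\mathcal{B}$, plays $\mathbf{x}_{i,1}(t)=\mathbf{x}_i(b)+\epsilon\mathbf{u}_{t,i}$ and $\mathbf{x}_{i,2}(t)=\mathbf{x}_i(b)-\epsilon\mathbf{u}_{t,i}$, forms $\hat{\mathbf{g}}_{t,i}=\frac{d}{2\epsilon}\big(f_{t,i}(\mathbf{x}_{i,1}(t))-f_{t,i}(\mathbf{x}_{i,2}(t))\big)\mathbf{u}_{t,i}$. Initialize $\mathbf{x}_i(1)=\hat{\mathbf{x}}_i(1)=\mathbf{0}$; learners keep identical copies of $\hat{\mathbf{x}}_j,\hat{\mathbf{y}}_j$ for $j\in\mathcal{N}_i$. After block 1: $\mathbf{z}_i(1)=\sum_{t=1}^L\hat{\mathbf{g}}_{t,i}$, $\mathbf{x}_i(2)=\hat{\mathbf{x}}_i(2)=\mathbf{0}$. Block $b\ge2$: (a) $\mathbf{y}_i^{(1)}(b)=\mathbf{x}_i(b)-\eta_b\mathbf{z}_i(b-1)$, $\hat{\mathbf{y}}_i^{(1)}(b)=\hat{\mathbf{x}}_i(b)$. (b) For $k=1,\dots,L_1$ (one per round): each $j$ sends $\mathcal{C}(\mathbf{y}_j^{(k)}(b)-\hat{\mathbf{y}}_j^{(k)}(b))$, $\hat{\mathbf{y}}_j^{(k+1)}(b)=\hat{\mathbf{y}}_j^{(k)}(b)+$ that message, $\mathbf{y}_i^{(k+1)}(b)=\mathbf{y}_i^{(k)}(b)+\gamma\sum_{j\in\mathcal{N}_i}P_{ij}(\hat{\mathbf{y}}_j^{(k+1)}(b)-\hat{\mathbf{y}}_i^{(k+1)}(b))$.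 (c) $\mathbf{r}_i(b+1)=\Pi_{\mathcal{X}_\zeta}(\mathbf{y}_i^{(L_1+1)}(b))-\mathbf{y}_i^{(L_1+1)}(b)$, $\mathbf{r}_i^{(1)}(b+1)=\mathbf{0}$; for $k=1,\dots,L_2$ (one per round): send $\Delta_i^{(k)}(b)=\mathcal{C}(\mathbf{r}_i(b+1)-\mathbf{r}_i^{(k)}(b+1))$, $\mathbf{r}_i^{(k+1)}(b+1)=\mathbf{r}_i^{(k)}(b+1)+\Delta_i^{(k)}(b)$. (d) End of block: $\hat{\mathbf{x}}_j(b+1)=\hat{\mathbf{y}}_j^{(L_1+1)}(b)+\mathbf{r}_j^{(L_2+1)}(b+1)$, $\mathbf{z}_i(b)=\sum_{t=(b-1)L+1}^{bL}\hat{\mathbf{g}}_{t,i}$, $\mathbf{x}_i(b+1)=\Pi_{\mathcal{X}_\zeta}(\mathbf{y}_i^{(L_1+1)}(b))$. $\mathbb{E}$ is over compressor randomness and sampled $\mathbf{u}_{t,i}$. $O(\cdot)$ hides constant factors not depending on $n,T,d,\omega,\rho$. *)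

(* Defs.v *)
From HB Require Import structures.
From mathcomp Require Import all_boot all_order all_algebra.
From mathcomp Require Import all_classical all_reals all_analysis.
Set Implicit Arguments.
Unset Strict Implicit.
Unset Printing Implicit Defensive.
Import Order.TTheory GRing.Theory Num.Theory.
Import numFieldNormedType.Exports.
Local Open Scope classical_set_scope.
Local Open Scope ring_scope.

(* Euclidean norm (the library norm on matrices is the sup norm). *)
Definition enorm {R : realType} {d : nat} (v : 'rV[R]_d) : R :=
  Num.sqrt (\sum_(j < d) v ord0 j ^+ 2).

Definition eball {R : realType} (d : nat) (s : R) : set 'rV[R]_d :=
  [set x | enorm x <= s].

Definition Rvec (R : realType) (d : nat) := g_sigma_algebraType (@open 'rV[R]_d).

Definition grad {R : realType} {d : nat} (g : 'rV[R]_d -> R) (x : 'rV[R]_d)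
  : 'rV[R]_d := \row_(j < d) ('d g x (delta_mx 0 j : 'rV[R]_d)).

(* Euclidean projection onto K (the minimiser of the distance; it exists
   and is unique for K nonempty closed convex; default y otherwise). *)
Definition eproj {R : realType} {d : nat} (K : set 'rV[R]_d) (y : 'rV[R]_d)
  : 'rV[R]_d :=
  match pselect (exists p, K p /\ forall z, K z -> enorm (y - p) <= enorm (y - z))
  with
  | left e => sval (cid e)
  | right _ => y
  end.

Definition shrink {R : realType} {d : nat} (zeta : R) (X : set 'rV[R]_d)
  : set 'rV[R]_d := [set (1 - zeta) *: x | x in X].

Fixpoint iter_int {R : realType} (k : nat) (g : (nat -> R) -> \bar R) : \bar R :=
  match k with
  | 0 => g (fun _ => 0)
  | k'.+1 => (\int[@lebesgue_measure R]_x
               iter_int k' (fun y => g (fun j => if j is j'.+1 then y j' else x)))%E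
  end.

Definition leb_d {R : realType} {d : nat} (A : set 'rV[R]_d) : \bar R :=
  iter_int d (fun y => (indic A (\row_(j < d) y (nat_of_ord j)) : R)%:E).

Definition unif_ball {R : realType} {d : nat} (A : set 'rV[R]_d) : R :=
  fine (leb_d (A `&` @eball R d 1)) / fine (leb_d (@eball R d 1)).

Definition is_spectrum {R : realType} {n : nat} (S : 'M[R]_n) (s : seq R) : Prop :=
  char_poly S = \prod_(l <- s) ('X - l%:P).

(* eigenvalues (with multiplicity) of S, when its characteristic polynomial
   splits over R (always the case for symmetric S) *)
Definition spectrum {R : realType} {n : nat} (S : 'M[R]_n) : seq R :=
  match pselect (exists s, is_spectrum S s) with
  | left e => sval (cid e)
  | right _ => [::]
  end.

(* k-th largest singular value (k = 0 : largest), i.e. square root of the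
   k-th largest eigenvalue of A^T A *)
Definition singval {R : realType} {n : nat} (A : 'M[R]_n) (k : nat) : R :=
  Num.sqrt (nth 0 (sort (fun a b : R => b <= a) (spectrum (A^T *m A))) k).

Definition comm_matrix {R : realType} {n : nat} (E : rel 'I_n) (P : 'M[R]_n) : Prop :=
  [/\ P^T = P,
      (forall i j, 0 <= P i j),
      (forall i, \sum_(j < n) P i j = 1) &
      (forall j, \sum_(i < n) P i j = 1)] /\
  [/\ (forall v : 'rV[R]_n, 0 <= (v *m P *m v^T) ord0 ord0),
      (forall i j, ~~ (E i j || (i == j)) -> P i j = 0) &
      singval P 1 < 1].

Definition contractive_compressor {R : realType} {d : nat}
  {dS : measure_display} {S : measurableType dS} (mu : probability S R)
  (C : S -> 'rV[R]_d -> 'rV[R]_d) (om : R) : Prop :=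
  forall x : 'rV[R]_d,
    (\int[mu]_s ((enorm (C s x - x)) ^+ 2)%:E <= ((1 - om) * enorm x ^+ 2)%:E)%E.

(* The randomness u_{t,i} (uniform on the unit ball) and the compressor
   seeds xi_{t,i} (law mu), for 1 <= t <= T, i in [n], are all mutually
   independent: their joint law is the product law (checked on measurable
   rectangles, which generate the product sigma-algebra). *)
Definition indep_randomness {R : realType} {n d : nat}
  {dS : measure_display} {S : measurableType dS} (mu : probability S R)
  {dO : measure_display} {Omega : measurableType dO} (Pr : probability Omega R)
  (T : nat) (u : nat -> 'I_n -> Omega -> Rvec R d) (xi : nat -> 'I_n -> Omega -> S)
  : Prop :=
  forall (A : nat -> 'I_n -> set (Rvec R d)) (B : nat -> 'I_n -> set S),
    (forall t i, measurable (A t i)) -> (forall t i, measurable (B t i)) ->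
    Pr [set w | forall (t : nat) (i : 'I_n), (1 <= t <= T)%N ->
                  A t i (u t i w) /\ B t i (xi t i w)]
    = (\prod_(1 <= t < T.+1) \prod_(i < n)
         (unif_ball (A t i) * fine (mu (B t i))))%:E.

Definition natceil {R : realType} (x : R) : nat := `|Num.ceil x|%N.

(* block containing round t (rounds and blocks numbered from 1) *)
Definition block_of (L t : nat) : nat := (t.-1 %/ L).+1.

Section Algo.
Context {R : realType} {n d : nat} {S : Type}
  (E : rel 'I_n) (P : 'M[R]_n) (C : S -> 'rV[R]_d -> 'rV[R]_d)
  (f : nat -> 'I_n -> 'rV[R]_d -> R)
  (gamma eta zeta eps : R) (L1 L2 : nat) (X : set 'rV[R]_d)
  (u : nat -> 'I_n -> 'rV[R]_d) (xi : nat -> 'I_n -> S).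

Let L := (L1 + L2)%N.

Definition ghat (t : nat) (i : 'I_n) (x : 'rV[R]_d) : 'rV[R]_d :=
  (d%:R / (2 * eps) * (f t i (x + eps *: u t i) - f t i (x - eps *: u t i)))
    *: u t i.

Definition zsum (b : nat) (x : 'I_n -> 'rV[R]_d) (i : 'I_n) : 'rV[R]_d :=
  \sum_((b.-1 * L).+1 <= t < (b * L).+1) ghat t i (x i).

Fixpoint consensus (b : nat) (y1 yh1 : 'I_n -> 'rV[R]_d) (k : nat)
  : ('I_n -> 'rV[R]_d) * ('I_n -> 'rV[R]_d) :=
  match k with
  | 0 => (y1, yh1)
  | k'.+1 =>
      let '(y, yh) := consensus b y1 yh1 k' in
      let t := (b.-1 * L + k'.+1)%N in
      let yh' := fun j => yh j + C (xi t j) (y j - yh j) in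
      (fun i => y i + gamma *: \sum_(j < n | E i j || (j == i)) P i j *: (yh' j - yh' i),
       yh')
  end.

Fixpoint rphase (b : nat) (rt : 'I_n -> 'rV[R]_d) (k : nat) : 'I_n -> 'rV[R]_d :=
  match k with
  | 0 => fun _ => 0
  | k'.+1 =>
      let r := rphase b rt k' in
      let t := (b.-1 * L + L1 + k'.+1)%N in
      fun i => r i + C (xi t i) (rt i - r i)
  end.

Definition block_update (b : nat) (x xh zp : 'I_n -> 'rV[R]_d)
  : ('I_n -> 'rV[R]_d) * ('I_n -> 'rV[R]_d) :=
  let '(y, yh) := consensus b (fun i => x i - eta *: zp i) xh L1 in
  let xnew := fun i => eproj (shrink zeta X) (y i) in
  let rr := rphase b (fun i => xnew i - y i) L2 in
  (xnew, fun j => yh j + rr j).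

(* run b = (x(b), xhat(b), z(b-1)) *)
Fixpoint run (b : nat)
  : ('I_n -> 'rV[R]_d) * ('I_n -> 'rV[R]_d) * ('I_n -> 'rV[R]_d) :=
  match b with
  | 0 => (fun _ => 0, fun _ => 0, fun _ => 0)
  | 1 => (fun _ => 0, fun _ => 0, fun _ => 0)
  | b'.+1 =>
      let '(x, xh, zp) := run b' in
      let '(x', xh') :=
        if b' == 1%N then ((fun _ : 'I_n => 0 : 'rV[R]_d), (fun _ : 'I_n => 0 : 'rV[R]_d))
        else block_update b' x xh zp in
      (x', xh', zsum b' x)
  end.

Definition xblock (b : nat) (i : 'I_n) : 'rV[R]_d := (run b).1.1 i.

Definition regret2 (T : nat) (i : 'I_n) : R :=
  \sum_(1 <= t < T.+1) \sum_(j < n)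
     (f t j (xblock (block_of L t) i + eps *: u t i)
      + f t j (xblock (block_of L t) i - eps *: u t i)) / 2
  - inf [set (\sum_(1 <= t < T.+1) \sum_(j < n) f t j x) | x in X].

End Algo.

(* Main.v *)
Require Import Defs.
From HB Require Import structures.
From mathcomp Require Import all_boot all_order all_algebra.
From mathcomp Require Import all_classical all_reals all_analysis.
From mathcomp Require Import measurable_realfun ring lra complex.
Import Order.TTheory GRing.Theory Num.Theory.
Import numFieldNormedType.Exports.
Local Open Scope classical_set_scope.
Local Open Scope ring_scope.

(* The iterates satisfy a descent inequality for sum_i |x_i(b) - x*|^2, where the
   errors are the consensus error sum_i |y_i - avg y|^2 and the compression error
   sum_i |y_i - yhat_i|^2.  Their sum contracts in expectation by 1 - gamma rho / 2
   in each gossip round; L_1 and L_2 are just large enough that one block divides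
   it by a multiple of n, so that in every block it stays O(q^2), where
   q = eta L d G bounds the step of a block and q^2 = Rad^2 L / T.

   The law of the sampled direction is uniform on the ball, not on the sphere, so
   the estimator is not the gradient of the usual smoothed loss.  Comparing the
   integrals of the loss over translates of the ball (a discrete integration by
   parts against 1 - |u|^2) shows that, in expectation, the estimator satisfies
   the linear lower bound f x - f y - 2 G eps <= cinv <ghat, x - y>, with a constant
   cinv <= 3.  Summing, E R_2 = O(n d sqrt (L T)), and L = O(ln n / (omega rho^2)). *)

(** * Euclidean geometry and projections *)

(** For the ball law, [u] is up to a constant minus the gradient of 1 - |u|^2, so the estimator
    behaves like a multiple of the gradient of the loss averaged with that weight; the multiple is
    at least d / (d + 2), whence [cinv] <= (d + 2) / d <= 3. Comparing translates instead of
    differentiating an average lets convexity supply a one-sided bound directly. The gradient sum of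
    block b is taken at x(b) but applied in block b + 1. The comparator is (1 - zeta) times a
    minimiser, which lies in the shrunken set. Measurability is the other obstacle: the losses are
    arbitrary outside X, and the directions lie in the ball only almost surely. Hence every estimate
    is first proved pathwise, with a nonnegative measurable majorant on the right, and only the
    majorant is integrated. The one signed term, loss gap minus its linear lower bound, is made
    nonnegative by adding a uniform bound, which cancels at the end. *)

Section Euclid.
Context {R : realType} {d : nat}.
Implicit Types u v w x y z : 'rV[R]_d.

Definition dot u v : R := \sum_(j < d) u ord0 j * v ord0 j.

Lemma dotC u v : dot u v = dot v u.
Proof. by apply: eq_bigr => j _; rewrite mulrC. Qed.

Lemma dotDl u v w : dot (u + v) w = dot u w + dot v w.
Proof. by rewrite -big_split; apply: eq_bigr => j _; rewrite mxE mulrDl. Qed.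

Lemma dotZl a u v : dot (a *: u) v = a * dot u v.
Proof. by rewrite mulr_sumr; apply: eq_bigr => j _; rewrite mxE mulrA. Qed.

Lemma dotNl u v : dot (- u) v = - dot u v.
Proof. by rewrite -scaleN1r dotZl mulN1r. Qed.

Lemma dotDr u v w : dot u (v + w) = dot u v + dot u w.
Proof. by rewrite dotC dotDl !(dotC u). Qed.

Lemma dotZr a u v : dot u (a *: v) = a * dot u v.
Proof. by rewrite dotC dotZl dotC. Qed.

Lemma dotNr u v : dot u (- v) = - dot u v.
Proof. by rewrite dotC dotNl dotC. Qed.

Lemma dot0l u : dot 0 u = 0.
Proof. by rewrite -(scale0r 0) dotZl mul0r. Qed.

Lemma dot_suml (I : Type) (s : seq I) (Q : pred I) (F : I -> 'rV[R]_d) u :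
  dot (\sum_(i <- s | Q i) F i) u = \sum_(i <- s | Q i) dot (F i) u.
Proof.
by apply: (big_morph (dot^~ u)) => [a b|]; rewrite ?dotDl ?dot0l.
Qed.

Lemma dot_ge0 u : 0 <= dot u u.
Proof. by apply: sumr_ge0 => j _; rewrite -expr2 sqr_ge0. Qed.

Lemma enorm_ge0 u : 0 <= enorm u.
Proof. exact: sqrtr_ge0. Qed.

Lemma enorm_sqr u : enorm u ^+ 2 = dot u u.
Proof.
rewrite /enorm sqr_sqrtr; last by apply: sumr_ge0 => j _; rewrite sqr_ge0.
by apply: eq_bigr => j _; rewrite expr2.
Qed.

Lemma enormE u : enorm u = Num.sqrt (dot u u).
Proof. by congr Num.sqrt; apply: eq_bigr => j _; rewrite expr2. Qed.

Lemma dot_sqrBZ (t : R) u v :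
  dot (u - t *: v) (u - t *: v) = dot u u - 2 * t * dot u v + t ^+ 2 * dot v v.
Proof. by rewrite !(dotDl, dotDr, dotNl, dotNr, dotZl, dotZr) (dotC v u); ring. Qed.

Lemma dot_CS u v : dot u v ^+ 2 <= dot u u * dot v v.
Proof.
have H t : 0 <= dot u u * t ^+ 2 - 2 * t * dot u v + dot v v.
  have := dot_ge0 (t *: u - v).
  rewrite !(dotDl, dotDr, dotNl, dotNr, dotZl, dotZr) (dotC v u) => h.
  by apply: le_trans h _; rewrite le_eqVlt; apply/orP; left; apply/eqP; ring.
have [u0|u0] := eqVneq (dot u u) 0.
  have [->|uv0] := eqVneq (dot u v) 0; first by rewrite u0 expr0n /= mul0r.
  (* With [dot u u = 0] the quadratic is affine in [t], and this [t] gives it the negative value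
     [- dot v v - 2]. *)
  have := H ((dot v v + 1) / dot u v); rewrite u0 mul0r add0r.
  have := dot_ge0 v; set a := dot u v in uv0 *; set b := dot v v.
  have -> : 2 * ((b + 1) / a) * a = 2 * (b + 1) by field.
  lra.
have up : 0 < dot u u by rewrite lt_def u0 dot_ge0.
have := H (dot u v / dot u u).
set a := dot u v; set b := dot v v; set c := dot u u in u0 up *.
have -> : c * (a / c) ^+ 2 - 2 * (a / c) * a + b = (c * b - a ^+ 2) / c by field.
by rewrite pmulr_lge0 ?invr_gt0// subr_ge0.
Qed.

Lemma dot_abs_le u v : `|dot u v| <= enorm u * enorm v.
Proof.
rewrite -ler_sqr ?nnegrE ?normr_ge0 ?mulr_ge0 ?enorm_ge0//.
by rewrite exprMn !enorm_sqr real_normK ?num_real// dot_CS.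
Qed.

Lemma dot_le u v : dot u v <= enorm u * enorm v.
Proof. exact: le_trans (ler_norm _) (dot_abs_le u v). Qed.

Lemma enorm0 : enorm (0 : 'rV[R]_d) = 0.
Proof. by rewrite enormE dot0l sqrtr0. Qed.

Lemma enormN u : enorm (- u) = enorm u.
Proof. by rewrite !enormE dotNl dotNr opprK. Qed.

Lemma enormZ a u : enorm (a *: u) = `|a| * enorm u.
Proof. by rewrite !enormE dotZl dotZr mulrA -expr2 sqrtrM ?sqr_ge0// sqrtr_sqr. Qed.

Lemma enormD u v : enorm (u + v) <= enorm u + enorm v.
Proof.
rewrite -ler_sqr ?nnegrE ?addr_ge0 ?enorm_ge0// sqrrD !enorm_sqr dotDl !dotDr.
rewrite (dotC v u); have := dot_le u v; lra.
Qed.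

Lemma enormB u v : enorm (u - v) <= enorm u + enorm v.
Proof. by rewrite -(enormN v) enormD. Qed.

Lemma enorm_distC u v : enorm (u - v) = enorm (v - u).
Proof. by rewrite -enormN opprB. Qed.

Lemma enorm_triangle w u v : enorm (u - v) <= enorm (u - w) + enorm (w - v).
Proof. by rewrite -(subrKA w) enormD. Qed.

Lemma enorm_eq0 u : enorm u = 0 -> u = 0.
Proof.
move=> u0; have := enorm_sqr u; rewrite u0 expr0n /= => /esym/eqP.
rewrite psumr_eq0 => [/allP h|j _]; last by rewrite -expr2 sqr_ge0.
apply/rowP => j; rewrite !mxE.
by have := h j (mem_index_enum _); rewrite -expr2 sqrf_eq0 => /eqP.
Qed.

Lemma enorm_leE u v : (enorm u <= enorm v) = (dot u u <= dot v v).
Proof. by rewrite -!enorm_sqr ler_sqr ?nnegrE ?enorm_ge0. Qed.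

Lemma coord_le_enorm u j : `|u ord0 j| <= enorm u.
Proof.
rewrite -ler_sqr ?nnegrE ?enorm_ge0// enorm_sqr real_normK ?num_real//.
rewrite /dot (bigD1 j)//= -expr2 lerDl.
by apply: sumr_ge0 => i _; rewrite -expr2 sqr_ge0.
Qed.

(** The difference of the two sides is |a u - v|^2 / a. *)
Lemma enormD_sqr_young (a : R) u v : 0 < a ->
  enorm (u + v) ^+ 2 <= (1 + a) * enorm u ^+ 2 + (1 + a^-1) * enorm v ^+ 2.
Proof.
move=> a0; rewrite !enorm_sqr.
have := dot_ge0 (a *: u - v).
rewrite !(dotDl, dotDr, dotNl, dotNr, dotZl, dotZr) (dotC v u).
set p := dot u u; set q := dot u v; set s := dot v v => h.
rewrite -subr_ge0.
have -> : (1 + a) * p + (1 + a^-1) * s - (p + q + (q + s)) =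
  (a * (a * p) + - (a * q) - (a * q - s)) / a by field; rewrite gt_eqF.
by rewrite divr_ge0// ?(ltW a0)//; lra.
Qed.

Lemma enormD_sqr u v : enorm (u + v) ^+ 2 <= 2 * enorm u ^+ 2 + 2 * enorm v ^+ 2.
Proof. by have := enormD_sqr_young 1 u v ltr01; rewrite invr1. Qed.

End Euclid.

Section Projection.
Context {R : realType} {d : nat}.
Implicit Types u v w x y z p : 'rV[R]_d.

Lemma continuous_enorm : continuous (@enorm R d).
Proof.
move=> x; rewrite /enorm.
apply: continuous_comp; last exact: sqrt_continuous.
apply: (@continuous_big _ _ (+%R : R -> R -> R)); first by move=> a; apply: add_continuous.
move=> j _ y; apply: (@continuous_comp _ _ _ (fun y : 'rV[R]_d => y ord0 j) (fun a : R => a ^+ 2)).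
  exact: coord_continuous.
exact: exprn_continuous.
Qed.

Definition cvx_set (K : set 'rV[R]_d) := forall x y (t : R), K x -> K y ->
  0 <= t <= 1 -> K (t *: x + (1 - t) *: y).

Lemma enorm_bounded_compact (K : set 'rV[R]_d) (s : R) :
  closed K -> (forall x, K x -> enorm x <= s) -> compact K.
Proof.
move=> cK bK; apply: bounded_closed_compact => //.
exists s; split; first exact: num_real.
move=> t st x Kx; rewrite /= [leLHS]/Num.Def.normr/= mx_normrE.
have t0 : 0 <= t by rewrite (le_trans (enorm_ge0 x))// (le_trans (bK _ Kx))// ltW.
apply: bigmax_le => // -[i j] _ /=; rewrite ord1.
by rewrite (le_trans (coord_le_enorm _ _))// (le_trans (bK _ Kx))// ltW.
Qed.

Section eproj.
Variable K : set 'rV[R]_d.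
Hypotheses (K0 : K !=set0) (cK : compact K) (convK : cvx_set K).

Lemma eproj_spec y : K (eproj K y) /\
  forall z, K z -> enorm (y - eproj K y) <= enorm (y - z).
Proof.
rewrite /eproj; case: pselect => [e|ne]; first by case: (cid e).
exfalso; apply: ne.
have [|c cinK cmin] := @EVT_min_rV R d (fun z => enorm (y - z)) K K0 cK.
  apply: continuous_subspaceT => z.
  apply: (@continuous_comp _ _ _ (fun z => y - z) (@enorm R d)); last exact: continuous_enorm.
  by apply: continuousB => //; apply: cst_continuous.
by exists c; split=> [|z Kz]; [exact: set_mem|apply: cmin; exact: mem_set].
Qed.

Lemma eproj_in y : K (eproj K y).
Proof. by case: (eproj_spec y). Qed.

Lemma eproj_min y z : K z -> enorm (y - eproj K y) <= enorm (y - z).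
Proof. by case: (eproj_spec y) => _; apply. Qed.

(** Moving from the projection towards [z] by a fraction [t] stays in [K] and cannot bring the point
    closer to [y]; to first order in [t] this is the inequality. *)
Lemma eproj_variational y z : K z -> dot (y - eproj K y) (z - eproj K y) <= 0.
Proof.
move=> Kz; set p := eproj K y.
set c := dot (y - p) (z - p); set N := dot (z - p) (z - p).
have N0 : 0 <= N := dot_ge0 _.
have key t : 0 <= t <= 1 -> 2 * t * c <= t ^+ 2 * N.
  move=> t01; have := eproj_min y _ (convK _ _ _ Kz (eproj_in y) t01).
  rewrite -/p enorm_leE.
  have -> : y - (t *: z + (1 - t) *: p) = (y - p) - t *: (z - p).
    by rewrite scalerBl scale1r scalerBr; apply/rowP => j; rewrite !mxE; ring.
  rewrite dot_sqrBZ.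
  rewrite -/c -/N; lra.
rewrite leNgt; apply/negP => c0.
have Nc : 0 < N + c by lra.
(* Any positive [t] below 2c / N that is at most 1 gives a contradiction; this choice needs no case
   distinction on [N = 0]. *)
have := key (c / (N + c)).
have -> : 0 <= c / (N + c) <= 1.
  by rewrite divr_ge0 ?(ltW c0) ?(ltW Nc)//= ler_pdivrMr// mul1r lerDr.
move=> /(_ isT); rewrite -subr_le0.
have -> : 2 * (c / (N + c)) * c - (c / (N + c)) ^+ 2 * N
   = c ^+ 2 * (N + 2 * c) / (N + c) ^+ 2 by field; rewrite gt_eqF.
by apply/negP; rewrite -ltNge !mulr_gt0 ?invr_gt0 ?exprn_gt0//; lra.
Qed.

(** The variational inequalities at the two projections add up to |p - q|^2 <= <y - z, p - q>;
    Cauchy-Schwarz concludes. *)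
Lemma eproj_nonexpansive y z : enorm (eproj K y - eproj K z) <= enorm (y - z).
Proof.
set p := eproj K y; set q := eproj K z.
have := eproj_variational y q (eproj_in z); have := eproj_variational z p (eproj_in y).
rewrite -/p -/q => h1 h2.
have h3 : dot (p - q) (p - q) <= dot (y - z) (p - q).
  have gen a b e : dot a (- e) <= 0 -> dot b e <= 0 -> dot e e <= dot (a - b + e) e.
    by rewrite !dotDl dotNl dotNr; lra.
  have -> : y - z = (y - p) - (z - q) + (p - q) by apply/rowP => j; rewrite !mxE; ring.
  by apply: gen; rewrite ?opprB.
have [->|pq0] := eqVneq (enorm (p - q)) 0; first exact: enorm_ge0.
have pq : 0 < enorm (p - q) by rewrite lt_def pq0 enorm_ge0.
rewrite -(ler_pM2r pq) -expr2 enorm_sqr.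
exact: le_trans h3 (dot_le _ _).
Qed.

Lemma eproj_id z : K z -> eproj K z = z.
Proof.
move=> Kz; have := eproj_min z z Kz; rewrite subrr enorm0 => h.
by apply/esym/subr0_eq/enorm_eq0/eqP; rewrite eq_le h enorm_ge0.
Qed.

Lemma eproj_le y z : K z -> enorm (eproj K y - z) <= enorm (y - z).
Proof. by move=> Kz; have := eproj_nonexpansive y z; rewrite (eproj_id z Kz). Qed.

Lemma continuous_eproj : continuous (eproj K).
Proof.
move=> x; apply/(@cvgrPdist_lt _ _ _ (nbhs x)) => e e0.
have : enorm (x - y) @[y --> x] --> enorm (x - x).
  apply: (@continuous_comp _ _ _ (fun y => x - y) (@enorm R d)); last exact: continuous_enorm.
  by apply: continuousB => //; apply: cst_continuous.
rewrite subrr enorm0 => /cvgr_lt /(_ e e0); apply: filterS => y xy.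
apply: le_lt_trans xy.
apply: le_trans (eproj_nonexpansive x y).
have := enorm_ge0 (eproj K x - eproj K y).
move=> h; rewrite /= [leLHS]/Num.Def.normr/= mx_normrE.
apply: bigmax_le => // -[i j] _ /=; rewrite ord1; exact: coord_le_enorm.
Qed.

End eproj.

Section shrink.
Variables (X : set 'rV[R]_d) (zeta : R).
Hypotheses (cX : compact X) (convX : cvx_set X).

Lemma shrink_compact : compact (shrink zeta X).
Proof.
apply: continuous_compact => //; apply: continuous_subspaceT.
by move=> x; apply: scaler_continuous.
Qed.

Lemma shrink_convex : cvx_set (shrink zeta X).
Proof.
move=> _ _ t [x Xx <-] [y Xy <-] t01; exists (t *: x + (1 - t) *: y); first exact: convX.
by rewrite scalerDr !scalerA mulrC [(1 - t) * _]mulrC.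
Qed.

Hypothesis z01 : 0 <= zeta <= 1.

(** The point is the convex combination of [y] and [r *: u] with weights 1 - zeta and zeta. With
    zeta = eps / r this keeps the played points in [X]. *)
Lemma shrink_ball (r : R) x u : 0 < r -> @eball R d r `<=` X ->
  shrink zeta X x -> enorm u <= 1 -> X (x + (zeta * r) *: u).
Proof.
move=> r0 rX [y Xy <-] u1.
have -> : zeta * r = (1 - (1 - zeta)) * r by ring.
rewrite -scalerA; apply: convX => //; last by case/andP: z01 => ? ?; apply/andP; split; lra.
apply: rX; rewrite /eball /= enormZ gtr0_norm//.
by rewrite -[leRHS]mulr1 ler_pM2l.
Qed.

End shrink.

Section Lipschitz.
Variables (X : set 'rV[R]_d) (G : R) (f : 'rV[R]_d -> R).
Hypothesis fcvx : forall x y (t : R), X x -> X y -> 0 <= t <= 1 ->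
  f (t *: x + (1 - t) *: y) <= t * f x + (1 - t) * f y.

Lemma diff_grad x v : differentiable f x -> 'd f x v = dot (grad f x) v.
Proof.
move=> dfx.
have -> : v = \sum_(j < d) v ord0 j *: (delta_mx 0 j : 'rV[R]_d).
  exact: row_sum_delta.
rewrite linear_sum /dot; apply: eq_bigr => j _.
rewrite linearZ /= mxE mulrC summxE (bigD1 j)//= !mxE !eqxx mulr1 big1 ?addr0// => i ij.
by rewrite !mxE (_ : (j == i) = false) ?andbF ?mulr0// eq_sym; apply/negbTE.
Qed.

(** By convexity the difference quotients towards [y] are at most f y - f x. The limit is taken from
    the right because only 0 < t <= 1 stays on the segment, where convexity is known. *)
Lemma convex_grad_ineq x y : X x -> X y -> differentiable f x ->
  f x + dot (grad f x) (y - x) <= f y.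
Proof.
move=> Xx Xy dfx; rewrite -diff_grad//.
have dv : derivable f x (y - x) by exact: diff_derivable.
rewrite -deriveE// addrC -lerBrDr.
have h : h^-1 *: ((f \o shift x) (h *: (y - x)) - f x) @[h --> (0:R)^'+] --> 'D_(y - x) f x.
  by apply: cvg_dnbhs_at_right; exact: dv.
rewrite -(cvg_lim _ h)//; apply: limr_le; first by apply/cvg_ex; eexists; exact: h.
near=> t; have t0 : 0 < t by near: t; exact: nbhs_right_gt.
have t1 : t <= 1 by near: t; apply: nbhs_right_le; exact: ltr01.
rewrite /= /GRing.scale/= ler_pdivrMl//.
have -> : t *: (y - x) + x = t *: y + (1 - t) *: x.
  by rewrite scalerBr scalerBl scale1r; apply/rowP => j; rewrite !mxE; ring.
have := fcvx y x t Xy Xx; rewrite (ltW t0) t1 => /(_ isT); lra.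
Unshelve. all: by end_near. Qed.

Hypothesis fdiff : forall x, X x -> differentiable f x /\ enorm (grad f x) <= G.

(** The gradient inequality at each of the two points bounds one sign of the difference, so no mean
    value argument is involved. *)
Lemma convex_lipschitz x y : X x -> X y -> `|f x - f y| <= G * enorm (x - y).
Proof.
have H a b : X a -> X b -> f a - f b <= G * enorm (a - b).
  move=> Xa Xb; have [dfa Ga] := fdiff a Xa.
  have := convex_grad_ineq a b Xa Xb dfa.
  have := dot_abs_le (grad f a) (b - a); rewrite ler_norml => /andP[h _] h'.
  have : enorm (grad f a) * enorm (b - a) <= G * enorm (a - b).
    by rewrite enorm_distC ler_wpM2r ?enorm_ge0.
  lra.
move=> Xx Xy; rewrite ler_norml; apply/andP; split; last exact: H.
by rewrite enorm_distC lerNl opprB; exact: H.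
Qed.

End Lipschitz.
End Projection.

(** * Spectral estimates for the communication matrix *)

Section RealSpectral.
Context {R : realType} {n : nat}.
Implicit Types (u v e : 'rV[R]_n) (S : 'M[R]_n).

Local Notation toC := (real_complex R).

Lemma char_poly_conj (F : fieldType) (U A : 'M[F]_n) : U \in unitmx ->
  char_poly (invmx U *m A *m U) = char_poly A.
Proof.
move=> uU; rewrite /char_poly.
have -> : char_poly_mx (invmx U *m A *m U) =
   map_mx polyC (invmx U) *m char_poly_mx A *m map_mx polyC U.
  rewrite /char_poly_mx !map_mxM mulmxBr mulmxBl; congr (_ - _).
  by rewrite -[_ *m _%:M *m _]mulmxA -scalar_mxC mulmxA -map_mxM mulVmx// map_mx1 mul1mx.
rewrite !det_mulmx !det_map_mx mulrAC -polyCM -det_mulmx mulVmx//.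
by rewrite det1 mul1r.
Qed.

(** The spectral theorem over [R[i]] gives a unitary eigenbasis that need not be real; [p] and [q]
    are the real and imaginary parts of the coordinates in it. The third and fourth clauses are the
    real and imaginary parts of Parseval's identity for real vectors. *)
Lemma real_spectral S : S^T = S ->
  exists (l : 'I_n -> R) (p q : 'rV[R]_n -> 'I_n -> R),
  [/\ forall v i, p (v *m S) i = l i * p v i,
      forall v i, q (v *m S) i = l i * q v i,
      forall u v, dot u v = \sum_i (p u i * p v i + q u i * q v i),
      forall u v, \sum_i (q u i * p v i - p u i * q v i) = 0 &
      char_poly S = \prod_i ('X - (l i)%:P)].
Proof.
move=> symS; set SC := map_mx toC S.
have hS : SC \is hermsymmx.
  apply: realsym_hermsym.
    by apply/is_hermitianmxP; rewrite expr0 scale1r map_mx_id// /SC map_trmx symS.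
  by apply/mxOverP => i j; rewrite mxE complex_real.
have /orthomx_spectralP := hermitian_normalmx hS.
set U := spectralmx SC; set D := spectral_diag SC => SE.
have uU : U \is unitarymx := spectral_unitarymx SC.
have Dreal : D \is a realmx := hermitian_spectral_diag_real hS.
have UU := spectral_unit SC.
pose w v : 'rV[R[i]]_n := map_mx toC v *m invmx U.
have DE i : D 0 i = (complex.Re (D 0 i))%:C%C.
  by rewrite RRe_real//; apply/mxOverP.
have wS v i : w (v *m S) 0 i = (complex.Re (D 0 i))%:C%C * w v 0 i.
  rewrite /w map_mxM -/SC SE !mulmxA mulmxK//.
  rewrite [RHS]mulrC -DE mul_mx_diag !mxE.
  by [].
have wdot u v : (dot u v)%:C%C = \sum_i w u 0 i * (w v 0 i)^*%C.
  have -> : \sum_i w u 0 i * (w v 0 i)^*%C = (w u *m ((w v)^T ^ (@Num.conj _))%sesqui) 0 0.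
    by rewrite mxE; apply: eq_bigr => i _; rewrite !mxE.
  rewrite /w trmx_mul map_mxM invmx_unitary// trmxCK mulmxA mulmxKtV//.
  rewrite mxE /dot rmorph_sum; apply: eq_bigr => i _.
  by rewrite !mxE rmorphM/=; congr (_ * _); apply/esym; exact: conjc_real.
have cmul (x y : R[i]) : x * y^*%C = ((complex.Re x * complex.Re y + complex.Im x * complex.Im y)
    +i* (complex.Im x * complex.Re y - complex.Re x * complex.Im y))%C.
  by case: x y => [a b] [c e]; simpc; rewrite [- _ + _]addrC.
exists (fun i => complex.Re (D 0 i)); exists (fun v i => complex.Re (w v 0 i)).
exists (fun v i => complex.Im (w v 0 i)).
split.
- by move=> v i; rewrite wS; case: (w v 0 i) => a b; simpc.
- by move=> v i; rewrite wS; case: (w v 0 i) => a b; simpc.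
- move=> u v; have := congr1 (@complex.Re R) (wdot u v); rewrite /= => ->.
  rewrite (raddf_sum (@complex.Re R : {additive _ -> _})).
  by apply: eq_bigr => i _; rewrite cmul.
- move=> u v; rewrite [RHS](_ : 0 = complex.Im (dot u v)%:C%C)// wdot.
  rewrite (raddf_sum (@complex.Im R : {additive _ -> _})).
  by apply: eq_bigr => i _; rewrite cmul.
- apply: (map_poly_inj (toC : {rmorphism R -> R[i]})); rewrite map_char_poly -/SC SE char_poly_conj//.
  rewrite char_poly_trig ?diag_mx_is_trig// rmorph_prod; apply: eq_bigr => i _.
  by rewrite rmorphB/= map_polyX map_polyC/= -DE mxE eqxx mulr1n.
Qed.

Lemma spectrumP S : S^T = S -> is_spectrum S (spectrum S).
Proof.
move=> /real_spectral[l [p [q [_ _ _ _ cS]]]].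
rewrite /spectrum; case: pselect => [e|ne]; first by case: (cid e).
by exfalso; apply: ne; exists (codom l); rewrite /is_spectrum cS /codom big_image.
Qed.

Definition eigs S := sort (fun a b : R => b <= a) (spectrum S).

(** [spectrum] is a list obtained by choice; unique factorisation of the characteristic polynomial
    identifies it, up to order, with the eigenvalues of [real_spectral]. *)
Lemma eigs_perm S (l : 'I_n -> R) : S^T = S -> char_poly S = \prod_i ('X - (l i)%:P) ->
  perm_eq (eigs S) (codom l).
Proof.
move=> /spectrumP; rewrite /is_spectrum => -> h.
rewrite perm_sort; apply: prod_XsubC_eq; rewrite h /codom big_image.
by [].
Qed.

Lemma eigs_sorted S : sorted (fun a b : R => b <= a) (eigs S).
Proof. by apply: sort_sorted => a b; exact: le_total. Qed.

Lemma eigs_nth_le S i j : (i <= j < size (eigs S))%N -> nth 0 (eigs S) j <= nth 0 (eigs S) i.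
Proof.
move=> /andP[ij js].
apply: (@sorted_leq_nth R (fun a b : R => b <= a)) => //.
- by move=> a b c ab bc; exact: le_trans bc ab.
- exact: eigs_sorted.
- by rewrite inE (leq_ltn_trans ij).
Qed.

Lemma quad_form_le S v : S^T = S -> dot (v *m S) v <= nth 0 (eigs S) 0 * dot v v.
Proof.
move=> symS; have [l [p [q [pS qS dE _ cS]]]] := real_spectral S symS.
have pe := eigs_perm S l symS cS.
rewrite !dE mulr_sumr; apply: ler_sum => i _; rewrite pS qS.
have : l i \in eigs S by rewrite (perm_mem pe) codom_f.
move=> /(nthP 0)[k ks lE].
have := eigs_nth_le S 0 k; rewrite ks lE => /(_ isT) h.
rewrite -!mulrA -mulrDr ler_wpM2r// addr_ge0// -expr2 sqr_ge0//.
Qed.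

(** At most one eigenvalue exceeds the second largest one, and the eigenvalue 1 of [e] does. So [e]
    has a single nonzero coordinate in the eigenbasis, and a vector orthogonal to [e] vanishes
    there. *)
Lemma quad_form_orth_le S e v : S^T = S -> e *m S = e -> e != 0 -> nth 0 (eigs S) 1 < 1 ->
  dot v e = 0 -> dot (v *m S) v <= nth 0 (eigs S) 1 * dot v v.
Proof.
move=> symS eS e0 s1 ve; have [l [p [q [pS qS dE iE cS]]]] := real_spectral S symS.
have pe := eigs_perm S l symS cS.
have peq i : (l i - 1) * p e i = 0 by rewrite mulrBl mul1r -pS eS subrr.
have qeq i : (l i - 1) * q e i = 0 by rewrite mulrBl mul1r -qS eS subrr.
have nth1 : forall k, (1 <= k < size (eigs S))%N -> nth 0 (eigs S) k <= nth 0 (eigs S) 1.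
  by move=> k hk; exact: eigs_nth_le.
(* In a decreasing list only the head can exceed the entry at position 1. *)
have cnt : (count (fun a => nth 0 (eigs S) 1 < a)%R (eigs S) <= 1)%N.
  move: nth1; case: (eigs S) => [//|a s] /= h.
  suff -> : count (fun a => nth 0 s 0 < a)%R s = 0%N by rewrite addn0; case: (_ < _).
  apply/eqP; rewrite -leqn0 leqNgt -has_count; apply/hasPn => x /(nthP 0)[k ks <-].
  by rewrite -leNgt; exact: (h k.+1).
have [i0 ei0] : exists i0, p e i0 ^+ 2 + q e i0 ^+ 2 != 0.
  apply/existsP; apply: contraT => /existsPn h; exfalso; move/eqP: e0; apply; apply: enorm_eq0.
  rewrite enormE dE big1 ?sqrtr0// => i _.
  by have := h i; rewrite negbK -!expr2 => /eqP.
have li0 : l i0 = 1.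
  apply/eqP; rewrite -subr_eq0; apply: contraT => h; exfalso; move/negP: ei0; apply.
  have := peq i0; have := qeq i0.
  move=> /eqP; rewrite mulf_eq0 (negbTE h) /= => /eqP ->.
  by move=> /eqP; rewrite mulf_eq0 (negbTE h) /= => /eqP ->; rewrite expr0n /= addr0.
have lle i : i != i0 -> l i <= nth 0 (eigs S) 1.
  move=> ii0; rewrite leNgt; apply/negP => h; move: cnt; rewrite leqNgt => /negP; apply.
  rewrite (permP pe) /codom count_map -size_filter.
  rewrite (_ : size _ = #|[pred i | nth 0 (eigs S) 1 < l i]%R|); last by rewrite cardE enumT.
  by apply/card_gt1P; exists i, i0; split=> //; rewrite inE// li0.
have e_eq0 i : i != i0 -> p e i = 0 /\ q e i = 0.
  move=> /lle h; have h1 : l i - 1 != 0 by rewrite subr_eq0 lt_eqF// (le_lt_trans h).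
  have := peq i; have := qeq i.
  move=> /eqP; rewrite mulf_eq0 (negbTE h1) /= => /eqP ->.
  by move=> /eqP; rewrite mulf_eq0 (negbTE h1) /= => /eqP ->.
have v0 : p v i0 = 0 /\ q v i0 = 0.
  have := ve; have := iE v e; rewrite dE.
  rewrite (bigD1 i0)//= big1 ?addr0; last by move=> i /e_eq0[-> ->]; rewrite !mulr0 subrr.
  rewrite (bigD1 i0)//= big1 ?addr0; last by move=> i /e_eq0[-> ->]; rewrite !mulr0 addr0.
  (* As complex numbers, (x + i y) times the conjugate of (a + i b) is zero; multiplying back by a +
     i b isolates x and y. *)
  set a := p e i0 in ei0 *; set b := q e i0 in ei0 *; set x := p v i0; set y := q v i0.
  move=> h1 h2; split; apply: (mulfI ei0); rewrite mulr0.
    have -> : (a ^+ 2 + b ^+ 2) * x = a * (x * a + y * b) - b * (y * a - x * b) by ring.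
    by rewrite h1 h2 !mulr0 subrr.
  have -> : (a ^+ 2 + b ^+ 2) * y = b * (x * a + y * b) + a * (y * a - x * b) by ring.
  by rewrite h1 h2 !mulr0 addr0.
rewrite !dE mulr_sumr; apply: ler_sum => i _; rewrite pS qS.
have [->|/lle h] := eqVneq i i0; first by case: v0 => -> ->; rewrite !mulr0 addr0 mulr0.
by rewrite -!mulrA -mulrDr ler_wpM2r// addr_ge0// -expr2 sqr_ge0.
Qed.

Lemma dot_mulmx u v S : dot (u *m S) v = dot u (v *m S^T).
Proof.
have dotE a b : dot a b = (a *m b^T) ord0 ord0.
  by rewrite mxE; apply: eq_bigr => i _; rewrite !mxE.
by rewrite !dotE trmx_mul trmxK mulmxA.
Qed.

(** Stated as an inequality because [Num.sqrt] is 0 on negative numbers, so the sign of the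
    eigenvalue never has to be settled. *)
Lemma singval_sqr_ge S k : nth 0 (eigs (S^T *m S)) k <= singval S k ^+ 2.
Proof.
rewrite /singval -/(eigs _).
have [h|h] := leP 0 (nth 0 (eigs (S^T *m S)) k); first by rewrite sqr_sqrtr.
by rewrite (ltW (lt_le_trans h _))// sqr_ge0.
Qed.

Lemma singval_top S v : S^T = S -> enorm (v *m S) <= singval S 0 * enorm v.
Proof.
move=> symS; rewrite -ler_sqr ?nnegrE ?mulr_ge0 ?enorm_ge0 ?sqrtr_ge0//.
rewrite exprMn !enorm_sqr dot_mulmx dotC -mulmxA.
have sS : (S *m S^T)^T = S *m S^T by rewrite trmx_mul trmxK.
apply: le_trans (quad_form_le _ _ sS) _; rewrite ler_wpM2r ?dot_ge0//.
by have := singval_sqr_ge S 0; rewrite symS.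
Qed.

End RealSpectral.

Section CommMatrix.
Context {R : realType} {n : nat} (P : 'M[R]_n).
Hypotheses (n2 : (2 <= n)%N) (symP : P^T = P) (P_ge0 : forall i j, 0 <= P i j)
  (rowP1 : forall i, \sum_(j < n) P i j = 1) (sigma1 : singval P 1 < 1).
Implicit Types v : 'rV[R]_n.

Let one : 'rV[R]_n := const_mx 1.

Lemma comm_const (a : R) : const_mx a *m P = const_mx a :> 'rV[R]_n.
Proof.
apply/rowP => j; rewrite !mxE -[RHS]mulr1 -(rowP1 j) mulr_sumr.
by apply: eq_bigr => i _; rewrite !mxE -{1}symP mxE.
Qed.

(** Apply [quad_form_orth_le] to [P *m P], which fixes the constant vectors, on their orthogonal
    complement. *)
Lemma comm_contract_orth v : \sum_i v ord0 i = 0 ->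
  enorm (v *m P) <= singval P 1 * enorm v.
Proof.
move=> v0; rewrite -ler_sqr ?nnegrE ?mulr_ge0 ?enorm_ge0 ?sqrtr_ge0//.
rewrite exprMn !enorm_sqr dot_mulmx dotC -mulmxA symP.
have sS : (P *m P)^T = P *m P by rewrite trmx_mul symP.
have le1 : nth 0 (eigs (P *m P)) 1 <= singval P 1 ^+ 2.
  by have := singval_sqr_ge P 1; rewrite symP.
apply: le_trans (quad_form_orth_le (P *m P) one v sS _ _ _ _) _.
- by rewrite mulmxA !comm_const.
- apply/negP => /eqP/rowP /(_ (Ordinal (ltnW n2))); rewrite !mxE => /eqP.
  by rewrite oner_eq0.
- by apply: le_lt_trans le1 _; rewrite expr_lt1// sqrtr_ge0.
- by rewrite /dot -[RHS]v0; apply: eq_bigr => i _; rewrite mxE mulr1.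
- by rewrite ler_wpM2r ?dot_ge0.
Qed.

Lemma orth_const_sum v : (\sum_i v ord0 i = 0) <-> dot v one = 0.
Proof.
have -> : dot v one = \sum_i v ord0 i by apply: eq_bigr => i _; rewrite mxE mulr1.
by [].
Qed.

Lemma comm_orth v : \sum_i v ord0 i = 0 -> \sum_i (v *m P) ord0 i = 0.
Proof. by rewrite !orth_const_sum dot_mulmx symP comm_const. Qed.

Lemma comm_contract v : enorm (v *m P) <= enorm v.
Proof.
have n0 : n%:R != 0 :> R by rewrite pnatr_eq0 -lt0n (ltnW n2).
pose a := (\sum_i v ord0 i) / n%:R; pose w := v - const_mx a.
have w0 : \sum_i w ord0 i = 0.
  rewrite (eq_bigr (fun i => v ord0 i - a)); last by move=> i _; rewrite !mxE.
  by rewrite sumrB sumr_const card_ord -mulr_natr /a divfK// subrr.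
have -> : v = a *: one + w by rewrite /w addrC -[a *: one]/(_) /one scalemx_const mulr1 subrK.
rewrite mulmxDl -scalemxAl comm_const enorm_leE.
have gen (x : 'rV[R]_n) : \sum_i x ord0 i = 0 -> dot (a *: one + x) (a *: one + x) = a ^+ 2 * dot one one + dot x x.
  move=> /orth_const_sum x0.
  by rewrite !(dotDl, dotDr, dotZl, dotZr) (dotC one x) x0; ring.
rewrite (gen _ (comm_orth _ w0)) (gen _ w0).
rewrite lerD2l -enorm_leE (le_trans (comm_contract_orth _ w0))//.
by rewrite ler_piMl ?enorm_ge0// ltW.
Qed.

Let beta := singval (1%:M - P) 0.

Lemma beta_ge0 : 0 <= beta. Proof. exact: sqrtr_ge0. Qed.

Lemma sym1P : (1%:M - P)^T = 1%:M - P.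
Proof. by rewrite linearB/= trmx1 symP. Qed.

Lemma comm_defect v : enorm (v - v *m P) <= beta * enorm v.
Proof. by have := singval_top (1%:M - P) v sym1P; rewrite mulmxBr mulmx1. Qed.

(** The norm bound [comm_defect] goes the wrong way here. Instead beta^2 is realised by an
    eigenvector [v] of (I - P)^2, and |v - v P| <= 2 |v| because [P] is nonexpansive. *)
Lemma beta_le2 : beta <= 2.
Proof.
rewrite -ler_sqr ?nnegrE ?beta_ge0// /beta /singval -/(eigs _) sym1P.
set S := (1%:M - P) *m (1%:M - P); set a := nth 0 _ 0.
have [a0|a0] := leP a 0; first by rewrite ler0_sqrtr// expr0n /= sqr_ge0.
rewrite sqr_sqrtr ?(ltW a0)//.
have symS : S^T = S by rewrite trmx_mul sym1P.
have [l [p [q [_ _ _ _ cS]]]] := real_spectral S symS.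
have pe := eigs_perm S l symS cS.
have : a \in eigs S by apply: mem_nth; rewrite (perm_size pe) size_codom card_ord ltnW.
rewrite (perm_mem pe) => /codomP[i ai].
have : eigenvalue S a.
  by rewrite eigenvalue_root_char cS ai /root horner_prod (bigD1 i)//= !hornerE subrr mul0r.
move=> /eigenvalueP[v vS v0].
have := congr1 (fun x => dot x v) vS; rewrite dotZl /S mulmxA dot_mulmx sym1P -enorm_sqr => h.
have vv : 0 < dot v v.
  rewrite lt_def dot_ge0 andbT; apply: contra v0 => /eqP v0.
  by apply/eqP; apply: enorm_eq0; rewrite enormE v0 sqrtr0.
rewrite -(ler_pM2r vv) -enorm_sqr -h -enorm_sqr -exprMn ler_sqr ?nnegrE ?mulr_ge0 ?enorm_ge0//.
rewrite mulmxBr mulmx1; apply: le_trans (enormB _ _) _.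
by have := comm_contract v; lra.
Qed.

Let rho := 1 - singval P 1.

Lemma rho_gt0 : 0 < rho. Proof. by rewrite subr_gt0. Qed.
Lemma rho_le1 : rho <= 1. Proof. by rewrite gerBl sqrtr_ge0. Qed.

(** Test on the difference of two basis vectors, which sums to zero: |v| <= |v - v P| + |v P| <=
    (beta + 1 - rho) |v|. *)
Lemma rho_le_beta : rho <= beta.
Proof.
pose i0 := Ordinal (ltnW n2); pose i1 := Ordinal n2.
pose v : 'rV[R]_n := delta_mx 0 i0 - delta_mx 0 i1.
have v0 : \sum_i v ord0 i = 0.
  rewrite (eq_bigr (fun i => (i == i0)%:R - (i == i1)%:R)); last by move=> i _; rewrite !mxE.
  have S1 (k : 'I_n) : \sum_i (i == k)%:R = 1 :> R.
    by rewrite (bigD1 k)//= eqxx big1 ?addr0// => i /negbTE ->.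
  by rewrite sumrB !S1 subrr.
have v1 : 0 < enorm v.
  rewrite lt_def enorm_ge0 andbT; apply/eqP => /enorm_eq0/rowP/(_ i0).
  by rewrite !mxE /= subr0 => /eqP; rewrite oner_eq0.
have := comm_contract_orth v v0; have := comm_defect v.
have := enormD (v - v *m P) (v *m P); rewrite subrK => h1 h2 h3.
by rewrite -(ler_pM2r v1) /rho mulrBl mul1r; lra.
Qed.

(** Write I + g (P - I) = (1 - g beta) I + g N with N = beta I - (I - P). On zero-sum vectors [N] is
    self-adjoint with quadratic form between 0 and beta - rho, so its norm is at most beta - rho,
    and (1 - g beta) + g (beta - rho) = 1 - g rho. *)
Lemma gossip_contract (g : R) v : 0 <= g -> g * beta <= 1 -> \sum_i v ord0 i = 0 ->
  enorm (v + g *: (v *m P - v)) <= (1 - g * rho) * enorm v.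
Proof.
move=> g0 gb v0.
pose N (x : 'rV[R]_n) : 'rV[R]_n := beta *: x - (x - x *m P).
have c0 : 0 <= beta - rho by rewrite subr_ge0 rho_le_beta.
have Nsub (t : R) (x y : 'rV[R]_n) : N (x - t *: y) = N x - t *: N y.
  rewrite /N mulmxBl -scalemxAl; apply/rowP => j; rewrite !mxE; ring.
have NC x y : dot (N x) y = dot x (N y).
  rewrite /N !(dotDl, dotDr, dotNl, dotNr, dotZl, dotZr) dot_mulmx symP; ring.
have North (x : 'rV[R]_n) : \sum_i x ord0 i = 0 -> \sum_i (N x) ord0 i = 0.
  move=> x0; have := comm_orth x x0; move: x0; rewrite !orth_const_sum => x0 x1.
  by rewrite /N !(dotDl, dotNl, dotZl) x0 x1; ring.
have lo (x : 'rV[R]_n) : 0 <= dot (N x) x.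
  have := le_trans (dot_le (x - x *m P) x) (ler_wpM2r (enorm_ge0 x) (comm_defect x)).
  rewrite -mulrA -expr2 enorm_sqr => h.
  by rewrite /N dotDl dotNl dotZl subr_ge0.
have hi (x : 'rV[R]_n) : \sum_i x ord0 i = 0 -> dot (N x) x <= (beta - rho) * dot x x.
  move=> x0; have := le_trans (dot_le (x *m P) x) (ler_wpM2r (enorm_ge0 x) (comm_contract_orth x x0)).
  rewrite -mulrA -expr2 enorm_sqr => h.
  by rewrite /N !(dotDl, dotNl, dotZl) /rho; lra.
set w := N v.
(* Passing from the quadratic form to the operator norm: positivity of [N] is used at v - t N v, and
   the upper bound at v and at N v. *)
have key (t : R) : 2 * t * dot w w <= (beta - rho) * (dot v v + t ^+ 2 * dot w w).
  have := lo (v - t *: w); rewrite Nsub -/w => h.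
  have := hi v v0; have := hi w (North _ v0); rewrite -/w => h1 h2.
  have h3 : dot (w - t *: N w) (v - t *: w) = dot w v - 2 * t * dot w w + t ^+ 2 * dot (N w) w.
    have gen (a b x y : 'rV[R]_n) : dot (a - t *: b) (x - t *: y) = dot a x - t * dot a y - t * dot b x + t ^+ 2 * dot b y.
      by rewrite !(dotDl, dotDr, dotNl, dotNr, dotZl, dotZr); ring.
    by rewrite gen (NC w v) -/w; ring.
  have := ler_wpM2l (sqr_ge0 t) h1; move: h; rewrite h3 -/w => h h4.
  lra.
have wle : enorm w <= (beta - rho) * enorm v.
  rewrite -ler_sqr ?nnegrE ?mulr_ge0 ?enorm_ge0// exprMn !enorm_sqr.
  have [cz|cn0] := eqVneq (beta - rho) 0.
    have := key 1; rewrite cz !mul0r expr0n /= mul0r; lra.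
  have cp : 0 < beta - rho by rewrite lt_def cn0.
  (* The value of [t] for which [key] reduces to |w|^2 <= (beta - rho)^2 |v|^2. *)
  have := ler_wpM2l (ltW cp) (key (beta - rho)^-1); set c := beta - rho in cp *.
  set a := dot w w; set b := dot v v.
  have -> : c * (c * (b + c^-1 ^+ 2 * a)) = c ^+ 2 * b + a by field; rewrite gt_eqF.
  have -> : c * (2 * c^-1 * a) = 2 * a by field; rewrite gt_eqF.
  lra.
have -> : v + g *: (v *m P - v) = (1 - g * beta) *: v + g *: w.
  by rewrite /w /N; apply/rowP => j; rewrite !mxE; ring.
apply: le_trans (enormD _ _) _; rewrite !enormZ ger0_norm ?subr_ge0// ger0_norm//.
have := ler_wpM2l g0 wle; lra.
Qed.

End CommMatrix.

(** * Measurability and integration *)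

Section BorelRow.
Context {R : realType} {d : nat}.
Context {dW : measure_display} {W : measurableType dW}.
Implicit Types V U : W -> 'rV[R]_d.

Definition mrow V := measurable_fun setT (V : W -> Rvec R d).

Lemma open_Rvec (A : set 'rV[R]_d) : open A -> measurable (A : set (Rvec R d)).
Proof. by move=> oA; apply: sub_sigma_algebra. Qed.

Lemma closed_Rvec (A : set 'rV[R]_d) : closed A -> measurable (A : set (Rvec R d)).
Proof.
move=> cA; rewrite -(setCK A); apply: measurableC; apply: open_Rvec.
by apply: closed_openC.
Qed.

Lemma continuous_Rvec_measurable (g : 'rV[R]_d -> R) :
  continuous g -> measurable_fun setT (g : Rvec R d -> R).
Proof.
move=> /continuousP cg; apply: (measurability _ (RGenOpens.measurableE R)).
move=> _ [_ [a [b ->] <-]]; rewrite setTI; apply: open_Rvec.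
exact/cg/interval_open.
Qed.

Lemma measurable_coord (j : 'I_d) :
  measurable_fun setT ((fun x : 'rV[R]_d => x ord0 j) : Rvec R d -> R).
Proof. by apply: continuous_Rvec_measurable => x; exact: coord_continuous. Qed.

Lemma mrow_coord V : mrow V -> forall j, measurable_fun setT (fun w => V w ord0 j).
Proof. by move=> mV j; exact: (measurableT_comp (measurable_coord j) mV). Qed.

Let box (q : {ffun 'I_d -> rat * rat}) : set 'rV[R]_d :=
  [set x | forall j, ratr (q j).1 < x ord0 j < ratr (q j).2].

Lemma open_bigcup_box (A : set 'rV[R]_d) : open A ->
  A = \bigcup_(q in [set q | box q `<=` A]) box q.
Proof.
move=> oA; apply/seteqP; split; last by move=> x [q qA] /qA.
move=> x Ax; have [Q Qx QA] : nbhs x A by apply: open_nbhs_nbhs.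
have H j : exists q : rat * rat, ratr q.1 < x ord0 j < ratr q.2 /\
    forall y : R, ratr q.1 < y < ratr q.2 -> Q ord0 j y.
  have /nbhs_ballP[e /= e0 eQ] := Qx ord0 j.
  have [|a] := @rat_in_itvoo R (x ord0 j - e) (x ord0 j); first lra.
  have [|b] := @rat_in_itvoo R (x ord0 j) (x ord0 j + e); first lra.
  rewrite !in_itv/= => /andP[b1 b2] /andP[a1 a2]; exists (a, b); rewrite /= a2 b1; split=> //.
  move=> y /andP[ya yb]; apply: eQ; rewrite /ball /= ltr_distlC; apply/andP; split; lra.
have [q qP] := choice H.
exists [ffun j => q j] => /=; last by move=> j; rewrite ffunE; case: (qP j).
move=> y yq; apply: QA => i j; rewrite ord1.
by have [_] := qP j; apply; have := yq j; rewrite ffunE.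
Qed.

(** An open set is the union of the rational boxes inside it; there are countably many of them, and
    the preimage of a box is a finite intersection of conditions on coordinates. *)
Lemma mrowP V : (forall j, measurable_fun setT (fun w => V w ord0 j)) -> mrow V.
Proof.
move=> mV; apply: (@measurability _ _ W (Rvec R d) setT V (@open 'rV[R]_d)); first by [].
move=> _ [A oA <-]; rewrite setTI.
rewrite (open_bigcup_box _ oA) preimage_bigcup bigcup_mkcond.
apply: countable_bigcupT_measurable => // q; case: ifPn => // _.
have -> : V @^-1` box q = \bigcap_(j in [set: 'I_d])
    ((fun w => V w ord0 j) @^-1` [set` `]ratr (q j).1, ratr (q j).2[]).
  apply/seteqP; split => w /=.
    by move=> h j _ /=; rewrite in_itv/=; exact: h.
  by move=> h j; have := h j I; rewrite /= in_itv.
apply: fin_bigcap_measurable => // j _.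
rewrite -[X in measurable X]setTI; apply: mV => //; exact: measurable_itv.
Qed.

Lemma mrowD U V : mrow U -> mrow V -> mrow (fun w => U w + V w).
Proof.
move=> mU mV; apply: mrowP => j.
rewrite (_ : (fun w => _) = (fun w => U w ord0 j + V w ord0 j)); last by apply/funext => w; rewrite mxE.
by apply: measurable_funD; exact: mrow_coord.
Qed.

Lemma mrow_scale (g : W -> R) V : measurable_fun setT g -> mrow V -> mrow (fun w => g w *: V w).
Proof.
move=> mg mV; apply: mrowP => j.
rewrite (_ : (fun w => _) = (fun w => g w * V w ord0 j)); last by apply/funext => w; rewrite mxE.
by apply: measurable_funM => //; exact: mrow_coord.
Qed.

Lemma mrowZ (a : R) V : mrow V -> mrow (fun w => a *: V w).
Proof. by move=> mV; apply: mrow_scale => //; exact: measurable_cst. Qed.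

Lemma mrowN V : mrow V -> mrow (fun w => - V w).
Proof.
by move=> /(mrowZ (-1)); rewrite /mrow; congr measurable_fun; apply/funext => w; rewrite scaleN1r.
Qed.

Lemma mrowB U V : mrow U -> mrow V -> mrow (fun w => U w - V w).
Proof. by move=> mU mV; apply: mrowD => //; exact: mrowN. Qed.

Lemma mrow_cst (a : 'rV[R]_d) : mrow (fun=> a).
Proof. by apply: mrowP => j; exact: measurable_cst. Qed.

Lemma mrow_sum (I : Type) (s : seq I) (Q : pred I) (F : I -> W -> 'rV[R]_d) :
  (forall i, Q i -> mrow (F i)) -> mrow (fun w => \sum_(i <- s | Q i) F i w).
Proof.
move=> mF; elim: s => [|i s IH].
  by rewrite (_ : (fun w => _) = (fun=> 0)); [exact: mrow_cst|apply/funext => w; rewrite big_nil].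
case Qi : (Q i).
  rewrite (_ : (fun w => _) = (fun w => F i w + \sum_(i <- s | Q i) F i w)).
    by apply: mrowD => //; exact: mF.
  by apply/funext => w; rewrite big_cons Qi.
rewrite (_ : (fun w => _) = (fun w => \sum_(i <- s | Q i) F i w))//.
by apply/funext => w; rewrite big_cons Qi.
Qed.

Lemma mrow_comp (g : 'rV[R]_d -> R) V :
  measurable_fun setT (g : Rvec R d -> R) -> mrow V -> measurable_fun setT (fun w => g (V w)).
Proof. by move=> mg mV; exact: (measurableT_comp mg mV). Qed.

Lemma mrow_enorm V : mrow V -> measurable_fun setT (fun w => enorm (V w)).
Proof. by apply: mrow_comp; apply: continuous_Rvec_measurable; exact: continuous_enorm. Qed.

Lemma mrow_dot U V : mrow U -> mrow V -> measurable_fun setT (fun w => dot (U w) (V w)).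
Proof.
move=> mU mV; rewrite /dot; apply: measurable_sum => j.
by apply: measurable_funM; exact: mrow_coord.
Qed.

Lemma mrow_continuous (g : 'rV[R]_d -> 'rV[R]_d) V :
  continuous g -> mrow V -> mrow (fun w => g (V w)).
Proof.
move=> cg mV; apply: mrowP => j; apply: (@mrow_comp (fun x => g x ord0 j)) => //.
apply: continuous_Rvec_measurable => x.
apply: (@continuous_comp _ _ _ g (fun y : 'rV[R]_d => y ord0 j)); first exact: cg.
exact: coord_continuous.
Qed.

End BorelRow.

(** Continuity holds at the points of [X] only, so the preimage of an open interval need not be
    open; but within [X] it coincides with its interior. *)
Lemma continuous_in_restrict_measurable {R : realType} {d : nat} (X : set 'rV[R]_d) (f : 'rV[R]_d -> R) :
  closed X -> (forall x, X x -> {for x, continuous f}) ->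
  measurable_fun setT ((f \_ X) : Rvec R d -> R).
Proof.
move=> cX cf; apply/(@measurable_restrictT _ _ (Rvec R d) R X f).
  exact: closed_Rvec.
apply: (measurability _ (RGenOpens.measurableE R)).
move=> _ [_ [a [b ->] <-]].
have -> : X `&` f @^-1` `]a, b[ = X `&` (f @^-1` `]a, b[)°.
  apply/seteqP; split => x [Xx fx]; split=> //; last exact: interior_subset.
  by apply: (cf x Xx); apply: open_nbhs_nbhs; split=> //; exact: interval_open.
by apply: measurableI; [exact: closed_Rvec|apply: open_Rvec; exact: open_interior].
Qed.

Section NonMeasurableMonotone.
Local Open Scope ereal_scope.
Context {R : realType} {dT : measure_display} {T : measurableType dT}.
Variable mu : {measure set T -> \bar R}.

(* No measurability is needed: the integral of a nonnegative function is a
   supremum over the simple functions below it. *)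
Lemma ge0_le_integral_sup (f g : T -> \bar R) :
  (forall x, 0 <= f x) -> (forall x, f x <= g x) -> \int[mu]_x f x <= \int[mu]_x g x.
Proof.
move=> f0 fg; rewrite !ge0_integralTE// => [|x]; last exact: le_trans (f0 x) (fg x).
apply: le_ereal_sup => _ [h hf <-]; exists h => // x.
exact: le_trans (hf x) (fg x).
Qed.

End NonMeasurableMonotone.

(** * Translation invariance of iterated Lebesgue integrals *)

Section Translate.
Local Open Scope ereal_scope.
Context {R : realType}.
Local Notation mu := (@lebesgue_measure R).
Import HBNNSimple.

Lemma lebesgue_measure_translate (a : R) (A : set R) : measurable A ->
  pushforward mu ((fun x => x + a)%R : _ -> measurableTypeR R) A = mu A.
Proof.
move=> mA.
have mf : measurable_fun setT ((fun x => x + a)%R : measurableTypeR R -> measurableTypeR R).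
  by apply: measurable_funD => //; exact: measurable_cst.
pose f : {mfun measurableTypeR R >-> measurableTypeR R} :=
  HB.pack ((fun x => x + a)%R : measurableTypeR R -> measurableTypeR R) (isMeasurableFun.Build _ _ _ _ _ mf).
apply/esym/(@lebesgue_measure_unique R (pushforward mu f)) => //= _ [[b c]] _ <-.
rewrite /pushforward.
have -> : f @^-1` `]b, c] = `](b - a)%R, (c - a)%R]%classic.
  apply/seteqP; split => x /=; rewrite !in_itv/= ltrBlDr lerBrDr//.
rewrite !lebesgue_measure_itv/= !lte_fin ltrD2r.
by case: ifP => // _; congr EFin; rewrite opprB addrA subrK.
Qed.

(** Translating the simple functions below the integrand works for an arbitrary nonnegative [F].
    This generality matters: the inner integrals of [iter_int] are not known to be measurable. *)
Lemma integral_translate_le (a : R) (F : R -> \bar R) : (forall x, 0 <= F x) ->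
  \int[mu]_x F (x + a)%R <= \int[mu]_x F x.
Proof.
move=> F0; rewrite [leLHS]ge0_integralTE//; apply: ge_ereal_sup => _ [h hF <-].
rewrite -integralT_nnsfun.
have mf : measurable_fun setT ((fun x => x + a)%R : measurableTypeR R -> measurableTypeR R).
  by apply: measurable_funD => //; exact: measurable_cst.
have mg : measurable_fun setT ((fun x => x - a)%R : measurableTypeR R -> measurableTypeR R).
  by apply: measurable_funB => //; exact: measurable_cst.
have mhg : measurable_fun setT ((fun x : R => (h (x - a)%R)%:E) : measurableTypeR R -> \bar R).
  by apply/measurable_EFinP; exact: (measurableT_comp (measurable_funPT h) mg).
have -> : \int[mu]_x (h x)%:E = integral mu setT (fun x : R => (h (x - a)%R)%:E).
  rewrite -[RHS](@eq_measure_integral _ _ _ setT mu (pushforward mu ((fun x => x + a)%R : measurableTypeR R -> measurableTypeR R))).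
    rewrite ge0_integral_pushforward//=; last by move=> y _; rewrite lee_fin.
    by apply: eq_integral => x _ /=; rewrite addrK.
  by move=> A mA _; exact: lebesgue_measure_translate.
apply: ge0_le_integral_sup => x; first by rewrite lee_fin.
by have := hF (x - a)%R; rewrite subrK.
Qed.

Lemma integral_translate (a : R) (F : R -> \bar R) : (forall x, 0 <= F x) ->
  \int[mu]_x F (x + a)%R = \int[mu]_x F x.
Proof.
move=> F0; apply/eqP; rewrite eq_le integral_translate_le//=.
have := @integral_translate_le (- a) (fun x => F (x + a)%R) (fun x => F0 _).
by under eq_integral do rewrite subrK.
Qed.

End Translate.

Lemma indic_iff {R : realType} {T U : Type} (A : set T) (B : set U) (a : T) (b : U) :
  (A a <-> B b) -> indic A a = indic B b :> R.
Proof.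
move=> AB; rewrite !indicE; congr (_%:R); congr nat_of_bool.
by apply/idP/idP; rewrite !inE; apply AB.
Qed.

Section IterInt.
Context {R : realType}.
Local Notation mu := (@lebesgue_measure R).

Definition consfun (x : R) (y : nat -> R) : nat -> R :=
  fun j => if j is j'.+1 then y j' else x.

Lemma iter_intS k (g : (nat -> R) -> \bar R) :
  iter_int k.+1 g = (\int[mu]_x iter_int k (fun y => g (consfun x y)))%E.
Proof. by []. Qed.

Lemma iter_int_ge0 k (g : (nat -> R) -> \bar R) : (forall y, 0 <= g y)%E -> (0 <= iter_int k g)%E.
Proof.
elim: k g => [|k IH] g g0; first exact: g0.
rewrite iter_intS.
by apply: integral_ge0 => x _; apply: IH.
Qed.

Lemma iter_int0 k : iter_int k (fun _ : nat -> R => 0%E) = 0%E.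
Proof. by elim: k => // k IH; rewrite iter_intS IH integral0. Qed.

(** The second hypothesis says that [g] depends on its first [k] arguments only: [iter_int 0]
    evaluates at the zero sequence, which a translation of later arguments would change. *)
Lemma iter_int_translate k (g : (nat -> R) -> \bar R) (v : nat -> R) :
  (forall y, 0 <= g y)%E ->
  (forall y z, (forall j, (j < k)%N -> y j = z j) -> g y = g z) ->
  iter_int k (fun y => g (fun j => y j + v j)) = iter_int k g.
Proof.
elim: k g v => [|k IH] g v g0 gE; first exact: gE.
rewrite !iter_intS -[RHS](integral_translate (v 0%N)); last by move=> x; exact: iter_int_ge0.
apply: eq_integral => x _.
rewrite -(IH (fun y => g (consfun (x + v 0%N) y)) (fun j => v j.+1))//; last first.
  by move=> y z yz; apply: gE => -[|j] //=; exact: yz.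
congr (iter_int k _); apply/funext => y; congr g; apply/funext => -[|j] //.
Qed.

Lemma lebesgue_measure_sqr_eq (c : R) : mu [set x | x ^+ 2 = c] = 0%E.
Proof.
have sub : [set x : R | x ^+ 2 = c] `<=` [set Num.sqrt c; - Num.sqrt c].
  move=> x /= <-; rewrite sqrtr_sqr.
  have [x0|x0] := leP 0 x; first by rewrite ger0_norm//; left.
  by rewrite ltr0_norm// opprK; right.
apply: countable_lebesgue_measure0; apply: finite_set_countable.
by apply: sub_finite_set sub _; apply: finite_set2.
Qed.

(** Fixing the first coordinate leaves a sphere of one dimension less, down to a set of at most two
    points. The radius parameter [c] is arbitrary, even negative, so that the induction can use
    [c - x ^+ 2]. *)
Lemma iter_int_sphere k (c : R) :
  iter_int k.+1 (fun y => (indic [set z : nat -> R | \sum_(j < k.+1) z j ^+ 2 = c] y : R)%:E) = 0%E.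
Proof.
elim: k c => [|k IH] c; rewrite iter_intS.
  rewrite (_ : (fun x => _) = (fun x => (indic [set x : R | x ^+ 2 = c] x)%:E)); last first.
    apply/funext => x /=; congr EFin; apply: indic_iff.
    by rewrite /= big_ord_recl big_ord0 addr0.
  rewrite integral_indic ?setIT//; first exact: lebesgue_measure_sqr_eq.
  have := lebesgue_measure_sqr_eq c => _.
  have -> : [set x : R | x ^+ 2 = c] = (fun x : R => x ^+ 2) @^-1` [set c] by [].
  rewrite -[X in measurable X]setTI.
  by apply: (measurable_funX 2 (@measurable_id _ _ setT)).
rewrite (_ : (fun x => _) = (fun=> 0%E)) ?integral0//; apply/funext => x.
rewrite -[RHS](IH (c - x ^+ 2)); congr iter_int; apply/funext => y; congr EFin; apply: indic_iff => /=.
rewrite big_ord_recl /=; split => [<-|->]; first by rewrite addrC addKr.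
by rewrite addrC subrK.
Qed.

End IterInt.

Section LebD.
Context {R : realType} {d : nat}.

Lemma leb_d_translate (A : set 'rV[R]_d) (v : 'rV[R]_d) :
  leb_d [set x | A (x + v)] = leb_d A.
Proof.
pose v' (j : nat) : R := if insub j is Some i then v ord0 i else 0.
pose g (y : nat -> R) : \bar R := (indic A (\row_(j < d) y (nat_of_ord j)) : R)%:E.
rewrite /leb_d -/g -(@iter_int_translate _ d g v').
- congr iter_int; apply/funext => y; rewrite /g; congr EFin; apply: indic_iff.
  rewrite (_ : (\row_(j < d) (y j + v' j)) = (\row_(j < d) y j) + v).
    by [].
  by apply/rowP => j; rewrite !mxE /v' valK.
- by move=> y; rewrite lee_fin.
- by move=> y z yz; rewrite /g; congr (indic A _)%:E; apply/rowP => j; rewrite !mxE yz.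
Qed.

Lemma leb_d0 : leb_d (set0 : set 'rV[R]_d) = 0%E.
Proof.
rewrite /leb_d -[RHS](@iter_int0 R d); congr iter_int; apply/funext => y.
by rewrite indic0.
Qed.

Lemma leb_d_sphere (c : R) : (0 < d)%N -> leb_d [set x : 'rV[R]_d | dot x x = c] = 0%E.
Proof.
rewrite /leb_d; case: d => // k _; rewrite -[RHS](iter_int_sphere k c).
congr iter_int; apply/funext => y; congr EFin; apply: indic_iff => /=.
have -> : dot (\row_(j < k.+1) y j) (\row_(j < k.+1) y j) = \sum_(j < k.+1) y j ^+ 2.
  by apply: eq_bigr => j _; rewrite !mxE expr2.
by [].
Qed.

End LebD.

(** * Integration by parts on the unit ball *)

Section BallLaw.
Context {R : realType} {d : nat}.
Variable nu : probability (Rvec R d) R.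
Hypothesis d_gt0 : (0 < d)%N.
Hypothesis nuE : forall A, measurable A -> nu A = (unif_ball A)%:E.
Implicit Types (x u v w : 'rV[R]_d).

Lemma measurable_enorm : measurable_fun setT (@enorm R d : Rvec R d -> R).
Proof. exact: continuous_Rvec_measurable continuous_enorm. Qed.

Lemma nu_outside : nu [set x | 1 < enorm x] = 0%E.
Proof.
rewrite nuE.
  rewrite /unif_ball (_ : _ `&` _ = set0) ?leb_d0 ?mul0r//.
  by apply/seteqP; split => x //= -[h]; rewrite /eball /= leNgt h.
rewrite -[X in measurable X]setTI.
have -> : [set x : Rvec R d | 1 < enorm (x : 'rV[R]_d)] = (@enorm R d) @^-1` `]1, +oo[%classic.
  by apply/seteqP; split => x /=; rewrite in_itv/= andbT.
by apply: measurable_enorm => //; exact: measurable_itv.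
Qed.

Lemma nu_sphere : nu [set x | enorm x = 1] = 0%E.
Proof.
rewrite nuE.
  rewrite /unif_ball (_ : _ `&` _ = [set x : 'rV[R]_d | dot x x = 1]).
    by rewrite leb_d_sphere// mul0r.
  apply/seteqP; split => x /=; rewrite /eball /= -enorm_sqr.
    by case => -> _; rewrite expr1n.
  move=> /eqP; rewrite sqrp_eq1 ?enorm_ge0// => /eqP ->; split=> //.
rewrite -[X in measurable X]setTI.
have -> : [set x : Rvec R d | enorm (x : 'rV[R]_d) = 1] = (@enorm R d) @^-1` [set 1] by [].
by apply: measurable_enorm.
Qed.

Lemma translate_measurable v : measurable_fun setT ((fun x => x + v) : Rvec R d -> Rvec R d).
Proof. by apply: mrowD; [exact: measurable_id|exact: mrow_cst]. Qed.

Lemma nu_translate (A : set 'rV[R]_d) v : measurable (A : set (Rvec R d)) ->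
  A `<=` @eball R d 1 -> [set x | A (x + v)] `<=` @eball R d 1 -> nu [set x | A (x + v)] = nu A.
Proof.
move=> mA AB AB'; rewrite !nuE//.
  rewrite /unif_ball (setIidl AB) (setIidl AB').
  by rewrite leb_d_translate.
by rewrite -[X in measurable X]setTI; apply: translate_measurable.
Qed.

(** The law is translation invariant only for sets that stay in the ball. The support hypothesis
    puts [F] on the intersection of the ball with its translate, where [nu] and its image under the
    translation agree. *)
Lemma ge0_integral_nu_translate (F : 'rV[R]_d -> \bar R) v :
  measurable_fun setT (F : Rvec R d -> \bar R) -> (forall x, 0 <= F x)%E ->
  (forall x, F x <> 0%E -> enorm x <= 1 /\ enorm (x - v) <= 1) ->
  (\int[nu]_x F ((x : 'rV[R]_d) + v)%R = \int[nu]_x F x)%E.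
Proof.
move=> mF F0 Fsupp.
pose D : set (Rvec R d) := [set x : 'rV[R]_d | enorm x <= 1 /\ enorm (x - v) <= 1].
have mD : measurable D.
  have -> : D = (setT `&` ((@enorm R d : Rvec R d -> R) @^-1` `]-oo, 1]%classic)) `&`
     (setT `&` ((fun x : Rvec R d => enorm ((x : 'rV[R]_d) - v)) @^-1` `]-oo, 1]%classic)).
    by apply/seteqP; split => x /=; rewrite !in_itv/= => -[]; [move=> ? ?|move=> [_ ?] [_ ?]].
  apply: measurableI; first by apply: measurable_enorm => //; exact: measurable_itv.
  have h : measurable_fun setT (fun x : Rvec R d => enorm ((x : 'rV[R]_d) - v)).
    by apply: mrow_enorm; apply: mrowB; [exact: measurable_id|exact: mrow_cst].
  by apply: h => //; exact: measurable_itv.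
have FD : forall x, F x = (F \_ D) x.
  move=> x; rewrite patchE; case: ifPn => // /negP xD.
  have [//|h] := pselect (F x = 0%E); exfalso; apply: xD; rewrite inE; exact: Fsupp.
have mT := translate_measurable v.
transitivity (\int[pushforward nu ((fun x : 'rV[R]_d => x + v)%R : Rvec R d -> Rvec R d)]_x F x)%E.
  rewrite (ge0_integral_pushforward (translate_measurable v))//= => y _; exact: F0.
rewrite (eq_integral (F \_ D)); last by move=> x _; exact: FD.
rewrite [RHS](eq_integral (F \_ D)); last by move=> x _; exact: FD.
rewrite -!integral_mkcond; apply: eq_measure_integral => A mA AD.
apply: nu_translate => // x; first by case/AD.
by move=> /AD /= [_]; rewrite addrK.
Qed.

Lemma integral_nu_translate (F : 'rV[R]_d -> \bar R) v :
  measurable_fun setT (F : Rvec R d -> \bar R) ->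
  (forall x, F x <> 0%E -> enorm x <= 1 /\ enorm (x - v) <= 1) ->
  (\int[nu]_x F ((x : 'rV[R]_d) + v)%R = \int[nu]_x F x)%E.
Proof.
move=> mF Fsupp; rewrite [LHS]integralE [RHS]integralE; congr (_ - _)%E.
  rewrite -(@ge0_integral_nu_translate (fun x => (F^\+)%E x) v).
  - by apply: eq_integral => x _; rewrite !funeposE.
  - exact: measurable_funepos.
  - exact: funepos_ge0.
  - by move=> x h; apply: Fsupp => Fx; apply: h; rewrite funeposE Fx maxxx.
rewrite -(@ge0_integral_nu_translate (fun x => (F^\-)%E x) v).
- by apply: eq_integral => x _; rewrite !funenegE.
- exact: measurable_funeneg.
- exact: funeneg_ge0.
- by move=> x h; apply: Fsupp => Fx; apply: h; rewrite funenegE Fx oppe0 maxxx.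
Qed.

End BallLaw.

Lemma bounded_integrable {R : realType} {dT : measure_display} {T : measurableType dT}
    (mu : probability T R) (h : T -> R) (C : R) :
  measurable_fun setT h -> (forall x, `|h x| <= C) -> mu.-integrable setT (EFin \o h).
Proof.
move=> mh hC; apply: (@le_integrable _ _ _ mu setT _ _ (EFin \o cst C)) => //.
- exact/measurable_EFinP.
- move=> x _ /=; rewrite lee_fin; apply: le_trans (hC x) _; exact: ler_norm.
- exact: finite_measure_integrable_cst.
Qed.

Section BallIBP.
Context {R : realType} {d : nat}.
Variable nu : probability (Rvec R d) R.
Hypothesis d_gt0 : (0 < d)%N.
Hypothesis nuE : forall A, measurable A -> nu A = (unif_ball A)%:E.
Implicit Types (x u v w : 'rV[R]_d).

(* Up to the factor 2, phi 1 is the potential of the vector field u on the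
   unit ball: -grad (phi 1) = 2u. *)
Definition phi (s : R) (x : 'rV[R]_d) : R := Num.max 0 (s ^+ 2 - enorm x ^+ 2).

Lemma phi_ge0 s x : 0 <= phi s x.
Proof. by rewrite le_max lexx. Qed.

Lemma phi_le1 s x : 0 <= s <= 1 -> phi s x <= 1.
Proof.
move=> /andP[s0 s1]; rewrite ge_max ler01 /=.
have := sqr_ge0 (enorm x); have : s ^+ 2 <= 1 by rewrite expr_le1.
lra.
Qed.

Lemma phi_inside s x : enorm x <= s -> phi s x = s ^+ 2 - enorm x ^+ 2.
Proof.
move=> xs; apply: max_r; rewrite subr_ge0 ler_sqr ?nnegrE ?enorm_ge0//.
exact: le_trans (enorm_ge0 x) xs.
Qed.

Lemma phi_outside s x : 0 <= s -> s <= enorm x -> phi s x = 0.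
Proof.
by move=> s0 sx; apply: max_l; rewrite subr_le0 ler_sqr ?nnegrE ?enorm_ge0.
Qed.

Lemma phi_neq0 s x : 0 <= s -> phi s x <> 0 -> enorm x <= s.
Proof. by move=> s0 h; rewrite leNgt; apply/negP => /ltW /(phi_outside _ _ s0). Qed.

Lemma phi_lipschitz s x y : `|phi s x - phi s y| <= `|enorm x ^+ 2 - enorm y ^+ 2|.
Proof.
rewrite /phi; set a := s ^+ 2; set b := enorm x ^+ 2; set c := enorm y ^+ 2.
have [|] := leP 0 (a - b); have [|] := leP 0 (a - c) => h1 h2.
- by rewrite (_ : a - b - (a - c) = - (b - c)) ?normrN//; ring.
- by rewrite subr0 ger0_norm// ler0_norm; lra.
- by rewrite sub0r normrN ger0_norm// ger0_norm; lra.
- by rewrite subrr normr0.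
Qed.

Lemma measurable_phi s : measurable_fun setT (phi s : Rvec R d -> R).
Proof.
apply: measurable_maxr; first exact: measurable_cst.
apply: measurable_funB; first exact: measurable_cst.
by apply: measurable_funX; apply: measurable_enorm.
Qed.

(** Formally, the integral of (derivative of k along w) times phi equals the integral of 2 k <x, w>,
    and the derivative is at least [a] inside the ball. Difference quotients replace the derivative,
    so [k] need not be differentiable, and dominated convergence lets the step tend to 0. *)
Lemma ball_ibp (k : 'rV[R]_d -> R) (w : 'rV[R]_d) (a M dl0 : R) :
  measurable_fun setT (k : Rvec R d -> R) -> (forall x, `|k x| <= M) ->
  (forall x, 1 < enorm x -> k x = 0) -> 0 < dl0 ->
  (forall dl u, 0 < dl <= dl0 -> enorm u <= 1 - dl * enorm w ->
     dl * a <= k (u + dl *: w) - k u) ->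
  (0 <= \int[nu]_x (2 * k x * dot x w - a * phi 1 x)%:E)%E.
Proof.
move=> mk kM kout dl0_gt0 kinc.
have M0 : 0 <= M := le_trans (normr_ge0 _) (kM 0).
have w0 := enorm_ge0 w.
pose dl1 := Num.min dl0 (enorm w + 1)^-1.
have dl1_gt0 : 0 < dl1 by rewrite lt_min dl0_gt0 invr_gt0; lra.
have dl1w : dl1 * enorm w < 1.
  apply: (@le_lt_trans _ _ ((enorm w + 1)^-1 * enorm w)).
    by rewrite ler_wpM2r// ge_min lexx orbT.
  by rewrite mulrC ltr_pdivrMr; lra.
pose dl (n : nat) := dl1 * n.+1%:R^-1.
have dl_gt0 n : 0 < dl n by rewrite mulr_gt0// invr_gt0.
have dl_le n : dl n <= dl1 by rewrite ler_piMr ?(ltW dl1_gt0)// invf_le1// ler1n.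
have dl_lew n : dl n * enorm w <= dl1 * enorm w by rewrite ler_wpM2r.
(* The radius shrinks by the length of the translation, so that the translated support of
   [phi (s n)] remains in the unit ball. *)
pose s n := 1 - dl n * enorm w.
have s01 n : 0 <= s n <= 1.
  have := dl_lew n; have : 0 <= dl n * enorm w by rewrite mulr_ge0// ltW.
  by rewrite /s => ? ?; apply/andP; split; lra.
have s0 n : 0 <= s n by case/andP: (s01 n).
pose g n (x : 'rV[R]_d) := k x * ((phi (s n) (x - dl n *: w) - phi (s n) x) / dl n) - a * phi (s n) x.
have mphis n : measurable_fun setT ((fun x => phi (s n) (x - dl n *: w)) : Rvec R d -> R).
  apply: (@mrow_comp _ _ _ (Rvec R d) (phi (s n)) (fun x => x - dl n *: w) (measurable_phi (s n))).
  by apply: mrowB; [exact: measurable_id|exact: mrow_cst].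
have mg n : measurable_fun setT (g n : Rvec R d -> R).
  apply: measurable_funB; apply: measurable_funM => //; try exact: measurable_phi.
  apply: measurable_funM => //; apply: measurable_funB => //; exact: measurable_phi.
have mdot : measurable_fun setT ((fun x => dot x w) : Rvec R d -> R).
  by apply: mrow_dot; [exact: measurable_id|exact: mrow_cst].
pose C := 3 * M * enorm w + `|a|.
have quad n x : enorm (x - dl n *: w) ^+ 2 - enorm x ^+ 2 = dl n * (dl n * enorm w ^+ 2 - 2 * dot x w).
  by rewrite !enorm_sqr dot_sqrBZ; ring.
(* By [quad], the difference quotient of phi is at most dl |w|^2 + 2 |w| in the ball, hence at most
   3 |w| since dl |w| <= 1. *)
have gC n x : `|g n x| <= C.
  apply: le_trans (ler_normB _ _) _; apply: lerD; last first.
    rewrite normrM ler_piMr// ger0_norm ?phi_ge0//; exact: phi_le1.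
  have [x1|x1] := leP (enorm x) 1; last first.
    by rewrite kout// mul0r normr0 !mulr_ge0.
  rewrite normrM (mulrC 3) -mulrA; apply: ler_pM => //.
  rewrite normrM normfV (gtr0_norm (dl_gt0 n)) ler_pdivrMr//.
  apply: le_trans (phi_lipschitz _ _ _) _.
  rewrite quad normrM (gtr0_norm (dl_gt0 n)) mulrC ler_wpM2r ?(ltW (dl_gt0 n))//.
  apply: le_trans (ler_normB _ _) _.
  rewrite [`|dl n * _|]ger0_norm; last by rewrite mulr_ge0 ?sqr_ge0// ltW.
  rewrite [`|2 * _|]normrM normr_nat.
  have := dot_abs_le x w; have := ler_wpM2r w0 x1.
  have h : dl n * enorm w <= 1 by apply: le_trans (dl_lew n) (ltW dl1w).
  have := ler_wpM2r w0 h; rewrite expr2 mulrA; lra.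
have g_ge0 n : (0 <= \int[nu]_x (g n x)%:E)%E.
  pose A x := k x * phi (s n) (x - dl n *: w) / dl n.
  pose B x := k x * phi (s n) x / dl n + a * phi (s n) x.
  have kphi_le x y : `|k x * phi (s n) y / dl n| <= M / dl n.
    rewrite !normrM normfV (gtr0_norm (dl_gt0 n)) ler_pM2r ?invr_gt0//.
    rewrite -[leRHS]mulr1; apply: ler_pM => //; rewrite ger0_norm ?phi_ge0//; exact: phi_le1.
  have mA : measurable_fun setT (A : Rvec R d -> R).
    by apply: measurable_funM => //; apply: measurable_funM.
  have mB : measurable_fun setT (B : Rvec R d -> R).
    apply: measurable_funD; apply: measurable_funM => //; try exact: measurable_phi.
    by apply: measurable_funM => //; exact: measurable_phi.
  have mAs : measurable_fun setT ((fun x => A (x + dl n *: w)) : Rvec R d -> R).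
    by apply: (@mrow_comp _ _ _ (Rvec R d) A (fun x => x + dl n *: w) mA); exact: translate_measurable.
  have iA : nu.-integrable setT (EFin \o A).
    by apply: (@bounded_integrable _ _ _ nu A (M / dl n)) => // x; exact: kphi_le.
  have iAs : nu.-integrable setT (EFin \o (fun x => A (x + dl n *: w))).
    by apply: (@bounded_integrable _ _ _ nu _ (M / dl n)) => // x; exact: kphi_le.
  have iB : nu.-integrable setT (EFin \o B).
    apply: (@bounded_integrable _ _ _ nu B (M / dl n + `|a|)) => // x.
    apply: le_trans (ler_normD _ _) _; apply: lerD; first exact: kphi_le.
    by rewrite normrM ler_piMr// ger0_norm ?phi_ge0//; exact: phi_le1.
  have -> : (\int[nu]_x (g n x)%:E = \int[nu]_x ((EFin \o A) x - (EFin \o B) x))%E.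
    by apply: eq_integral => x _; rewrite /= -EFinB /g /A /B; congr EFin; ring.
  rewrite integralB//.
  (* Summation by parts: the translation moves the difference from phi to [k], where the hypothesis
     on increments applies. *)
  rewrite -(@integral_nu_translate _ _ nu nuE (EFin \o A) (dl n *: w)); first last.
  - move=> x /= Ax; have ph : phi (s n) (x - dl n *: w) <> 0.
      by move=> h; apply: Ax; rewrite /A h mulr0 mul0r.
    have := phi_neq0 _ _ (s0 n) ph => xs; split.
      rewrite -(subrK (dl n *: w) x); apply: le_trans (enormD _ _) _.
      rewrite enormZ (gtr0_norm (dl_gt0 n)); move: xs; rewrite /s; lra.
    by apply: le_trans xs _; case/andP: (s01 n).
  - exact/measurable_EFinP.
  rewrite -integralB//; apply: integral_ge0 => x _; rewrite /= -EFinB lee_fin.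
  rewrite /A /B addrK; have [->|ph] := eqVneq (phi (s n) x) 0.
    by rewrite !mulr0 !mul0r addr0 subrr.
  have xs : enorm x <= s n by apply: phi_neq0 => //; apply/eqP.
  have := kinc (dl n) x; rewrite dl_gt0 (le_trans (dl_le n))//; last by rewrite ge_min lexx.
  move=> /(_ isT xs) h.
  have -> : k (x + dl n *: w) * phi (s n) x / dl n - (k x * phi (s n) x / dl n + a * phi (s n) x)
    = (k (x + dl n *: w) - k x - dl n * a) * (phi (s n) x / dl n) by field; rewrite gt_eqF.
  apply: mulr_ge0; first by rewrite subr_ge0.
  by apply: divr_ge0; [exact: phi_ge0|exact: ltW].
pose f x := 2 * k x * dot x w - a * phi 1 x.
have mf : measurable_fun setT (f : Rvec R d -> R).
  by apply: measurable_funB; apply: measurable_funM => //; try exact: measurable_phi; apply: measurable_funM.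
have dl_cvg : dl n @[n --> \oo] --> (0 : R).
  by rewrite -(mulr0 dl1); apply: cvgMr; exact: cvg_harmonic.
(* Inside the ball both points eventually lie within radius [s n], where phi is a polynomial;
   outside it everything vanishes; the sphere itself is a null set. *)
have g_cvg x : enorm x != 1 -> g n x @[n --> \oo] --> f x.
  move=> x1; have [x_lt1|x_gt1|xe] := ltgtP (enorm x) 1; last by rewrite xe eqxx in x1.
  - have dlw_cvg : dl n * enorm w *+ 2 @[n --> \oo] --> (0 : R).
      rewrite (_ : 0 = 0 * enorm w *+ 2); last by rewrite mul0r mul0rn.
      by apply: cvgMn; apply: cvgMl.
    have h : k x * (2 * dot x w - dl n * enorm w ^+ 2) - a * (s n ^+ 2 - enorm x ^+ 2) @[n --> \oo] --> f x.
      rewrite (_ : f x = k x * (2 * dot x w - 0 * enorm w ^+ 2) - a * ((1 - 0 * enorm w) ^+ 2 - enorm x ^+ 2)).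
        apply: cvgB; apply: cvgMr; apply: cvgB; try exact: cvg_cst; first exact: cvgMl.
        by apply: (@cvg_comp _ _ _ s (fun y => y ^+ 2) _ (nbhs (1 - 0 * enorm w))); [apply: cvgB; [exact: cvg_cst|exact: cvgMl]|exact: exprn_continuous].
      by rewrite /f phi_inside ?(ltW x_lt1)//; ring.
    apply: cvg_trans h; apply: near_eq_cvg.
    near=> n; have : dl n * enorm w *+ 2 < 1 - enorm x.
      near: n; move/cvgr_lt : dlw_cvg; apply; lra.
    rewrite mulr2n => hn.
    have xs : enorm x <= s n.
      have : 0 <= dl n * enorm w by rewrite mulr_ge0// ltW.
      rewrite /s; lra.
    have xs' : enorm (x - dl n *: w) <= s n.
      apply: le_trans (enormB _ _) _; rewrite enormZ gtr0_norm// /s; lra.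
    rewrite /g (phi_inside _ _ xs) (phi_inside _ _ xs'); congr (k x * _ - _).
    rewrite (_ : _ - _ - _ = - (enorm (x - dl n *: w) ^+ 2 - enorm x ^+ 2)); last by ring.
    by rewrite quad; field; rewrite gt_eqF.
  - have h : (fun=> f x) n @[n --> \oo] --> f x by exact: cvg_cst.
    apply: cvg_trans h; apply: near_eq_cvg; near=> n.
    have xs : s n <= enorm x by apply: le_trans (ltW x_gt1); case/andP: (s01 n).
    rewrite /f /g kout// mulr0 !mul0r (phi_outside _ _ (s0 n) xs).
    by rewrite phi_outside// ltW.
have aeS : {ae nu, forall x, setT x -> EFin (g n x) @[n --> \oo] --> (f x)%:E}.
  exists [set x | enorm x = 1]; split.
  - rewrite -[X in measurable X]setTI.
    by apply: (measurable_enorm (d:=d) measurableT [set 1]).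
  - exact: nu_sphere.
  - move=> x /= h; apply: contrapT => /eqP x1; apply: h => _.
    by apply/fine_cvgP; split; [exact: nearW|exact: g_cvg].
have [] := @dominated_convergence _ _ _ nu setT measurableT (fun n x => (g n x)%:E) (fun x => (f x)%:E) (cst C%:E).
- by move=> n; apply/measurable_EFinP.
- exact/measurable_EFinP.
- exact: aeS.
- exact: (finite_measure_integrable_cst nu C).
- by apply: aeW => x n _; rewrite /= lee_fin.
move=> _ _ h.
apply: (@cvge_to_ge _ _ _ _ _ _ _ h).
by apply: nearW => n; exact: g_ge0.
Unshelve. all: by end_near. Qed.

End BallIBP.

(** * The mean of the two-point estimator under the uniform law on the ball *)

Section Smoothing.
Context {R : realType} {d : nat}.
Variable nu : probability (Rvec R d) R.
Hypothesis d_gt0 : (0 < d)%N.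
Hypothesis nuE : forall A, measurable A -> nu A = (unif_ball A)%:E.
Implicit Types (x y u v w : 'rV[R]_d).

(* Almost surely the identity on the samples, which lie in the ball only almost
   surely; it makes all the bounds below hold for every outcome. *)
Definition clip u : 'rV[R]_d := if enorm u <= 1 then u else 0.

Lemma clip_le1 u : enorm (clip u) <= 1.
Proof. by rewrite /clip; case: ifP => // _; rewrite enorm0. Qed.

Lemma measurable_enorm_ball : measurable ([set x : Rvec R d | enorm (x : 'rV[R]_d) <= 1]).
Proof.
rewrite -[X in measurable X]setTI.
have -> : [set x : Rvec R d | enorm (x : 'rV[R]_d) <= 1] = (@enorm R d) @^-1` `]-oo, 1]%classic.
  by apply/seteqP; split => x /=; rewrite in_itv/=.
by apply: measurable_enorm => //; exact: measurable_itv.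
Qed.

Definition ind1 u : R := if enorm u <= 1 then 1 else 0.

Lemma ind1_indic : ind1 = \1_[set x : 'rV[R]_d | enorm x <= 1].
Proof.
apply/funext => x; rewrite indicE /ind1; case: ifPn => h; first by rewrite mem_set.
by rewrite memNset//=; apply/negP.
Qed.

Lemma measurable_ind1 : measurable_fun setT (ind1 : Rvec R d -> R).
Proof.
by rewrite ind1_indic; apply: measurable_indic; exact: measurable_enorm_ball.
Qed.

Lemma clipE u : clip u = ind1 u *: u.
Proof. by rewrite /clip /ind1; case: ifP; rewrite ?scale1r ?scale0r. Qed.

Lemma measurable_clip : mrow (clip : Rvec R d -> 'rV[R]_d).
Proof.
rewrite (_ : clip = fun u => ind1 u *: u); last by apply/funext => u; exact: clipE.
by apply: mrow_scale; [exact: measurable_ind1|exact: measurable_id].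
Qed.

Lemma ae_integral_cst (a : R) : (\int[nu]_x a%:E = a%:E)%E.
Proof. by rewrite integral_cst// (_ : _ setT = 1%E) ?mule1//; exact: probability_setT. Qed.

Definition phi_mean : R := fine (\int[nu]_x (phi 1 x)%:E).

Let iphi : nu.-integrable setT (EFin \o (phi 1 : Rvec R d -> R)).
Proof.
apply: (@bounded_integrable _ _ _ nu _ 1); first exact: measurable_phi.
by move=> x; rewrite ger0_norm ?phi_ge0//; apply: phi_le1; rewrite lexx ler01.
Qed.

Lemma phi_meanE : (\int[nu]_x (phi 1 x)%:E = phi_mean%:E)%E.
Proof. by rewrite /phi_mean fineK//; exact: integrable_fin_num iphi. Qed.

Lemma ind1_mean : (\int[nu]_x (ind1 x)%:E = 1)%E.
Proof.
rewrite ind1_indic.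
rewrite integral_indic ?setIT//; last exact: measurable_enorm_ball.
have E : [set x : Rvec R d | enorm (x : 'rV[R]_d) <= 1] = ~` [set x : Rvec R d | 1 < enorm (x : 'rV[R]_d)].
  by apply/seteqP; split => x /=; rewrite leNgt => /negP.
have mA : measurable [set x : Rvec R d | 1 < enorm (x : 'rV[R]_d)].
  by rewrite -(setCK [set x | _]) -E; apply: measurableC; exact: measurable_enorm_ball.
transitivity (nu (~` [set x : Rvec R d | 1 < enorm (x : 'rV[R]_d)])); first by rewrite -E.
by rewrite (probability_setC nu mA) (nu_outside nu nuE) sube0.
Qed.

(** Apply [ball_ibp] to minus each coordinate and sum: twice the mean of |u|^2 is at most d times
    [phi_mean]. On the ball |u|^2 = 1 - phi, so that mean is 1 - [phi_mean]. No volume is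
    computed. *)
Lemma phi_mean_ge : 2 <= (d%:R + 2) * phi_mean.
Proof.
pose k (j : 'I_d) x : R := - (ind1 x * x ord0 j).
have mk j : measurable_fun setT (k j : Rvec R d -> R).
  apply: measurable_funN; apply: measurable_funM; first exact: measurable_ind1.
  exact: measurable_coord.
have k1 j x : `|k j x| <= 1.
  rewrite /k normrN /ind1; case: ifP => h; last by rewrite mul0r normr0.
  by rewrite mul1r (le_trans (coord_le_enorm _ _)).
have dotd j x : dot x (delta_mx 0 j) = x ord0 j.
  rewrite /dot (bigD1 j)//= mxE !eqxx mulr1 big1 ?addr0// => i ij.
  by rewrite mxE (negbTE ij) andbF mulr0.
have ed j : enorm (delta_mx 0 j : 'rV[R]_d) = 1.
  by rewrite enormE dotd mxE !eqxx sqrtr1.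
have H j : (0 <= \int[nu]_x (2 * k j x * dot x (delta_mx 0 j) - (-1) * phi 1 x)%:E)%E.
  apply: (@ball_ibp _ _ nu d_gt0 nuE (k j) (delta_mx 0 j) (-1) 1 1) => //.
    by move=> x; rewrite ltNge /k /ind1 => /negbTE ->; rewrite mul0r oppr0.
  move=> dl u /andP[dl0 _]; rewrite ed mulr1 => hu.
  have h1 : enorm (u + dl *: delta_mx 0 j) <= 1.
    by apply: le_trans (enormD _ _) _; rewrite enormZ ed mulr1 gtr0_norm//; lra.
  rewrite /k /ind1 h1 (_ : enorm u <= 1); last by lra.
  by rewrite !mxE !eqxx /=; lra.
have H2 : (0 <= \sum_(j < d) \int[nu]_x (2 * k j x * dot x (delta_mx 0 j) - (-1) * phi 1 x)%:E)%E.
  by apply: sume_ge0.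
move: H2; rewrite -integral_sum//; last first.
  move=> j; apply: (@bounded_integrable _ _ _ nu (fun x => 2 * k j x * dot x (delta_mx 0 j) - (-1) * phi 1 x) 3).
    apply: measurable_funB; apply: measurable_funM => //; last exact: measurable_phi.
      by apply: measurable_funM.
    by apply: mrow_dot; [exact: measurable_id|exact: mrow_cst].
  move=> x; apply: le_trans (ler_normB _ _) _.
  have -> : 3 = 2 + 1 :> R by ring.
  apply: lerD; last first.
    rewrite normrM normrN normr1 mul1r ger0_norm ?phi_ge0//.
    by apply: phi_le1; rewrite lexx ler01.
  rewrite dotd /k -!mulrA normrM normr_nat ler_piMr// mulNr normrN.
  rewrite /ind1; case: ifP => h; last by rewrite !mul0r normr0.
  rewrite mul1r normrM -[leRHS]mulr1.
  by apply: ler_pM => //; rewrite (le_trans (coord_le_enorm _ _)).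
rewrite (_ : (fun x => _) = (fun x => ((d%:R + 2) * phi 1 x)%:E - (2 * ind1 x)%:E)%E).
  rewrite integralB//.
  - under eq_integral do rewrite EFinM.
    rewrite integralZl//; under [X in (_ - X)%E]eq_integral do rewrite EFinM.
    rewrite integralZl//.
      by rewrite phi_meanE ind1_mean mule1 -EFinM -EFinB lee_fin subr_ge0.
    apply: (@bounded_integrable _ _ _ nu ind1 1); first exact: measurable_ind1.
    by move=> x; rewrite /ind1; case: ifP; rewrite ?normr1 ?normr0.
  - under eq_fun do rewrite EFinM.
    exact: integrableZl.
  - under eq_fun do rewrite EFinM.
    apply: integrableZl => //; apply: (@bounded_integrable _ _ _ nu ind1 1); first exact: measurable_ind1.
    by move=> x; rewrite /ind1; case: ifP; rewrite ?normr1 ?normr0.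
apply/funext => x; rewrite sumEFin -EFinB; congr EFin.
rewrite big_split /= sumrN sumr_const card_ord.
rewrite (eq_bigr (fun j => - 2 * ind1 x * (x ord0 j * x ord0 j))); last first.
  by move=> j _; rewrite dotd /k; ring.
rewrite -mulr_sumr -/(dot x x) -enorm_sqr -mulr_natl.
rewrite /ind1; case: ifP => h; first by rewrite phi_inside//; ring.
by rewrite phi_outside ?ler01// ?ltW// 1?ltNge ?h//; ring.
Qed.

Lemma phi_mean_gt0 : 0 < phi_mean.
Proof.
have := phi_mean_ge; rewrite leNgt => h; rewrite ltNge; apply/negP => h2; move/negP: h; apply.
apply: (@le_lt_trans _ _ 0) => //; rewrite mulr_ge0_le0// addr_ge0//.
Qed.

(* The reciprocal of the factor that ball_ibp puts in front of f x - f y - 2 G eps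
   in the lower bound on the mean of <ghat, x - y>. *)
Definition cinv : R := 2 / (d%:R * phi_mean).

Lemma cinv_gt0 : 0 < cinv.
Proof. by rewrite divr_gt0// mulr_gt0 ?phi_mean_gt0// ltr0n. Qed.

Lemma cinv_le3 : cinv <= 3.
Proof.
have dp : 0 < d%:R :> R by rewrite ltr0n.
have d1 : 1 <= d%:R :> R by rewrite ler1n.
rewrite /cinv ler_pdivrMr ?mulr_gt0 ?phi_mean_gt0//.
have := phi_mean_ge; have := phi_mean_gt0 => h.
have : phi_mean * 1 <= phi_mean * d%:R by rewrite ler_pM2l.
lra.
Qed.

Definition gest (f : 'rV[R]_d -> R) (eps : R) x u : 'rV[R]_d :=
  (d%:R / (2 * eps) * (f (x + eps *: u) - f (x - eps *: u))) *: u.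

(** Convexity bounds from below the increments, in the direction x - y, of u -> f (x + eps u) - f (x
    - eps u) by the loss gap between x and y; [ball_ibp] turns this into a bound on the mean of the
    estimator. The term 2 G eps pays for evaluating the gap at shifted points. *)
Lemma gest_mean_ge (X : set 'rV[R]_d) (f : 'rV[R]_d -> R) (G eps Mf : R) x y :
  measurable_fun setT (f : Rvec R d -> R) -> (forall z, `|f z| <= Mf) -> 0 <= G -> 0 < eps ->
  (forall a b (t : R), X a -> X b -> 0 <= t <= 1 ->
     f (t *: a + (1 - t) *: b) <= t * f a + (1 - t) * f b) ->
  (forall a b, X a -> X b -> `|f a - f b| <= G * enorm (a - b)) ->
  (forall u, enorm u <= 1 -> X (x + eps *: u)) ->
  (forall u, enorm u <= 1 -> X (y + eps *: u)) ->
  (0 <= \int[nu]_u (cinv * dot (gest f eps x (clip u)) (x - y)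
                    - (f x - f y - 2 * G * eps))%:E)%E.
Proof.
move=> mf fM G0 eps0 fcvx flip xX yX.
pose k u := ind1 u * (f (x + eps *: u) - f (x - eps *: u)).
pose A := f x - f y - 2 * G * eps; pose w := x - y.
have mfs (s : R) : measurable_fun setT ((fun u => f (x + s *: u)) : Rvec R d -> R).
  apply: (@mrow_comp _ _ _ (Rvec R d) f (fun u => x + s *: u) mf).
  by apply: mrowD; [exact: mrow_cst|apply: mrowZ; exact: measurable_id].
have mk : measurable_fun setT (k : Rvec R d -> R).
  apply: measurable_funM; first exact: measurable_ind1.
  apply: measurable_funB => //.
  rewrite (_ : (fun u => _) = (fun u => f (x + (- eps) *: u)))//.
  by apply/funext => u; rewrite scaleNr.
have kM u : `|k u| <= 2 * Mf.
  rewrite /k normrM; have h : `|f (x + eps *: u) - f (x - eps *: u)| <= 2 * Mf.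
    by apply: le_trans (ler_normB _ _) _; rewrite mulr2n mulrDl mul1r lerD.
  rewrite -[leRHS]mul1r; apply: ler_pM => //.
  by rewrite /ind1; case: ifP; rewrite ?normr1 ?normr0.
have xN u : enorm u <= 1 -> X (x - eps *: u).
  by move=> h; rewrite -scalerN; apply: xX; rewrite enormN.
have yN u : enorm u <= 1 -> X (y - eps *: u).
  by move=> h; rewrite -scalerN; apply: yX; rewrite enormN.
have x0 : X x by have := xX 0; rewrite scaler0 addr0; apply; rewrite enorm0.
have y0 : X y by have := yX 0; rewrite scaler0 addr0; apply; rewrite enorm0.
have near_ge z u (s : R) : `|s| = eps -> enorm u <= 1 -> X z -> X (z + s *: u) -> `|f (z + s *: u) - f z| <= G * eps.
  move=> se hu Xz Xz'; apply: le_trans (flip _ _ Xz' Xz) _; rewrite ler_wpM2l//.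
  by rewrite addrC addKr enormZ se ler_piMr// ltW.
have epsN : `|eps| = eps by rewrite gtr0_norm.
have epsN' : `|- eps| = eps by rewrite normrN gtr0_norm.
have H : (0 <= \int[nu]_u (2 * k u * dot u w - (2 * eps * A) * phi 1 u)%:E)%E.
  apply: (@ball_ibp _ _ nu d_gt0 nuE k w (2 * eps * A) (2 * Mf) eps^-1) => //.
  - by move=> u; rewrite ltNge /k /ind1 => /negbTE ->; rewrite mul0r.
  - by rewrite invr_gt0.
  move=> dl u /andP[dl0 dle] hu.
  have wu : 0 <= dl * enorm w by rewrite mulr_ge0 ?enorm_ge0// ltW.
  have h1 : enorm (u + dl *: w) <= 1.
    by apply: le_trans (enormD _ _) _; rewrite enormZ gtr0_norm//; lra.
  have h0 : enorm u <= 1 by lra.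
  rewrite /k /ind1 h1 h0 !mul1r.
  pose s := eps * dl.
  have s0 : 0 < s by rewrite mulr_gt0.
  have s1 : s <= 1 by rewrite /s -(mulfV (lt0r_neq0 eps0)) ler_wpM2l// ltW.
  (* x + eps u is the convex combination, with weights proportional to 1 and s, of x + eps (u + dl
     w) and y + eps u. *)
  have c1 : (1 + s) * f (x + eps *: u) <= f (x + eps *: (u + dl *: w)) + s * f (y + eps *: u).
    have s1p : 0 < 1 + s by lra.
    have := fcvx (x + eps *: (u + dl *: w)) (y + eps *: u) (1 + s)^-1 (xX _ h1) (yX _ h0).
    have -> : 0 <= (1 + s)^-1 <= 1.
      by rewrite invr_ge0 (ltW s1p) invf_le1//; lra.
    move=> /(_ isT).
    have -> : (1 + s)^-1 *: (x + eps *: (u + dl *: w)) + (1 - (1 + s)^-1) *: (y + eps *: u) = x + eps *: u.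
      apply/rowP => j; rewrite /w /s !mxE; field; move: s1p; rewrite /s; lra.
    move=> /(ler_wpM2l (ltW s1p)) h; apply: le_trans h _; rewrite le_eqVlt; apply/orP; left.
    by apply/eqP; field; lra.
  (* With the opposite sign the displaced point x - eps (u + dl w) is itself the combination, with
     weights 1 - s and s; this is why s <= 1, that is dl <= 1 / eps, is required. *)
  have c2 : f (x - eps *: (u + dl *: w)) <= (1 - s) * f (x - eps *: u) + s * f (y - eps *: u).
    have := fcvx (x - eps *: u) (y - eps *: u) (1 - s) (xN _ h0) (yN _ h0).
    have -> : 0 <= 1 - s <= 1 by apply/andP; split; lra.
    move=> /(_ isT); rewrite subKr.
    by have -> : (1 - s) *: (x - eps *: u) + s *: (y - eps *: u) = x - eps *: (u + dl *: w)
      by apply/rowP => j; rewrite /w /s !mxE; ring.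
  have := near_ge x u eps epsN h0 x0 (xX _ h0).
  have := near_ge y u eps epsN h0 y0 (yX _ h0).
  have := near_ge x u (- eps) epsN' h0 x0; rewrite scaleNr => /(_ (xN _ h0)).
  have := near_ge y u (- eps) epsN' h0 y0; rewrite scaleNr => /(_ (yN _ h0)).
  rewrite !ler_norml => /andP[_ b1] /andP[b2 _] /andP[_ b3] /andP[b4 _].
  have e1 : s * A <= s * (f (x + eps *: u) - f (y + eps *: u)).
    by rewrite ler_pM2l// /A; lra.
  have e2 : s * A <= s * (f (x - eps *: u) - f (y - eps *: u)).
    by rewrite ler_pM2l// /A; lra.
  rewrite (_ : dl * (2 * eps * A) = s * A + s * A); last by rewrite /s; ring.
  lra.
have dp : 0 < d%:R :> R by rewrite ltr0n.
have mp := phi_mean_gt0.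
have mdot : measurable_fun setT ((fun x => dot x w) : Rvec R d -> R).
  by apply: mrow_dot; [exact: measurable_id|exact: mrow_cst].
have Mf0 : 0 <= Mf := le_trans (normr_ge0 _) (fM 0).
have ik : nu.-integrable setT (EFin \o (fun u => 2 * k u * dot u w)).
  apply: (@bounded_integrable _ _ _ nu _ (2 * (2 * Mf) * enorm w)).
    by apply: measurable_funM => //; apply: measurable_funM.
  move=> u; have -> : `|2 * k u * dot u w| = 2 * (`|k u| * `|dot u w|).
    by rewrite normrM normrM normr_nat mulrA.
  rewrite -mulrA ler_wpM2l//; have [hu|hu] := leP (enorm u) 1.
    apply: ler_pM => //; apply: le_trans (dot_abs_le u w) _.
    by rewrite ler_piMl ?enorm_ge0.
  have -> : k u = 0 by rewrite /k /ind1 leNgt hu mul0r.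
  by rewrite normr0 mul0r !mulr_ge0 ?enorm_ge0.
rewrite (_ : (fun u => _) = (fun u => ((cinv * d%:R / (4 * eps))%:E * (2 * k u * dot u w)%:E - A%:E)%E)); last first.
  apply/funext => u; rewrite -EFinM -EFinB -/A -/w; congr (EFin (_ - _)).
  rewrite /gest dotZl /k clipE dotZl /ind1; case: ifP => h.
    by rewrite scale1r; field; rewrite gt_eqF.
  by rewrite scale0r scaler0 addr0 subr0 subrr !(mul0r,mulr0).
have {}H : (0 <= \int[nu]_u ((2 * k u * dot u w)%:E - (2 * eps * A)%:E * (phi 1 u)%:E))%E.
  by under eq_integral do rewrite -EFinM -EFinB.
move: H; rewrite integralB//; last exact: integrableZl.
rewrite integralZl//.
rewrite integralB//; first last.
- exact: finite_measure_integrable_cst.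
- exact: integrableZl.
rewrite integralZl// ae_integral_cst phi_meanE.
rewrite -(@fineK _ (\int[nu]_u (2 * k u * dot u w)%:E)%E); last exact: integrable_fin_num ik.
set I := fine _; rewrite -!EFinM -!EFinB !lee_fin => H.
have c0 : 0 < cinv * d%:R / (4 * eps) by apply: divr_gt0; apply: mulr_gt0 => //; exact: cinv_gt0.
(* [cinv] is defined so that all factors multiplying [A] cancel here. *)
have -> : A = cinv * d%:R / (4 * eps) * (2 * eps * A * phi_mean).
  by rewrite /cinv; field; rewrite !gt_eqF.
by rewrite -mulrBr; apply: mulr_ge0; [exact: ltW|].
Qed.

End Smoothing.

(** * Independence and filtration *)

Section IndependentTonelli.
Local Open Scope ereal_scope.
Context {R : realType} {dO dS : measure_display}.
Context {Omega : measurableType dO} {S : measurableType dS}.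
Variables (Pr : probability Omega R) (lam : probability S R) (Y : Omega -> S).
Variable PI : set (set Omega).
Hypotheses (mY : measurable_fun setT Y) (PIm : PI `<=` measurable)
  (PII : setI_closed PI) (PIT : PI setT).
Hypothesis indep : forall D B, PI D -> measurable B ->
  Pr (D `&` Y @^-1` B) = Pr D * lam B.

Local Notation W := (g_sigma_algebraType PI).

Lemma sigma_PI_measurable (A : set Omega) : <<s PI >> A -> measurable A.
Proof. by move=> h; apply: (smallest_sub (@sigma_algebra_measurable _ Omega) PIm). Qed.

(** For fixed [B] both sides are finite measures in [A] that agree on the pi-system, hence on the
    sigma-algebra it generates. *)
Lemma indep_sigma (A : set Omega) (B : set S) : <<s PI >> A -> measurable B ->
  Pr (A `&` Y @^-1` B) = Pr A * lam B.
Proof.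
move=> sA mB.
have mYB : measurable (Y @^-1` B) by rewrite -[X in measurable X]setTI; exact: mY.
have lamB0 : (0 <= fine (lam B))%R by rewrite fine_ge0.
have lamBE : lam B = (fine (lam B))%:E by rewrite fineK// fin_num_measure.
rewrite lamBE muleC.
apply: (@g_sigma_algebra_measure_unique _ R Omega PI PIm (fun=> setT) _ _
  (mrestr Pr mYB) (mscale (NngNum lamB0) Pr)) => //.
- by rewrite bigcup_const//; exists 0%N.
- move=> D PD; rewrite /mrestr /= /mscale /= muleC -lamBE.
  exact: indep.
- move=> _; rewrite /= /mrestr setTI; apply: le_lt_trans (probability_le1 Pr mYB) _.
  exact: ltry.
Qed.

Let idW : Omega -> W := fun w => w.

Let m_idW : measurable_fun setT idW.
Proof. by move=> _ A mA; rewrite setTI; exact: sigma_PI_measurable. Qed.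

HB.instance Definition _ := isMeasurableFun.Build _ _ Omega W idW m_idW.

Let joint : Omega -> W * S := fun w => (idW w, Y w).

Let m_joint : measurable_fun setT joint.
Proof. by apply: measurable_fun_pair. Qed.

HB.instance Definition _ := isMeasurableFun.Build _ _ Omega (W * S)%type joint m_joint.

(** The past is represented by the identity map from Omega to Omega with the smaller sigma-algebra.
    Its joint law with [Y] is a product, so [Psi] may depend on the past through any measurable
    quantity, and [Y] can be averaged first. *)
Lemma indep_tonelli (Psi : W * S -> \bar R) :
  measurable_fun setT Psi -> (forall p, 0 <= Psi p) ->
  \int[Pr]_w Psi (w, Y w) = \int[Pr]_w \int[lam]_y Psi (w, y).
Proof.
move=> mPsi Psi0.
transitivity (\int[distribution Pr joint]_p Psi p).
  by rewrite ge0_integral_distribution.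
transitivity (\int[distribution Pr idW \x lam]_p Psi p).
  apply: eq_measure_integral => A mA _.
  apply/esym/product_measure_unique => // B C mB mC.
  rewrite /distribution /pushforward/=.
  exact: (indep_sigma B C mB mC).
rewrite fubini_tonelli1// ge0_integral_distribution//.
- exact: measurable_fun_fubini_tonelli_F.
- by move=> y; apply: integral_ge0.
Qed.

End IndependentTonelli.

Section Filtration.
Context {R : realType} {n d : nat} {dS dO : measure_display}.
Context {S : measurableType dS} {Omega : measurableType dO}.
Variables (mu : probability S R) (Pr : probability Omega R) (T : nat).
Variables (u : nat -> 'I_n -> Omega -> Rvec R d) (xi : nat -> 'I_n -> Omega -> S).
Hypotheses (n_gt0 : (0 < n)%N) (T_gt0 : (0 < T)%N).
Hypothesis mu_ : forall t i, measurable_fun setT (u t i).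
Hypothesis mxi : forall t i, measurable_fun setT (xi t i).
Hypothesis indep : indep_randomness mu Pr T u xi.

Definition rect_event (s : nat) (A : nat -> 'I_n -> set (Rvec R d)) (B : nat -> 'I_n -> set S)
  : set Omega :=
  [set w | forall (t : nat) (i : 'I_n), (1 <= t <= s)%N -> A t i (u t i w) /\ B t i (xi t i w)].

(* A pi-system generating the information available after round s. *)
Definition past (s : nat) : set (set Omega) :=
  [set D | exists A B, [/\ forall t i, measurable (A t i), forall t i, measurable (B t i) &
     D = rect_event s A B]].

Lemma past_measurable s : past s `<=` measurable.
Proof.
move=> _ [A [B [mA mB ->]]].
have -> : rect_event s A B = \bigcap_(t in [set t | (1 <= t <= s)%N])
    \bigcap_(i in [set: 'I_n]) (u t i @^-1` A t i `&` xi t i @^-1` B t i).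
  by apply/seteqP; split => [w h t ht i _|w h t i ht]; [exact: h|exact: (h t ht i I)].
apply: bigcap_measurableType => t _; apply: fin_bigcap_measurable => // i _.
by apply: measurableI; rewrite -[X in measurable X]setTI; [exact: mu_|exact: mxi].
Qed.

Lemma past_setI s : setI_closed (past s).
Proof.
move=> _ _ [A [B [mA mB ->]]] [A' [B' [mA' mB' ->]]].
exists (fun t i => A t i `&` A' t i), (fun t i => B t i `&` B' t i).
split; try by move=> t i; apply: measurableI.
apply/seteqP; split => w /=.
  by move=> [h1 h2] t i ht; have [? ?] := h1 t i ht; have [? ?] := h2 t i ht.
by move=> h; split => t i ht; have [[? ?] [? ?]] := h t i ht.
Qed.

Lemma past_setT s : past s setT.
Proof.
exists (fun _ _ => setT), (fun _ _ => setT); split=> //.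
by apply/seteqP; split.
Qed.

Lemma past_mono s s' : (s <= s')%N -> past s `<=` past s'.
Proof.
move=> ss' _ [A [B [mA mB ->]]].
exists (fun t i => if (t <= s)%N then A t i else setT), (fun t i => if (t <= s)%N then B t i else setT).
split; try by move=> t i; case: ifP.
apply/seteqP; split => w /= h t i /andP[t1 ts].
  by case: ifP => // ts1; apply: h; rewrite t1.
by have := h t i; rewrite t1 ts (leq_trans ts ss') => /(_ isT).
Qed.

Lemma u_past s t i : (1 <= t <= s)%N ->
  measurable_fun setT (u t i : g_sigma_algebraType (past s) -> Rvec R d).
Proof.
move=> ts _ A mA; rewrite setTI; apply: sub_sigma_algebra.
exists (fun t' i' => if (t' == t) && (i' == i) then A else setT), (fun _ _ => setT).
split=> //; first by move=> t' i'; case: ifP.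
apply/seteqP; split => w /=.
  by move=> h t' i' _; split=> //; case: ifP => // /andP[/eqP -> /eqP ->].
by move=> /(_ t i ts) []; rewrite !eqxx.
Qed.

Lemma xi_past s t i : (1 <= t <= s)%N ->
  measurable_fun setT (xi t i : g_sigma_algebraType (past s) -> S).
Proof.
move=> ts _ A mA; rewrite setTI; apply: sub_sigma_algebra.
exists (fun _ _ => setT), (fun t' i' => if (t' == t) && (i' == i) then A else setT).
split=> //; first by move=> t' i'; case: ifP.
apply/seteqP; split => w /=.
  by move=> h t' i' _; split=> //; case: ifP => // /andP[/eqP -> /eqP ->].
by move=> /(_ t i ts) []; rewrite !eqxx.
Qed.

Lemma prod_update (F F' : nat -> 'I_n -> R) t j : (1 <= t <= T)%N ->
  (forall t' i', (t', i') <> (t, j) -> F' t' i' = F t' i') -> F t j = 1 ->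
  \prod_(1 <= t < T.+1) \prod_(i < n) F' t i = F' t j * \prod_(1 <= t < T.+1) \prod_(i < n) F t i.
Proof.
move=> tT FF' Ftj.
have tin : t \in index_iota 1 T.+1 by rewrite mem_index_iota ltnS.
rewrite (bigD1_seq t)//=; last exact: iota_uniq.
rewrite [in RHS](bigD1_seq t)//=; last exact: iota_uniq.
rewrite (bigD1 j)//= [in RHS](bigD1 j)//= Ftj mul1r -!mulrA; congr (_ * (_ * _)).
  by apply: eq_bigr => i ij; apply: FF' => -[] /eqP; rewrite (negbTE ij).
apply: eq_bigr => t' tt'; apply: eq_bigr => i _; apply: FF' => -[] /eqP.
by rewrite (negbTE tt').
Qed.

(** The quotient is 1 unless the volume of the ball is degenerate and the quotient is 0. In that
    case the product formula for the sure event would give probability 0. *)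
Lemma unif_ballT : unif_ball (setT : set 'rV[R]_d) = 1.
Proof.
have := indep (fun _ _ => setT) (fun _ _ => setT) (fun _ _ => measurableT) (fun _ _ => measurableT).
have -> : [set w | forall (t : nat) (i : 'I_n), (1 <= t <= T)%N ->
    (setT : set (Rvec R d)) (u t i w) /\ (setT : set S) (xi t i w)] = setT by apply/seteqP; split.
rewrite probability_setT probability_setT /= mulr1 => -[].
rewrite /unif_ball setTI; set p := fine _.
have [->|p0 _] := eqVneq p 0; last by rewrite divff.
rewrite mul0r big_nat_recr//= (bigD1 (Ordinal n_gt0))//= mul0r mulr0 => /eqP.
by rewrite oner_eq0.
Qed.

Lemma rect_event_prob A B : (forall t i, measurable (A t i)) -> (forall t i, measurable (B t i)) ->
  Pr (rect_event T A B) =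
  (\prod_(1 <= t < T.+1) \prod_(i < n) (unif_ball (A t i) * fine (mu (B t i))))%:E.
Proof. exact: indep. Qed.

Lemma fine_mu_setT : fine (mu setT) = 1.
Proof. by rewrite probability_setT. Qed.

(** Padding with full sets turns an event on [s] rounds into one on all [T] rounds, the only events
    whose probability the independence hypothesis gives. *)
Lemma past_at s D : (s <= T)%N -> past s D ->
  exists A B, [/\ forall t i, measurable (A t i), forall t i, measurable (B t i),
    forall t i, (s < t)%N -> A t i = setT /\ B t i = setT & D = rect_event T A B].
Proof.
move=> sT [A [B [mA mB ->]]].
exists (fun t i => if (t <= s)%N then A t i else setT), (fun t i => if (t <= s)%N then B t i else setT).
split; try by move=> t i; case: ifP.
  by move=> t i; rewrite ltnNge => /negbTE ->.
apply/seteqP; split => w /= h t i /andP[t1 ts].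
  by case: ifP => // ts1; apply: h; rewrite t1.
by have := h t i; rewrite t1 ts (leq_trans ts sT) => /(_ isT).
Qed.

Lemma past_indep_u s t j D A0 : (s < t <= T)%N -> past s D -> measurable A0 ->
  Pr (D `&` u t j @^-1` A0) = (Pr D * (unif_ball A0)%:E)%E.
Proof.
move=> /andP[st tT] PD mA0.
have [A [B [mA mB AB ->]]] := past_at _ _ (leq_trans (ltnW st) tT) PD.
have t1 : (1 <= t <= T)%N by rewrite (leq_ltn_trans _ st).
have -> : rect_event T A B `&` u t j @^-1` A0 =
    rect_event T (fun t' i' => if (t' == t) && (i' == j) then A0 else A t' i') B.
  apply/seteqP; split => w /=.
    move=> [h hA] t' i' ht; case: ifP => [/andP[/eqP -> /eqP ->]|_]; last exact: h.
    by split=> //; have [] := h t j t1.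
  move=> h; split; last by have [] := h t j t1; rewrite !eqxx.
  move=> t' i' ht; have := h t' i' ht; case: ifP => [/andP[/eqP -> /eqP ->]|//] [_ hB].
  by have [-> _] := AB t j st.
rewrite !rect_event_prob//; last by move=> t' i'; case: ifP.
rewrite -EFinM mulrC; congr EFin.
have [At Bt] := AB t j st.
rewrite (prod_update (fun t i => unif_ball (A t i) * fine (mu (B t i))) _ t j)//.
- by rewrite !eqxx /= Bt fine_mu_setT mulr1.
- by move=> t' i' h; case: ifP => // /andP[/eqP a /eqP b]; exfalso; apply: h; rewrite a b.
- by rewrite At Bt unif_ballT fine_mu_setT mulr1.
Qed.

Lemma past_indep_xi s t j D B0 : (s < t <= T)%N -> past s D -> measurable B0 ->
  Pr (D `&` xi t j @^-1` B0) = (Pr D * mu B0)%E.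
Proof.
move=> /andP[st tT] PD mB0.
have [A [B [mA mB AB ->]]] := past_at _ _ (leq_trans (ltnW st) tT) PD.
have t1 : (1 <= t <= T)%N by rewrite (leq_ltn_trans _ st).
have -> : rect_event T A B `&` xi t j @^-1` B0 =
    rect_event T A (fun t' i' => if (t' == t) && (i' == j) then B0 else B t' i').
  apply/seteqP; split => w /=.
    move=> [h hA] t' i' ht; case: ifP => [/andP[/eqP -> /eqP ->]|_]; last exact: h.
    by split=> //; have [] := h t j t1.
  move=> h; split; last by have [] := h t j t1; rewrite !eqxx.
  move=> t' i' ht; have := h t' i' ht; case: ifP => [/andP[/eqP -> /eqP ->]|//] [hA _].
  by have [_ ->] := AB t j st.
rewrite !rect_event_prob//; last by move=> t' i'; case: ifP.
rewrite -[mu B0]fineK ?fin_num_measure// -EFinM mulrC; congr EFin.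
have [At Bt] := AB t j st.
rewrite (prod_update (fun t i => unif_ball (A t i) * fine (mu (B t i))) _ t j)//.
- by rewrite !eqxx /= At unif_ballT mul1r.
- by move=> t' i' h; case: ifP => // /andP[/eqP a /eqP b]; exfalso; apply: h; rewrite a b.
- by rewrite At Bt unif_ballT fine_mu_setT mulr1.
Qed.

Lemma u_law t j A0 : (1 <= t <= T)%N -> measurable A0 -> Pr (u t j @^-1` A0) = (unif_ball A0)%:E.
Proof.
move=> t1 mA0; have := past_indep_u 0 t j setT A0 t1 (past_setT 0) mA0.
by rewrite setTI probability_setT mul1e.
Qed.

HB.instance Definition _ t j := isMeasurableFun.Build _ _ Omega (Rvec R d) (u t j) (mu_ t j).

(** [unif_ball] is a mere set function; the law of one sample realises it as a probability
    measure. *)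
Definition nu : probability (Rvec R d) R := distribution Pr (u 1 (Ordinal n_gt0)).

Lemma nuE A : measurable A -> nu A = (unif_ball A)%:E.
Proof. by move=> mA; rewrite /nu /= /distribution /pushforward u_law// T_gt0. Qed.

Definition adapted s (V : Omega -> 'rV[R]_d) := @mrow R d _ (g_sigma_algebraType (past s)) V.

Lemma past_fun_mono {dU} {U : measurableType dU} s s' (V : Omega -> U) : (s <= s')%N ->
  measurable_fun setT (V : g_sigma_algebraType (past s) -> U) ->
  measurable_fun setT (V : g_sigma_algebraType (past s') -> U).
Proof.
move=> ss' mV _ A mA; have := mV measurableT A mA; rewrite !setTI.
by apply: sub_sigma_algebra2; exact: past_mono.
Qed.

Lemma past_fun_measurable {dU} {U : measurableType dU} s (V : Omega -> U) :
  measurable_fun setT (V : g_sigma_algebraType (past s) -> U) -> measurable_fun setT V.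
Proof.
move=> mV _ A mA; have := mV measurableT A mA; rewrite !setTI.
by apply: sigma_PI_measurable; exact: past_measurable.
Qed.

Lemma u_tonelli s t j (Psi : g_sigma_algebraType (past s) * Rvec R d -> \bar R) :
  (s < t <= T)%N -> measurable_fun setT Psi -> (forall p, 0 <= Psi p)%E ->
  (\int[Pr]_w Psi (w, u t j w) = \int[Pr]_w \int[nu]_y Psi (w, y))%E.
Proof.
move=> st; apply: indep_tonelli => //; [exact: past_measurable|exact: past_setI|exact: past_setT|].
by move=> D B PD mB; rewrite (past_indep_u s)// nuE.
Qed.

Lemma xi_tonelli s t j (Psi : g_sigma_algebraType (past s) * S -> \bar R) :
  (s < t <= T)%N -> measurable_fun setT Psi -> (forall p, 0 <= Psi p)%E ->
  (\int[Pr]_w Psi (w, xi t j w) = \int[Pr]_w \int[mu]_y Psi (w, y))%E.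
Proof.
move=> st; apply: indep_tonelli => //; [exact: past_measurable|exact: past_setI|exact: past_setT|].
by move=> D B PD mB; exact: (past_indep_xi s t j D B st PD mB).
Qed.

Variables (C : S -> 'rV[R]_d -> 'rV[R]_d) (om : R).
Hypothesis Ccontr : contractive_compressor mu C om.
Hypothesis mC : measurable_fun setT (fun p : S * Rvec R d => (C p.1 p.2 : Rvec R d)).

Lemma adapted_compress s t j (V : Omega -> 'rV[R]_d) : (1 <= t <= s)%N -> adapted s V ->
  adapted s (fun w => C (xi t j w) (V w)).
Proof.
move=> ts aV; apply: (measurableT_comp (f := fun p : S * Rvec R d => (C p.1 p.2 : Rvec R d)) mC
  (g := fun w : g_sigma_algebraType (past s) => (xi t j w, V w : Rvec R d))).
by apply: measurable_fun_pair => //; exact: xi_past.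
Qed.

(** The input [V] is determined by the past and the seed is fresh, so the contraction property,
    which concerns a fixed vector, can be applied under the integral over the past. *)
Lemma compress_error s t j (V : Omega -> 'rV[R]_d) : (s < t <= T)%N -> adapted s V ->
  (\int[Pr]_w (enorm (C (xi t j w) (V w) - V w) ^+ 2)%:E
    <= \int[Pr]_w ((1 - om) * enorm (V w) ^+ 2)%:E)%E.
Proof.
move=> st aV.
pose W := g_sigma_algebraType (past s).
have mV : mrow (fun p : W * S => V p.1) by exact: (measurableT_comp aV measurable_fst).
have mCV : mrow (fun p : W * S => C p.2 (V p.1)).
  apply: (measurableT_comp (f := fun p : S * Rvec R d => (C p.1 p.2 : Rvec R d)) mC
    (g := fun p : W * S => (p.2, V p.1 : Rvec R d))).
  by apply: measurable_fun_pair.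
pose Psi (p : W * S) := (enorm (C p.2 (V p.1) - V p.1) ^+ 2)%:E.
have -> : (\int[Pr]_w (enorm (C (xi t j w) (V w) - V w) ^+ 2)%:E = \int[Pr]_w Psi (w, xi t j w))%E by [].
rewrite (xi_tonelli s)//; first last.
- by move=> p; rewrite lee_fin sqr_ge0.
- apply/measurable_EFinP; apply: measurable_funX; apply: mrow_enorm; exact: mrowB.
apply: (@ge0_le_integral_sup R _ Omega Pr (fun w => (\int[mu]_y Psi (w, y))%E)
  (fun w => ((1 - om) * enorm (V w) ^+ 2)%:E)) => w.
  by apply: integral_ge0 => y _; rewrite lee_fin sqr_ge0.
exact: (Ccontr (V w)).
Qed.

End Filtration.

(** * Compressed gossip *)

Section GossipRate.
Context {R : realType}.
Variables (om rho beta : R).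
Hypotheses (om01 : 0 < om <= 1) (rho_p : 0 < rho) (rho_beta : rho <= beta).

Definition gossip_den : R := 2 * rho * beta ^+ 2 + 4 * beta ^+ 2
       + (2 - om) * (beta ^+ 2 + 2 * beta) * rho + rho ^+ 2.
Definition gossip_gamma : R := om * rho / gossip_den.
Local Notation g := gossip_gamma.

Let om0 : 0 < om. Proof. by case/andP: om01. Qed.
Let om1 : om <= 1. Proof. by case/andP: om01. Qed.
Let beta_gt0 : 0 < beta. Proof. exact: lt_le_trans rho_p rho_beta. Qed.

Lemma gossip_den_gt0 : 0 < gossip_den.
Proof.
rewrite /gossip_den !addr_gt0 ?mulr_gt0 ?exprn_gt0//; last by rewrite addr_gt0 ?exprn_gt0 ?mulr_gt0.
by have := om1; lra.
Qed.

Lemma gamma_gt0 : 0 < g.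
Proof. by rewrite divr_gt0 ?gossip_den_gt0// mulr_gt0. Qed.

Lemma gamma_den : g * gossip_den = om * rho.
Proof. by rewrite divfK// gt_eqF ?gossip_den_gt0. Qed.

(** Only the summand 4 beta^2 of the denominator is kept. *)
Lemma gamma_beta_sqr : 4 * g * beta ^+ 2 <= om * rho.
Proof.
rewrite -gamma_den (mulrC 4) -mulrA ler_pM2l ?gamma_gt0// /gossip_den.
have := beta_gt0; have := om1; have := rho_p => r0 o1 b0.
have : 0 <= (2 - om) * (beta ^+ 2 + 2 * beta) * rho.
  have o2 : 0 <= 2 - om by lra.
  by rewrite mulr_ge0 ?(ltW r0)// mulr_ge0// addr_ge0 ?sqr_ge0// mulr_ge0 ?(ltW b0).
have : 0 <= 2 * rho * beta ^+ 2 by rewrite !mulr_ge0 ?sqr_ge0// ltW.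
have := sqr_ge0 rho; lra.
Qed.

Lemma gamma_beta_le : g * beta <= om / 4.
Proof.
rewrite ler_pdivlMr// -(ler_pM2r beta_gt0).
have -> : g * beta * 4 * beta = 4 * g * beta ^+ 2 by ring.
by apply: le_trans gamma_beta_sqr _; rewrite ler_pM2l.
Qed.

Lemma gamma_rho_le : g * rho <= om / 4.
Proof. by apply: le_trans gamma_beta_le; rewrite ler_pM2l ?gamma_gt0. Qed.

(** [rate_c1] and [rate_c2] are the weights with which the consensus and the compression error enter
    the bound [gossip_row] on their sum after one gossip step. *)
Definition rate_c1 : R := (1 + g * rho / 2) * (1 - g * rho) ^+ 2 + (1 + (om / 2)^-1) * (g * beta) ^+ 2.
Definition rate_c2 : R := (1 + (g * rho / 2)^-1) * (g * beta) ^+ 2 + (1 + om / 2) * (1 + g * beta) ^+ 2.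

(* The denominator of gamma is designed for these two estimates, which make both
   parts of the Lyapunov function decay at the common rate 1 - g rho / 2 (the
   coefficient rate_c2 being multiplied by 1 - om in expectation). *)
Lemma rate_c1_le : rate_c1 <= 1 - g * rho / 2.
Proof.
rewrite /rate_c1; set e := g * rho.
have e0 : 0 < e by rewrite mulr_gt0 ?gamma_gt0.
have e1 : e <= 1 / 4.
  have h : e <= om / 4 := gamma_rho_le.
  by have := om1; lra.
have a2 : (g * beta) ^+ 2 <= om * e / 4.
  have := ler_wpM2l (ltW gamma_gt0) gamma_beta_sqr.
  rewrite /e exprMn; lra.
have h : (1 + (om / 2)^-1) * (g * beta) ^+ 2 <= (1 + (om / 2)^-1) * (om * e / 4).
  by rewrite ler_wpM2l// addr_ge0// invr_ge0 divr_ge0// ltW.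
apply: (@le_trans _ _ ((1 + e / 2) * (1 - e) ^+ 2 + (1 + (om / 2)^-1) * (om * e / 4))).
  by rewrite lerD2l.
have -> : (1 + (om / 2)^-1) * (om * e / 4) = (om + 2) * e / 4 by field; rewrite gt_eqF.
have h1 : (om + 2) * e <= 3 * e by rewrite ler_pM2r//; have := om1; lra.
have h2 : e * e <= 1 / 4 * (1 / 4) by apply: ler_pM => //; exact: ltW.
have h3 : e * e * e <= 1 / 4 * (1 / 4) * e by rewrite ler_pM2r.
have -> : (1 + e / 2) * (1 - e) ^+ 2 = 1 - 3 / 2 * e + e * e * e / 2 by field.
lra.
Qed.

Lemma rate_c2_le : (1 - om) * rate_c2 <= 1 - g * rho / 2.
Proof.
have g0 := gamma_gt0; have o0 := om0; have o1 := om1.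
rewrite /rate_c2; set a := g * beta; set e := g * rho.
have a0 : 0 <= a by rewrite mulr_ge0// ltW.
have a1 : a <= om / 4 := gamma_beta_le.
have e0 : 0 < e by rewrite mulr_gt0.
pose h := 2 * g * beta ^+ 2 / rho.
have h0 : 0 <= h.
  apply: divr_ge0; last exact: ltW.
  by apply: mulr_ge0; [apply: mulr_ge0 => //; exact: ltW|exact: sqr_ge0].
have b0 : 0 <= g * beta ^+ 2 by rewrite mulr_ge0 ?sqr_ge0// ltW.
(* This is [gamma_den] divided by 2 rho: each summand of the denominator pays for one of the terms
   below, and together they use exactly om / 2. *)
have key : g * beta ^+ 2 + h + (2 - om) * (g * beta ^+ 2 / 2 + a) + e / 2 = om / 2.
  apply: (mulIf (lt0r_neq0 rho_p)).
  have -> : om / 2 * rho = g * gossip_den / 2 by rewrite gamma_den; ring.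
  by rewrite /h /a /e /gossip_den; field; rewrite gt_eqF.
have -> : (1 + (e / 2)^-1) * a ^+ 2 = a ^+ 2 + h.
  by rewrite /h /a /e; field; rewrite !gt_eqF.
have k1 : 0 <= (2 - om) * (g * beta ^+ 2 / 2).
  by apply: mulr_ge0; [lra|apply: divr_ge0].
have k2 : (1 - om) * (a ^+ 2 + h) <= a ^+ 2 + h.
  by apply: ler_piMl; [apply: addr_ge0; rewrite ?sqr_ge0|lra].
have k3 : a ^+ 2 <= (om / 4) ^+ 2 by rewrite ler_sqr ?nnegrE// divr_ge0// ltW.
have k4 : (1 - om) * (1 + om / 2) * (2 * a) <= (2 - om) * a.
  rewrite mulrA ler_wpM2r//.
  have : 0 <= om * om by rewrite mulr_ge0// ltW.
  lra.
have k5 : (1 - om) * (1 + om / 2) * a ^+ 2 <= a ^+ 2.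
  apply: ler_piMl; first exact: sqr_ge0.
  have : 0 <= om * om by rewrite mulr_ge0// ltW.
  lra.
have -> : (1 - om) * (a ^+ 2 + h + (1 + om / 2) * (1 + a) ^+ 2) =
  (1 - om) * (a ^+ 2 + h) + ((1 - om) * (1 + om / 2) * (2 * a) +
  (1 - om) * (1 + om / 2) * a ^+ 2) + (1 - om) * (1 + om / 2) by ring.
have : 0 <= om * om by rewrite mulr_ge0// ltW.
move: k3; rewrite expr_div_n [om ^+ 2]expr2; lra.
Qed.

Lemma rate_c1_ge0 : 0 <= rate_c1.
Proof.
have e0 : 0 <= g * rho / 2 by apply: divr_ge0 => //; apply: mulr_ge0; apply: ltW => //; exact: gamma_gt0.
have o0 : 0 <= om / 2 by apply: divr_ge0 => //; exact: ltW.
by apply: addr_ge0; apply: mulr_ge0; rewrite ?sqr_ge0// addr_ge0// invr_ge0.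
Qed.

Lemma rate_c2_ge0 : 0 <= rate_c2.
Proof.
have e0 : 0 <= g * rho / 2 by apply: divr_ge0 => //; apply: mulr_ge0; apply: ltW => //; exact: gamma_gt0.
have o0 : 0 <= om / 2 by apply: divr_ge0 => //; exact: ltW.
by apply: addr_ge0; apply: mulr_ge0; rewrite ?sqr_ge0// addr_ge0// invr_ge0.
Qed.

End GossipRate.

Section Average.
Context {R : realType} {n d : nat}.
Hypothesis n_gt0 : (0 < n)%N.
Implicit Types (y z : 'I_n -> 'rV[R]_d).

Definition avg y : 'rV[R]_d := n%:R^-1 *: \sum_i y i.
Definition sqs y : R := \sum_i enorm (y i) ^+ 2.

Let nR : 0 < n%:R :> R. Proof. by rewrite ltr0n. Qed.

Lemma sqs_ge0 y : 0 <= sqs y.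
Proof. by apply: sumr_ge0 => i _; rewrite sqr_ge0. Qed.

Lemma avg_sum y : \sum_i y i = n%:R *: avg y.
Proof. by rewrite scalerA mulfV ?scale1r// gt_eqF. Qed.

Lemma avg_dev_sum y : \sum_i (y i - avg y) = 0.
Proof.
by rewrite sumrB sumr_const card_ord avg_sum scaler_nat subrr.
Qed.

(** Pythagoras: the deviations from the average sum to zero, so the cross terms vanish. *)
Lemma sqs_split y (a : 'rV[R]_d) :
  sqs (fun i => y i - a) = sqs (fun i => y i - avg y) + n%:R * enorm (avg y - a) ^+ 2.
Proof.
rewrite /sqs (eq_bigr (fun i => enorm (y i - avg y) ^+ 2 +
   (2 * dot (y i - avg y) (avg y - a) + enorm (avg y - a) ^+ 2))).
  rewrite !big_split /= -mulr_sumr -dot_suml avg_dev_sum dot0l mulr0 add0r.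
  by rewrite sumr_const card_ord mulr_natl.
move=> i _; rewrite !enorm_sqr.
have -> : y i - a = (y i - avg y) + (avg y - a) by rewrite subrKA.
have gen (p q : 'rV[R]_d) : dot (p + q) (p + q) = dot p p + (2 * dot p q + dot q q).
  by rewrite dotDl !dotDr (dotC q p); ring.
exact: gen.
Qed.

Lemma sqs_avg_le y (a : 'rV[R]_d) : sqs (fun i => y i - avg y) <= sqs (fun i => y i - a).
Proof. by rewrite (sqs_split y a) lerDl mulr_ge0 ?sqr_ge0// ltW. Qed.

Lemma sqs_avg_dist y (a : 'rV[R]_d) : n%:R * enorm (avg y - a) ^+ 2 <= sqs (fun i => y i - a).
Proof. by rewrite (sqs_split y a) lerDr sqs_ge0. Qed.

Lemma avgB y z : avg (fun i => y i - z i) = avg y - avg z.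
Proof. by rewrite /avg sumrB scalerBr. Qed.

Lemma avg_in (K : set 'rV[R]_d) y : cvx_set K -> (forall i, K (y i)) -> K (avg y).
Proof.
move=> cK Ky; rewrite /avg.
suff H : forall s : seq 'I_n, (0 < size s)%N -> K ((size s)%:R^-1 *: \sum_(i <- s) y i).
  have := H (index_enum 'I_n); have -> : size (index_enum 'I_n) = n.
    by rewrite -sum1_size sum1_card card_ord.
  exact.
elim=> // i [_ _|j s IH _]; first by rewrite big_seq1 invr1 scale1r.
have {}IH := IH isT; set m := size (j :: s) in IH *.
have m0 : 0 < m%:R :> R by rewrite ltr0n.
rewrite big_cons /= -/m.
have m1 : m.+1%:R != 0 :> R by rewrite pnatr_eq0.
have -> : m.+1%:R^-1 *: (y i + \sum_(k <- j :: s) y k)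
   = m.+1%:R^-1 *: y i + (1 - m.+1%:R^-1) *: (m%:R^-1 *: \sum_(k <- j :: s) y k).
  rewrite scalerDr scalerA; congr (_ + _ *: _).
  move: m1; rewrite -natr1 => m1; field; rewrite m1 gt_eqF//.
by apply: cK => //; rewrite invr_ge0 ler0n invf_le1 ?ltr0n// ler1n.
Qed.

(** Collects one coordinate of all learners into a vector of length n, on which [P] acts; spectral
    bounds are applied coordinate by coordinate. *)
Definition rowc y (c : 'I_d) : 'rV[R]_n := \row_i y i ord0 c.

Lemma sqs_rowc y : sqs y = \sum_c enorm (rowc y c) ^+ 2.
Proof.
rewrite /sqs (eq_bigr (fun i => \sum_c y i ord0 c ^+ 2)); last first.
  by move=> i _; rewrite enorm_sqr; apply: eq_bigr => c _; rewrite expr2.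
rewrite exchange_big; apply: eq_bigr => c _; rewrite enorm_sqr.
by apply: eq_bigr => i _; rewrite !mxE expr2.
Qed.

End Average.

Section GossipStep.
Context {R : realType} {n d : nat} (E : rel 'I_n) (P : 'M[R]_n) (om : R).
Hypotheses (n2 : (2 <= n)%N) (cP : comm_matrix E P) (om01 : 0 < om <= 1).
Let rho := 1 - singval P 1.
Let beta := singval (1%:M - P) 0.
Let g := gossip_gamma om rho beta.

Let symP : P^T = P. Proof. by case: cP => -[]. Qed.
Let P_ge0 i j : 0 <= P i j. Proof. by case: cP => -[_ ? _ _] _. Qed.
Let rowP1 i : \sum_(j < n) P i j = 1. Proof. by case: cP => -[_ _ ? _] _. Qed.
Let colP1 j : \sum_(i < n) P i j = 1. Proof. by case: cP => -[_ _ _ ?] _. Qed.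
Let sigma1 : singval P 1 < 1. Proof. by case: cP => _ []. Qed.
Let PE i j : ~~ (E i j || (i == j)) -> P i j = 0. Proof. by case: cP => _ [_ h _]; exact: h. Qed.
Let n_gt0 : (0 < n)%N. Proof. exact: ltnW. Qed.

Lemma rho_pos : 0 < rho. Proof. exact: rho_gt0. Qed.
Lemma rho_beta_le : rho <= beta. Proof. exact: rho_le_beta. Qed.
Let g0 : 0 < g. Proof. exact: gamma_gt0 om01 rho_pos rho_beta_le. Qed.
Let gb : g * beta <= om / 4. Proof. exact: gamma_beta_le om01 rho_pos rho_beta_le. Qed.

(** With w = v - m and e = z - v, the new deviation is (I + g (P - I)) w + g (P - I) e, and the new
    compression error is (g (P - I) - I) e + g (P - I) w. Young's inequality separates the two
    summands, and [gossip_contract] gives the gain on w. *)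
Lemma gossip_row (m : R) (v z v' : 'rV[R]_n) : \sum_i (v ord0 i - m) = 0 ->
  v' = v + g *: (z *m P - z) ->
  enorm (v' - const_mx m) ^+ 2 + enorm (v' - z) ^+ 2 <=
  rate_c1 om rho beta * enorm (v - const_mx m) ^+ 2 + rate_c2 om rho beta * enorm (z - v) ^+ 2.
Proof.
move=> vm v'E; set w := v - const_mx m; set e := z - v.
have o0 : 0 < om by case/andP: om01.
have o1 : om <= 1 by case/andP: om01.
have w0 : \sum_i w ord0 i = 0.
  by rewrite -[RHS]vm; apply: eq_bigr => i _; rewrite !mxE.
have wP : v *m P - v = w *m P - w.
  rewrite /w mulmxBl (comm_const P symP rowP1).
  by apply/rowP => i; rewrite !mxE; ring.
have gb1 : g * beta <= 1 by move: gb; lra.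
have bw x : enorm (x *m P - x) <= beta * enorm x.
  by rewrite enorm_distC; exact: comm_defect.
have zE : z = v + e by rewrite /e addrC subrK.
have d1 : v' - const_mx m = (w + g *: (w *m P - w)) + g *: (e *m P - e).
  rewrite v'E zE mulmxDl -wP /w; apply/rowP => i; rewrite !mxE; ring.
have d2 : v' - z = (g *: (e *m P - e) - e) + g *: (w *m P - w).
  rewrite v'E zE mulmxDl -wP /w; apply/rowP => i; rewrite !mxE; ring.
have n1 : enorm (w + g *: (w *m P - w)) <= (1 - g * rho) * enorm w.
  by apply: gossip_contract => //; exact: ltW.
have n2' x : enorm (g *: (x *m P - x)) <= g * beta * enorm x.
  by rewrite enormZ gtr0_norm// -mulrA ler_pM2l.
have n3 : enorm (g *: (e *m P - e) - e) <= (1 + g * beta) * enorm e.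
  by apply: le_trans (enormB _ _) _; have := n2' e; lra.
have sq (a b : R) : 0 <= a -> a <= b -> a ^+ 2 <= b ^+ 2.
  by move=> a0 ab; rewrite ler_sqr ?nnegrE// (le_trans a0).
have e1 : 0 < g * rho / 2 by rewrite divr_gt0// mulr_gt0// rho_pos.
have e2 : 0 < om / 2 by rewrite divr_gt0.
rewrite d1 d2.
have y1 := enormD_sqr_young _ (w + g *: (w *m P - w)) (g *: (e *m P - e)) e1.
have y2 := enormD_sqr_young _ (g *: (e *m P - e) - e) (g *: (w *m P - w)) e2.
have s1 := ler_wpM2l (ltW (ltr_wpDr (ltW e1) ltr01)) (sq _ _ (enorm_ge0 _) n1).
have s2 := ler_wpM2l (ltW (ltr_wpDr (ltW e2) ltr01)) (sq _ _ (enorm_ge0 _) n3).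
have i1 : 0 <= 1 + (g * rho / 2)^-1 by rewrite addr_ge0// invr_ge0 ltW.
have i2 : 0 <= 1 + (om / 2)^-1 by rewrite addr_ge0// invr_ge0 ltW.
have s3 := ler_wpM2l i1 (sq _ _ (enorm_ge0 _) (n2' e)).
have s4 := ler_wpM2l i2 (sq _ _ (enorm_ge0 _) (n2' w)).
move: y1 y2 s1 s2 s3 s4; rewrite /rate_c1 /rate_c2 -/g !exprMn; lra.
Qed.

Definition gossip (y z : 'I_n -> 'rV[R]_d) : 'I_n -> 'rV[R]_d :=
  fun i => y i + g *: \sum_(j < n | E i j || (j == i)) P i j *: (z j - z i).

Lemma gossipE y z i : gossip y z i = y i + g *: (\sum_(j < n) P i j *: z j - z i).
Proof.
congr (_ + _ *: _).
rewrite big_mkcond /= (eq_bigr (fun j => P i j *: z j - P i j *: z i)).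
  by rewrite sumrB -scaler_suml rowP1 scale1r.
move=> j _; case: ifPn => h; first by rewrite scalerBr.
by rewrite PE 1?eq_sym// !scale0r subr0.
Qed.

(** The column sums of [P] are 1, so the corrections add up to zero whatever [z] is: compression
    never biases the average. *)
Lemma gossip_avg y z : avg (gossip y z) = avg y.
Proof.
rewrite /avg; congr (_ *: _).
rewrite (eq_bigr (fun i => y i + g *: (\sum_(j < n) P i j *: z j - z i))); last first.
  by move=> i _; exact: gossipE.
rewrite big_split /= -scaler_sumr sumrB exchange_big /=.
have -> : \sum_(j < n) \sum_(i < n) P i j *: z j = \sum_(j < n) z j.
  by apply: eq_bigr => j _; rewrite -scaler_suml colP1 scale1r.
by rewrite subrr scaler0 addr0.
Qed.

(* y is the current vector and z its updated compressed copy: the weights of the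
   two applications of Young's inequality are g rho / 2 and om / 2. *)
Lemma gossip_lyapunov y z :
  sqs (fun i => gossip y z i - avg (gossip y z)) + sqs (fun i => gossip y z i - z i) <=
  rate_c1 om rho beta * sqs (fun i => y i - avg y) + rate_c2 om rho beta * sqs (fun i => z i - y i).
Proof.
rewrite gossip_avg !sqs_rowc !mulr_sumr -!big_split /=; apply: ler_sum => c _.
have vm : \sum_i (rowc y c ord0 i - avg y ord0 c) = 0.
  have := congr1 (fun v : 'rV[R]_d => v ord0 c) (avg_dev_sum n_gt0 y).
  rewrite summxE !mxE => h; rewrite -[RHS]h; apply: eq_bigr => i _; rewrite !mxE//.
have E' : rowc (gossip y z) c = rowc y c + g *: (rowc z c *m P - rowc z c).
  apply/rowP => i; rewrite mxE gossipE !mxE summxE; congr (_ + _ * (_ - _)).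
  by apply: eq_bigr => j _; rewrite !mxE mulrC -[in LHS]symP mxE.
have rB (a b : 'I_n -> 'rV[R]_d) : rowc (fun i => a i - b i) c = rowc a c - rowc b c.
  by apply/rowP => i; rewrite !mxE.
have rC (a : 'rV[R]_d) : rowc (fun _ : 'I_n => a) c = const_mx (a ord0 c).
  by apply/rowP => i; rewrite !mxE.
have := gossip_row (avg y ord0 c) (rowc y c) (rowc z c) (rowc (gossip y z) c) vm E'.
by rewrite !rB !rC.
Qed.

End GossipStep.

(** * Expectations of nonnegative functions and of one compressed step *)

Section NonnegExpectation.
Context {R : realType} {dO : measure_display} {Omega : measurableType dO}.
Variable Pr : probability Omega R.
Implicit Types h k : Omega -> R.

(** Extended-real valued and used on nonnegative functions: then sums, scalings and comparisons
    require no integrability. *)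
Definition EE h : \bar R := (\int[Pr]_w (h w)%:E)%E.

Arguments EE h%_R.

Definition nnm h := measurable_fun setT h /\ forall w, 0 <= h w.

Lemma nnmD h k : nnm h -> nnm k -> nnm (fun w => h w + k w).
Proof.
by move=> [mh h0] [mk k0]; split; [exact: measurable_funD|move=> w; exact: addr_ge0].
Qed.

Lemma nnmZ a h : 0 <= a -> nnm h -> nnm (fun w => a * h w).
Proof.
move=> a0 [mh h0]; split; [|by move=> w; exact: mulr_ge0].
by apply: measurable_funM => //; exact: measurable_cst.
Qed.

Lemma nnm_cst a : 0 <= a -> nnm (fun=> a).
Proof. by move=> a0; split=> //; exact: measurable_cst. Qed.

Lemma nnm_sum (I : finType) (F : I -> Omega -> R) : (forall i, nnm (F i)) ->
  nnm (fun w => \sum_i F i w).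
Proof.
move=> hF; split; first by apply: measurable_sum => i; case: (hF i).
by move=> w; apply: sumr_ge0 => i _; case: (hF i).
Qed.

Lemma EE_ge0 h : (forall w, 0 <= h w) -> (0 <= EE h)%E.
Proof. by move=> h0; apply: integral_ge0 => w _; rewrite lee_fin. Qed.

Lemma EE_le h k : (forall w, 0 <= h w) -> (forall w, h w <= k w) -> (EE h <= EE k)%E.
Proof. by move=> h0 hk; apply: ge0_le_integral_sup => w; rewrite lee_fin. Qed.

Lemma EE_D h k : nnm h -> nnm k -> (EE (fun w => (h w + k w)%R) = EE h + EE k)%E.
Proof.
move=> [mh h0] [mk k0]; rewrite /EE -ge0_integralD//.
- by move=> w _; rewrite lee_fin.
- exact/measurable_EFinP.
- by move=> w _; rewrite lee_fin.
- exact/measurable_EFinP.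
Qed.

Lemma EE_Z a h : 0 <= a -> nnm h -> (EE (fun w => (a * h w)%R) = a%:E * EE h)%E.
Proof.
move=> a0 [mh h0]; rewrite /EE -ge0_integralZl//.
- exact/measurable_EFinP.
- by move=> w _; rewrite lee_fin.
Qed.

Lemma EE_cst a : EE (fun=> a) = a%:E.
Proof. by rewrite /EE integral_cst// (_ : _ setT = 1%E) ?mule1//; exact: probability_setT. Qed.

Lemma EE_sum (I : finType) (F : I -> Omega -> R) : (forall i, nnm (F i)) ->
  (EE (fun w => \sum_i F i w)%R = \sum_i EE (F i))%E.
Proof.
move=> hF; rewrite /EE -ge0_integral_sum//.
- by apply: eq_integral => w _; rewrite sumEFin.
- by move=> i; apply/measurable_EFinP; case: (hF i).
- by move=> i w _; rewrite lee_fin; case: (hF i).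
Qed.

Lemma EE_sum_nat (m k : nat) (F : nat -> Omega -> R) : (forall i, nnm (F i)) ->
  (EE (fun w => \sum_(m <= i < k) F i w)%R = \sum_(m <= i < k) EE (F i))%E.
Proof.
move=> hF; rewrite /EE -ge0_integral_sum//.
- by apply: eq_integral => w _; rewrite sumEFin.
- by move=> i; apply/measurable_EFinP; case: (hF i).
- by move=> i w _; rewrite lee_fin; case: (hF i).
Qed.

End NonnegExpectation.
Arguments EE {R dO Omega} Pr h%_R.

Section CompressedSteps.
Context {R : realType} {n d : nat} {dS dO : measure_display}.
Context {S : measurableType dS} {Omega : measurableType dO}.
Variables (mu : probability S R) (Pr : probability Omega R) (T : nat).
Variables (u : nat -> 'I_n -> Omega -> Rvec R d) (xi : nat -> 'I_n -> Omega -> S).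
Variables (E : rel 'I_n) (P : 'M[R]_n) (om : R) (C : S -> 'rV[R]_d -> 'rV[R]_d).
Hypotheses (n2 : (2 <= n)%N) (T_gt0 : (0 < T)%N).
Hypothesis mu_ : forall t i, measurable_fun setT (u t i).
Hypothesis mxi : forall t i, measurable_fun setT (xi t i).
Hypothesis indep : indep_randomness mu Pr T u xi.
Hypotheses (cP : comm_matrix E P) (om01 : 0 < om <= 1).
Hypothesis Ccontr : contractive_compressor mu C om.
Hypothesis mC : measurable_fun setT (fun p : S * Rvec R d => (C p.1 p.2 : Rvec R d)).

Local Notation rho := (1 - singval P 1).
Local Notation beta := (singval (1%:M - P) 0).
Local Notation g := (gossip_gamma om rho beta).
Local Notation adapted := (@adapted R n d dS dO S Omega u xi).
Local Notation EE := (EE Pr).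

Let n_gt0 : (0 < n)%N. Proof. exact: ltnW. Qed.
Let om0 : 0 < om. Proof. by case/andP: om01. Qed.
Let om1 : 0 <= 1 - om. Proof. by case/andP: om01; rewrite subr_ge0. Qed.

Lemma adapted_mono s s' V : (s <= s')%N -> adapted s V -> adapted s' V.
Proof. exact: past_fun_mono. Qed.

Lemma adapted_mrow s V : adapted s V -> mrow V.
Proof. by apply: past_fun_measurable. Qed.

Lemma nnm_enorm (V : Omega -> 'rV[R]_d) : mrow V -> nnm (fun w => enorm (V w) ^+ 2).
Proof.
by move=> mV; split=> [|w]; [apply: measurable_funX; exact: mrow_enorm|exact: sqr_ge0].
Qed.

Lemma nnm_sqs (V : 'I_n -> Omega -> 'rV[R]_d) : (forall i, mrow (V i)) ->
  nnm (fun w => sqs (fun i => V i w)).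
Proof. by move=> mV; apply: nnm_sum => i; exact: nnm_enorm. Qed.

Lemma mrow_avg {dW} {W : measurableType dW} (V : 'I_n -> W -> 'rV[R]_d) :
  (forall i, mrow (V i)) -> mrow (fun w => avg (fun i => V i w)).
Proof. by move=> mV; apply: mrowZ; apply: mrow_sum => i _; exact: mV. Qed.

Lemma compress_sqs s t (V : 'I_n -> Omega -> 'rV[R]_d) : (s < t <= T)%N ->
  (forall i, adapted s (V i)) ->
  (EE (fun w => sqs (fun i => C (xi t i w) (V i w) - V i w))%R <=
   (1 - om)%:E * EE (fun w => sqs (fun i => V i w)))%E.
Proof.
move=> st aV.
have mV i : mrow (V i) by exact: adapted_mrow (aV i).
have mCV i : mrow (fun w => C (xi t i w) (V i w)).
  apply: (@adapted_mrow t); apply: (adapted_compress u xi C mC t t i (V i)).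
    by rewrite leqnn andbT; case/andP: st => h _; exact: leq_ltn_trans (leq0n _) h.
  by apply: adapted_mono (aV i); case/andP: st => /ltnW.
rewrite [X in (_ * X)%E]EE_sum => [|i]; last exact: nnm_enorm.
rewrite EE_sum => [|i]; last by apply: nnm_enorm; exact: mrowB.
rewrite ge0_sume_distrr; last by move=> i _; apply: EE_ge0 => w; exact: sqr_ge0.
apply: lee_sum => i _; rewrite -EE_Z//; last exact: nnm_enorm.
exact: (compress_error mu Pr T u xi n_gt0 T_gt0 mu_ mxi indep C om Ccontr mC s t i (V i) st (aV i)).
Qed.

(** [gossip_lyapunov] holds pathwise with the compressor's error on y - yh; averaging over the fresh
    seed multiplies its weight [rate_c2] by 1 - om, and both rates are then at most 1 - g rho /
    2. *)
Lemma gossip_expect s t (y yh z y' : 'I_n -> Omega -> 'rV[R]_d) : (s < t <= T)%N ->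
  (forall i, adapted s (y i)) -> (forall i, adapted s (yh i)) ->
  (forall i w, z i w = yh i w + C (xi t i w) (y i w - yh i w)) ->
  (forall i w, y' i w = gossip E P om (fun i => y i w) (fun i => z i w) i) ->
  (EE (fun w => sqs (fun i => y' i w - avg (fun i => y' i w)) + sqs (fun i => y' i w - z i w))%R <=
   (1 - g * rho / 2)%:E *
   EE (fun w => sqs (fun i => y i w - avg (fun i => y i w)) + sqs (fun i => y i w - yh i w))%R)%E.
Proof.
move=> st ay ayh zE y'E.
have my i : mrow (y i) by exact: adapted_mrow (ay i).
have myh i : mrow (yh i) by exact: adapted_mrow (ayh i).
have rp := rho_pos E P cP.
have rb := rho_beta_le E P n2 cP.
have c1 := rate_c1_ge0 om rho beta om01 rp rb.
have c2 := rate_c2_ge0 om rho beta om01 rp rb.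
pose V i w := y i w - yh i w.
have aV i : adapted s (V i) by apply: mrowB; [exact: ay|exact: ayh].
have mD i : mrow (fun w => y i w - avg (fun i => y i w)) by apply: mrowB => //; exact: mrow_avg.
have mCV i : mrow (fun w => C (xi t i w) (V i w)).
  apply: (@adapted_mrow t); apply: (adapted_compress u xi C mC t t i (V i)).
    by rewrite leqnn andbT; case/andP: st => h _; exact: leq_ltn_trans (leq0n _) h.
  by apply: adapted_mono (aV i); case/andP: st => /ltnW.
have nD := nnm_sqs _ mD.
have nV : nnm (fun w => sqs (fun i => V i w)) by apply: nnm_sqs => i; exact: adapted_mrow (aV i).
have nC : nnm (fun w => sqs (fun i => C (xi t i w) (V i w) - V i w)).
  by apply: nnm_sqs => i; apply: mrowB => //; exact: adapted_mrow (aV i).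
apply: (@le_trans _ _ (EE (fun w => rate_c1 om rho beta * sqs (fun i => y i w - avg (fun i => y i w))
   + rate_c2 om rho beta * sqs (fun i => C (xi t i w) (V i w) - V i w)))).
  apply: EE_le => w; first by rewrite addr_ge0 ?sqs_ge0.
  have := gossip_lyapunov E P om n2 cP om01 (fun i => y i w) (fun i => z i w).
  have -> : gossip E P om (fun i => y i w) (fun i => z i w) = (fun i => y' i w).
    by apply/funext => i; rewrite y'E.
  rewrite (_ : (fun i => z i w - y i w) = (fun i => C (xi t i w) (V i w) - V i w))//.
  by apply/funext => i; rewrite zE /V; apply/rowP => k; rewrite !mxE; ring.
pose F1 w := sqs (fun i => y i w - avg (fun i => y i w)).
pose F2 w := sqs (fun i => C (xi t i w) (V i w) - V i w).
rewrite (EE_D Pr (fun w => rate_c1 om rho beta * F1 w) (fun w => rate_c2 om rho beta * F2 w)); first last.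
- exact: nnmZ c2 nC.
- exact: nnmZ c1 nD.
rewrite (EE_Z Pr _ F1)// (EE_Z Pr _ F2)//.
rewrite (EE_D Pr F1 (fun w => sqs (fun i => V i w)))//.
have r0 : 0 <= 1 - g * rho / 2 := le_trans c1 (rate_c1_le om rho beta om01 rp rb).
have F10 : (0 <= EE F1)%E by apply: EE_ge0 => w; exact: sqs_ge0.
have F30 : (0 <= EE (fun w => sqs (fun i => V i w))%R)%E by apply: EE_ge0 => w; exact: sqs_ge0.
rewrite [X in (_ <= X)%E](ge0_muleDr (1 - g * rho / 2)%:E F10 F30).
apply: leeD.
  apply: lee_wpmul2r => //.
  by rewrite lee_fin; exact: rate_c1_le.
apply: (@le_trans _ _ ((rate_c2 om rho beta)%:E * ((1 - om)%:E * EE (fun w => sqs (fun i => V i w))))%E).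
  by apply: lee_wpmul2l; [rewrite lee_fin|exact: compress_sqs aV].
rewrite muleA -EFinM; apply: lee_wpmul2r => //.
by rewrite lee_fin mulrC; exact: rate_c2_le.
Qed.

Lemma compress_residual s t (r v : 'I_n -> Omega -> 'rV[R]_d) : (s < t <= T)%N ->
  (forall i, adapted s (r i)) -> (forall i, adapted s (v i)) ->
  (EE (fun w => sqs (fun i => r i w - (v i w + C (xi t i w) (r i w - v i w))))%R <=
   (1 - om)%:E * EE (fun w => sqs (fun i => r i w - v i w))%R)%E.
Proof.
move=> st ar av.
pose V i w := r i w - v i w.
have aV i : adapted s (V i) by apply: mrowB; [exact: ar|exact: av].
apply: le_trans (compress_sqs s t V st aV).
apply: EE_le => w; first exact: sqs_ge0.
rewrite le_eqVlt; apply/orP; left; apply/eqP; apply: eq_bigr => i _.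
by rewrite -enormN; congr (enorm _ ^+ 2); rewrite /V; apply/rowP => k; rewrite !mxE; ring.
Qed.

End CompressedSteps.

Lemma amgm_half {R : realType} (q x : R) : 0 < q -> x <= q / 2 + x ^+ 2 / (2 * q).
Proof.
move=> q0; rewrite -subr_ge0.
have -> : q / 2 + x ^+ 2 / (2 * q) - x = (x - q) ^+ 2 / (2 * q) by field; rewrite gt_eqF.
by apply: divr_ge0; [exact: sqr_ge0|rewrite mulr_ge0// ltW].
Qed.

(** * The algorithm *)

Section Processes.
Context {R : realType} {n d : nat} {dS dO : measure_display}.
Context {S : measurableType dS} {Omega : measurableType dO}.
Variables (mu : probability S R) (Pr : probability Omega R) (T : nat).
Variables (u : nat -> 'I_n -> Omega -> Rvec R d) (xi : nat -> 'I_n -> Omega -> S).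
Variables (E : rel 'I_n) (P : 'M[R]_n) (om : R) (C : S -> 'rV[R]_d -> 'rV[R]_d).
Hypotheses (n2 : (2 <= n)%N) (T_gt0 : (0 < T)%N).
Hypothesis mu_ : forall t i, measurable_fun setT (u t i).
Hypothesis mxi : forall t i, measurable_fun setT (xi t i).
Hypothesis indep : indep_randomness mu Pr T u xi.
Hypotheses (cP : comm_matrix E P) (om01 : 0 < om <= 1).
Hypothesis Ccontr : contractive_compressor mu C om.
Hypothesis mC : measurable_fun setT (fun p : S * Rvec R d => (C p.1 p.2 : Rvec R d)).
Variables (X : set 'rV[R]_d) (f : nat -> 'I_n -> 'rV[R]_d -> R).
Variables (G eta zeta eps : R) (L1 L2 : nat).
Hypothesis mf : forall t i, measurable_fun setT (f t i : Rvec R d -> R).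
Hypotheses (G_gt0 : 0 < G) (eta_ge0 : 0 <= eta) (eps_gt0 : 0 < eps).
Hypothesis flip : forall t i x y, X x -> X y -> `|f t i x - f t i y| <= G * enorm (x - y).
Local Notation K := (shrink zeta X).
Hypotheses (cK : compact K) (convK : cvx_set K) (K0 : K 0).
Hypothesis KX : forall x v, K x -> enorm v <= 1 -> X (x + eps *: v).

Local Notation rho := (1 - singval P 1).
Local Notation beta := (singval (1%:M - P) 0).
Local Notation g := (gossip_gamma om rho beta).
Local Notation adapted := (@adapted R n d dS dO S Omega u xi).
Local Notation EE := (EE Pr).
Local Notation L := (L1 + L2)%N.

Let n_gt0 : (0 < n)%N. Proof. exact: ltnW. Qed.
Let Kne : K !=set0. Proof. by exists 0. Qed.

(* The processes of the algorithm run with the clipped directions [cu]: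
   px = x, pxh = x-hat, pz b = z(b-1), pY b k = y^(k+1)(b), pYh = y-hat^(k+1)(b),
   pres b = r(b+1), pR b k = r^(k+1)(b+1). *)
Definition cu w (t : nat) (j : 'I_n) : 'rV[R]_d := clip (u t j w).
Definition cxi w (t : nat) (j : 'I_n) : S := xi t j w.
Definition RUN b w := run E P C f g eta zeta eps L1 L2 X (cu w) (cxi w) b.
Definition px b i w : 'rV[R]_d := (RUN b w).1.1 i.
Definition pxh b i w : 'rV[R]_d := (RUN b w).1.2 i.
Definition pz b i w : 'rV[R]_d := (RUN b w).2 i.
Definition CONS b k w :=
  consensus E P C g L1 L2 (cxi w) b (fun i => px b i w - eta *: pz b i w) (fun i => pxh b i w) k.
Definition pY b k i w : 'rV[R]_d := (CONS b k w).1 i.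
Definition pYh b k i w : 'rV[R]_d := (CONS b k w).2 i.
Definition pres b i w : 'rV[R]_d := eproj K (pY b L1 i w) - pY b L1 i w.
Definition pR b k i w : 'rV[R]_d := rphase C L1 L2 (cxi w) b (fun i => pres b i w) k i.

Lemma RUN_S b w : (2 <= b)%N -> RUN b.+1 w =
  ((fun i => eproj K (pY b L1 i w)), (fun i => pYh b L1 i w + pR b L2 i w),
   zsum f eps L1 L2 (cu w) b (fun i => px b i w)).
Proof.
case: b => [//|[//|b]] _.
have -> : RUN b.+3 w =
    (let '(x, xh, zp) := RUN b.+2 w in
     let '(x', xh') := block_update E P C g eta zeta L1 L2 X (cxi w) b.+2 x xh zp in
     (x', xh', zsum f eps L1 L2 (cu w) b.+2 x)) by [].
rewrite /pYh /pR /pres /pY /CONS /px /pxh /pz.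
case: (RUN b.+2 w) => [[x xh] z] /=.
rewrite /block_update /=.
by case: (consensus _ _ _ _ _ _ _ _ _ _ _).
Qed.

Lemma px_S b i w : (2 <= b)%N -> px b.+1 i w = eproj K (pY b L1 i w).
Proof. by move=> b2; rewrite /px RUN_S. Qed.

Lemma pxh_S b i w : (2 <= b)%N -> pxh b.+1 i w = pYh b L1 i w + pR b L2 i w.
Proof. by move=> b2; rewrite /pxh RUN_S. Qed.

Lemma pz_S b i w : (1 <= b)%N -> pz b.+1 i w =
  \sum_((b.-1 * L).+1 <= t < (b * L).+1) gest (f t i) eps (px b i w) (cu w t i).
Proof.
case: b => [//|[|b]] _; first by [].
by rewrite /pz RUN_S.
Qed.

(** Blocks 1 and 2 both play around 0: the first gradient sum is complete only after block 1, and is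
    applied during block 2. *)
Lemma px_le2 b i w : (b <= 2)%N -> px b i w = 0.
Proof. by case: b => [|[|[|]]]. Qed.

Lemma pxh_le2 b i w : (b <= 2)%N -> pxh b i w = 0.
Proof. by case: b => [|[|[|]]]. Qed.

Lemma pz_le1 b i w : (b <= 1)%N -> pz b i w = 0.
Proof. by case: b => [|[|]]. Qed.

Lemma pY0 b i w : pY b 0 i w = px b i w - eta *: pz b i w. Proof. by []. Qed.
Lemma pYh0 b i w : pYh b 0 i w = pxh b i w. Proof. by []. Qed.

Lemma pYh_S b k i w : pYh b k.+1 i w =
  pYh b k i w + C (xi (b.-1 * L + k.+1)%N i w) (pY b k i w - pYh b k i w).
Proof. by rewrite /pYh /pY /CONS /=; case: (consensus _ _ _ _ _ _ _ _ _ _ _). Qed.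

Lemma pY_S b k i w : pY b k.+1 i w =
  gossip E P om (fun j => pY b k j w) (fun j => pYh b k.+1 j w) i.
Proof. by rewrite /pYh /pY /CONS /=; case: (consensus _ _ _ _ _ _ _ _ _ _ _). Qed.

Lemma pR0 b i w : pR b 0 i w = 0. Proof. by []. Qed.

Lemma pR_S b k i w : pR b k.+1 i w =
  pR b k i w + C (xi (b.-1 * L + L1 + k.+1)%N i w) (pres b i w - pR b k i w).
Proof. by []. Qed.

Lemma px_in b i w : K (px b i w).
Proof.
have [b2|b2] := leqP b 2; first by rewrite px_le2.
by case: b b2 => // b b2; rewrite px_S//; exact: eproj_in.
Qed.

(** The two points differ by 2 eps v, so the Lipschitz bound cancels the factor 1 / (2 eps) and the
    estimator stays bounded as eps tends to 0. *)
Lemma gest_norm t i x v : K x -> enorm v <= 1 -> enorm (gest (f t i) eps x v) <= d%:R * G.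
Proof.
move=> Kx v1; rewrite /gest enormZ.
have Xn : X (x - eps *: v) by rewrite -scalerN; apply: KX; rewrite ?enormN.
have := flip t i _ _ (KX _ _ Kx v1) Xn.
have -> : x + eps *: v - (x - eps *: v) = (2 * eps) *: v.
  by apply/rowP => j; rewrite !mxE; ring.
have e2 : 0 < 2 * eps by rewrite mulr_gt0.
rewrite enormZ (gtr0_norm e2) => h.
have c0 : 0 <= d%:R / (2 * eps) by apply: divr_ge0 => //; exact: ltW.
rewrite normrM (ger0_norm c0).
set D := `|_ - _| in h *.
have h1 : D <= G * (2 * eps).
  apply: le_trans h _; rewrite ler_pM2l// ler_piMr// ltW//.
apply: (@le_trans _ _ (d%:R / (2 * eps) * (G * (2 * eps)) * 1)).
  apply: ler_pM; [|exact: enorm_ge0|exact: ler_wpM2l|exact: v1].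
  by apply: mulr_ge0; rewrite // /D.
by rewrite mulr1 le_eqVlt; apply/orP; left; apply/eqP; field; rewrite gt_eqF.
Qed.

Definition q : R := eta * (L%:R * d%:R * G).

Lemma q_ge0 : 0 <= q.
Proof. by rewrite mulr_ge0// !mulr_ge0// ltW. Qed.

Lemma pz_norm b i w : enorm (eta *: pz b i w) <= q.
Proof.
rewrite enormZ ger0_norm// ler_wpM2l//.
case: b => [|[|b]]; try by rewrite pz_le1// enorm0 !mulr_ge0// ltW.
rewrite pz_S//=.
have sumle (s : seq nat) (F : nat -> 'rV[R]_d) (c : R) : (forall t, enorm (F t) <= c) ->
    enorm (\sum_(t <- s) F t) <= (size s)%:R * c.
  move=> Fc; elim: s => [|t s IH]; first by rewrite big_nil enorm0 mul0r.
  rewrite big_cons; apply: le_trans (enormD _ _) _.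
  by rewrite /= -natr1 mulrDl mul1r addrC lerD.
apply: le_trans (sumle _ _ (d%:R * G) _) _.
  by move=> t; apply: gest_norm; [exact: px_in|exact: clip_le1].
by rewrite size_iota subSS -mulnBl subSnn mul1n mulrA.
Qed.

(** Consensus plus compression error at the start of block b; [PHI b k] is the same quantity after k
    gossip rounds. *)
Definition SS b w : R :=
  sqs (fun i => px b i w - avg (fun i => px b i w)) + sqs (fun i => px b i w - pxh b i w).
Definition PHI b k w : R :=
  sqs (fun i => pY b k i w - avg (fun i => pY b k i w)) + sqs (fun i => pY b k i w - pYh b k i w).

Lemma PHI_ge0 b k w : 0 <= PHI b k w.
Proof. by rewrite addr_ge0 ?sqs_ge0. Qed.

Lemma SS_ge0 b w : 0 <= SS b w.
Proof. by rewrite addr_ge0 ?sqs_ge0. Qed.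

Lemma pY_avg b k w : avg (fun i => pY b k i w) =
  avg (fun i => px b i w) - avg (fun i => eta *: pz b i w).
Proof.
elim: k => [|k IH]; first by rewrite -avgB.
rewrite -IH -[RHS](gossip_avg E P om cP _ (fun j => pYh b k.+1 j w)).
by congr avg; apply/funext => i; rewrite pY_S.
Qed.

Lemma eta_z_avg b w : enorm (avg (fun i => eta *: pz b i w)) <= q.
Proof.
have cB : cvx_set [set x : 'rV[R]_d | enorm x <= q].
  move=> x y t /= hx hy /andP[t0 t1]; apply: le_trans (enormD _ _) _.
  rewrite !enormZ !ger0_norm ?subr_ge0//.
  have -> : q = t * q + (1 - t) * q by ring.
  by apply: lerD; apply: ler_wpM2l => //; rewrite subr_ge0.
by apply: (avg_in n_gt0 _ _ cB) => i /=; exact: pz_norm.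
Qed.

Lemma sqsB_le (y z : 'I_n -> 'rV[R]_d) :
  sqs (fun i => y i - z i) <= 2 * sqs y + 2 * sqs z.
Proof.
rewrite /sqs !mulr_sumr -big_split /=; apply: ler_sum => i _.
by rewrite -[enorm (z i)]enormN enormD_sqr.
Qed.

Lemma sqs_eta_z b w : sqs (fun i => eta *: pz b i w) <= n%:R * q ^+ 2.
Proof.
rewrite /sqs; apply: (@le_trans _ _ (\sum_(i < n) q ^+ 2)).
  by apply: ler_sum => i _; rewrite ler_sqr ?nnegrE ?enorm_ge0 ?q_ge0// pz_norm.
by rewrite sumr_const card_ord mulr_natl.
Qed.

Lemma PHI0_le b w : PHI b 0 w <= 2 * SS b w + 4 * n%:R * q ^+ 2.
Proof.
rewrite /PHI /SS.
have h1 : sqs (fun i => pY b 0 i w - avg (fun i => pY b 0 i w)) <=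
    2 * sqs (fun i => px b i w - avg (fun i => px b i w)) + 2 * (n%:R * q ^+ 2).
  apply: le_trans (sqs_avg_le n_gt0 _ (avg (fun i => px b i w))) _.
  rewrite (_ : (fun i => _) = (fun i => (px b i w - avg (fun i => px b i w)) - eta *: pz b i w)).
    apply: le_trans (sqsB_le _ _) _; rewrite lerD2l ler_wpM2l//; exact: sqs_eta_z.
  by apply/funext => i; rewrite pY0 addrAC.
have h2 : sqs (fun i => pY b 0 i w - pYh b 0 i w) <=
    2 * sqs (fun i => px b i w - pxh b i w) + 2 * (n%:R * q ^+ 2).
  rewrite (_ : (fun i => _) = (fun i => (px b i w - pxh b i w) - eta *: pz b i w)).
    apply: le_trans (sqsB_le _ _) _; rewrite lerD2l ler_wpM2l//; exact: sqs_eta_z.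
  by apply/funext => i; rewrite pY0 pYh0 addrAC.
lra.
Qed.

Lemma sqs_dist_prev b k w :
  sqs (fun i => pY b k i w - avg (fun i => px b i w)) <=
  sqs (fun i => pY b k i w - avg (fun i => pY b k i w)) + n%:R * q ^+ 2.
Proof.
rewrite (sqs_split n_gt0 _ (avg (fun i => px b i w))) lerD2l ler_wpM2l//.
rewrite ler_sqr ?nnegrE ?enorm_ge0 ?q_ge0// pY_avg addrAC subrr add0r enormN.
exact: eta_z_avg.
Qed.

Lemma avg_px_in b w : K (avg (fun i => px b i w)).
Proof. by apply: (avg_in n_gt0) => // i; exact: px_in. Qed.

(** The average of the x_i(b) lies in [K] by convexity, so the projection of y_i is at least as
    close to y_i as that average is; the average of y has moved away from it by at most [q]. *)
Lemma pres_sqs b w : sqs (fun i => pres b i w) <=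
  sqs (fun i => pY b L1 i w - avg (fun i => pY b L1 i w)) + n%:R * q ^+ 2.
Proof.
apply: le_trans (sqs_dist_prev b L1 w); apply: ler_sum => i _.
rewrite ler_sqr ?nnegrE ?enorm_ge0// /pres enorm_distC.
by apply: eproj_min => //; exact: avg_px_in.
Qed.

(** The average minimises the sum of squared distances, so it may be replaced by the projection of
    the average of y; projecting does not increase distances. *)
Lemma px_next_dev b w : (2 <= b)%N ->
  sqs (fun i => px b.+1 i w - avg (fun i => px b.+1 i w)) <=
  sqs (fun i => pY b L1 i w - avg (fun i => pY b L1 i w)).
Proof.
move=> b2; apply: le_trans (sqs_avg_le n_gt0 _ (eproj K (avg (fun i => pY b L1 i w)))) _.
apply: ler_sum => i _; rewrite ler_sqr ?nnegrE ?enorm_ge0// px_S//.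
exact: eproj_nonexpansive.
Qed.

(** As x(b+1) is y plus the residual and its copy is the copy of y plus the compressed residual, the
    new compression error is the sum of those of y and of the residual. *)
Lemma SS_next b w : (2 <= b)%N ->
  SS b.+1 w <= sqs (fun i => pY b L1 i w - avg (fun i => pY b L1 i w))
   + 2 * sqs (fun i => pY b L1 i w - pYh b L1 i w)
   + 2 * sqs (fun i => pres b i w - pR b L2 i w).
Proof.
move=> b2; rewrite /SS -addrA; apply: lerD; first exact: px_next_dev.
rewrite (_ : (fun i => _) = (fun i => (pY b L1 i w - pYh b L1 i w) - (- (pres b i w - pR b L2 i w)))).
  apply: le_trans (sqsB_le _ _) _; rewrite lerD2l ler_wpM2l//.
  by apply: ler_sum => i _; rewrite enormN.
by apply/funext => i; rewrite px_S// pxh_S// /pres opprK; apply/rowP => k; rewrite !mxE; ring.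
Qed.

Lemma adapted_gest s t i (V : Omega -> 'rV[R]_d) : (1 <= t <= s)%N -> adapted s V ->
  adapted s (fun w => gest (f t i) eps (V w) (cu w t i)).
Proof.
move=> ts aV.
have acu : adapted s (fun w => cu w t i).
  exact: (measurableT_comp (@measurable_clip R d) (u_past u xi s t i ts)).
rewrite /gest; apply: mrow_scale => //.
apply: measurable_funM; first exact: measurable_cst.
have mcomp V' : adapted s V' -> measurable_fun setT (fun w : g_sigma_algebraType (past u xi s) => f t i (V' w)).
  exact: mrow_comp (mf t i).
apply: measurable_funB.
  by apply: (mcomp (fun w => V w + eps *: cu w t i)); apply: mrowD => //; exact: mrowZ.
by apply: (mcomp (fun w => V w - eps *: cu w t i)); apply: mrowB => //; exact: mrowZ.
Qed.

(** Round (b - 1) L is the last one before block b. The gradient sum z(b-1) used in block b is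
    complete by then, while every seed and direction of block b is still fresh. *)
Definition block_adapted b := forall i, [/\ adapted (b.-1 * L) (px b i),
  adapted (b.-1 * L) (pxh b i) & adapted (b.-1 * L) (pz b i)].

Lemma adapted_Y b k i : block_adapted b ->
  adapted (b.-1 * L + k) (pY b k i) /\ adapted (b.-1 * L + k) (pYh b k i).
Proof.
move=> ab; elim: k i => [|k IH] i.
  rewrite addn0; have [ax axh az] := ab i; split; last exact: axh.
  by apply: mrowB => //; exact: mrowZ.
have up V : adapted (b.-1 * L + k) V -> adapted (b.-1 * L + k.+1) V.
  by apply: past_fun_mono; rewrite addnS.
have aYh j : adapted (b.-1 * L + k.+1) (pYh b k.+1 j).
  rewrite (_ : pYh b k.+1 j = fun w => pYh b k j w + C (xi (b.-1 * L + k.+1)%N j w) (pY b k j w - pYh b k j w)).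
    have [aY aYh] := IH j; apply: mrowD; first exact: up.
    apply: (adapted_compress u xi C mC _ _ j (fun w => pY b k j w - pYh b k j w)).
      by rewrite leqnn andbT addnS.
    by apply: mrowB; exact: up.
  by apply/funext => w; exact: pYh_S.
split; last exact: aYh.
rewrite (_ : pY b k.+1 i = fun w => pY b k i w + g *: \sum_(j < n | E i j || (j == i))
    P i j *: (pYh b k.+1 j w - pYh b k.+1 i w)).
  apply: mrowD; first by apply: up; case: (IH i).
  apply: mrowZ; apply: mrow_sum => j _; apply: mrowZ.
  by apply: mrowB; exact: aYh.
by apply/funext => w; rewrite pY_S.
Qed.

Lemma eproj_adapted s V : adapted s V -> adapted s (fun w => eproj K (V w)).
Proof. by apply: mrow_continuous; exact: continuous_eproj. Qed.

Lemma adapted_res b i : block_adapted b -> adapted (b.-1 * L + L1) (pres b i).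
Proof.
move=> ab; have [aY _] := adapted_Y b L1 i ab.
by apply: mrowB => //; exact: eproj_adapted.
Qed.

Lemma adapted_R b k i : block_adapted b -> adapted (b.-1 * L + L1 + k) (pR b k i).
Proof.
move=> ab; elim: k => [|k IH]; first exact: mrow_cst.
have up V : adapted (b.-1 * L + L1 + k) V -> adapted (b.-1 * L + L1 + k.+1) V.
  by apply: past_fun_mono; rewrite [leqRHS]addnS.
have ar : adapted (b.-1 * L + L1 + k) (pres b i).
  by apply: past_fun_mono (adapted_res b i ab); exact: leq_addr.
rewrite (_ : pR b k.+1 i = fun w => pR b k i w + C (xi (b.-1 * L + L1 + k.+1)%N i w) (pres b i w - pR b k i w)).
  apply: mrowD; first exact: up.
  apply: (adapted_compress u xi C mC _ _ i (fun w => pres b i w - pR b k i w)).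
    by rewrite leqnn andbT addnS.
  by apply: mrowB; exact: up.
by apply/funext => w; exact: pR_S.
Qed.

Lemma adapted_z b i : (1 <= b)%N -> (forall i, adapted (b.-1 * L) (px b i)) -> adapted (b * L) (pz b.+1 i).
Proof.
move=> b1 ax.
rewrite (_ : pz b.+1 i = fun w => \sum_((b.-1 * L).+1 <= t < (b * L).+1) gest (f t i) eps (px b i w) (cu w t i)).
  (* The redundant filter makes the range of [t] available to [mrow_sum]. *)
  rewrite (_ : (fun w => _) = (fun w => \sum_(t <- index_iota (b.-1 * L).+1 (b * L).+1 | (1 <= t <= b * L)%N)
     gest (f t i) eps (px b i w) (cu w t i))); last first.
    apply/funext => w; rewrite [RHS]big_seq_cond [LHS]big_seq_cond; apply: eq_bigl => t.
    rewrite mem_index_iota andbT ltnS; case: (boolP (_ <= _)%N) => // h1 /=.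
    by rewrite (leq_trans _ h1)//; case: (_ <= _)%N.
  apply: mrow_sum => t ht; apply: adapted_gest => //.
  by apply: past_fun_mono (ax i); rewrite leq_mul2r leq_pred orbT.
by apply/funext => w; exact: pz_S.
Qed.

Lemma block_adaptedP b : (1 <= b)%N -> block_adapted b.
Proof.
elim: b => // -[_ _ i|b IH _ i].
  have E0 (V : 'I_n -> Omega -> 'rV[R]_d) : (forall w, V i w = 0) -> adapted 0 (V i).
    by move=> V0; rewrite (_ : V i = fun=> 0); [exact: mrow_cst|apply/funext].
  by rewrite mul0n; split; apply: E0.
have ab := IH isT.
have ax i' : adapted (b * L) (px b.+1 i') by case: (ab i').
rewrite [b.+2.-1]/=.
have az := adapted_z b.+1 i isT ax.
case: b IH ab ax az => [|b] _ ab ax az.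
  split=> //.
    by rewrite (_ : px 2 i = fun=> 0); [exact: mrow_cst|apply/funext].
  by rewrite (_ : pxh 2 i = fun=> 0); [exact: mrow_cst|apply/funext].
have le1 : (b.+2.-1 * L + L1 <= b.+2 * L)%N by rewrite [leqRHS]mulSn addnC leq_add2r leq_addr.
split=> //.
  rewrite (_ : px b.+3 i = fun w => eproj K (pY b.+2 L1 i w)); last by apply/funext => w; rewrite px_S.
  apply: eproj_adapted; apply: past_fun_mono le1 _.
  by case: (adapted_Y b.+2 L1 i ab).
rewrite (_ : pxh b.+3 i = fun w => pYh b.+2 L1 i w + pR b.+2 L2 i w); last by apply/funext => w; rewrite pxh_S.
apply: mrowD.
  by apply: past_fun_mono le1 _; case: (adapted_Y b.+2 L1 i ab).
apply: past_fun_mono (adapted_R b.+2 L2 i ab).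
by rewrite [leqRHS]mulSn -addnA addnC.
Qed.

Lemma mrow_px b i : (1 <= b)%N -> mrow (px b i).
Proof.
by move=> b1; have [ax _ _] := block_adaptedP b b1 i; exact: (adapted_mrow u xi mu_ mxi _ _ ax).
Qed.

Lemma mrow_pxh b i : (1 <= b)%N -> mrow (pxh b i).
Proof.
by move=> b1; have [_ ax _] := block_adaptedP b b1 i; exact: (adapted_mrow u xi mu_ mxi _ _ ax).
Qed.

Lemma mrow_pY b k i : (1 <= b)%N -> mrow (pY b k i).
Proof.
by move=> b1; have [ax _] := adapted_Y b k i (block_adaptedP b b1); exact: (adapted_mrow u xi mu_ mxi _ _ ax).
Qed.

Lemma mrow_pYh b k i : (1 <= b)%N -> mrow (pYh b k i).
Proof.
by move=> b1; have [_ ax] := adapted_Y b k i (block_adaptedP b b1); exact: (adapted_mrow u xi mu_ mxi _ _ ax).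
Qed.

Lemma mrow_pres b i : (1 <= b)%N -> mrow (pres b i).
Proof.
by move=> b1; exact: (adapted_mrow u xi mu_ mxi _ _ (adapted_res b i (block_adaptedP b b1))).
Qed.

Lemma mrow_pR b k i : (1 <= b)%N -> mrow (pR b k i).
Proof.
by move=> b1; exact: (adapted_mrow u xi mu_ mxi _ _ (adapted_R b k i (block_adaptedP b b1))).
Qed.

Lemma nnm_dev (V : 'I_n -> Omega -> 'rV[R]_d) : (forall i, mrow (V i)) ->
  nnm (fun w => sqs (fun i => V i w - avg (fun i => V i w))).
Proof. by move=> mV; apply: nnm_sqs => i; apply: mrowB => //; exact: mrow_avg. Qed.

Lemma nnm_diff (V V' : 'I_n -> Omega -> 'rV[R]_d) : (forall i, mrow (V i)) -> (forall i, mrow (V' i)) ->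
  nnm (fun w => sqs (fun i => V i w - V' i w)).
Proof. by move=> mV mV'; apply: nnm_sqs => i; exact: mrowB. Qed.

Lemma nnm_SS b : (1 <= b)%N -> nnm (SS b).
Proof.
move=> b1; apply: nnmD; first by apply: nnm_dev => i; exact: mrow_px.
by apply: nnm_diff => i; [exact: mrow_px|exact: mrow_pxh].
Qed.

Lemma nnm_PHI b k : (1 <= b)%N -> nnm (PHI b k).
Proof.
move=> b1; apply: nnmD; first by apply: nnm_dev => i; exact: mrow_pY.
by apply: nnm_diff => i; [exact: mrow_pY|exact: mrow_pYh].
Qed.

(** * Expected consensus and compression errors, block by block *)

Hypotheses (rate1 : (1 - g * rho / 2) ^+ L1 <= (14 * n%:R)^-1)
  (rate2 : (1 - om) ^+ L2 <= (8 * n%:R)^-1).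

Let rp : 0 < rho. Proof. exact: (rho_pos E P cP). Qed.
Let rb : rho <= beta. Proof. exact: (rho_beta_le E P n2 cP). Qed.
Let contr_ge0 : 0 <= 1 - g * rho / 2.
Proof. exact: le_trans (rate_c1_ge0 om rho beta om01 rp rb) (rate_c1_le om rho beta om01 rp rb). Qed.
Let om1 : 0 <= 1 - om. Proof. by case/andP: om01; rewrite subr_ge0. Qed.
Let nR : 0 < n%:R :> R. Proof. by rewrite ltr0n. Qed.

Lemma EE_PHI_iter b k : (1 <= b)%N -> (b.-1 * L + k <= T)%N ->
  (EE (PHI b k) <= ((1 - g * rho / 2) ^+ k)%:E * EE (PHI b 0))%E.
Proof.
move=> b1; elim: k => [|k IH] kT; first by rewrite expr0 mul1e.
have kT' : (b.-1 * L + k < b.-1 * L + k.+1 <= T)%N by rewrite kT addnS leqnn.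
have step := gossip_expect mu Pr T u xi E P om C n2 T_gt0 mu_ mxi indep cP om01 Ccontr mC
  (b.-1 * L + k) (b.-1 * L + k.+1) (pY b k) (pYh b k) (pYh b k.+1) (pY b k.+1) kT'
  (fun i => proj1 (adapted_Y b k i (block_adaptedP b b1)))
  (fun i => proj2 (adapted_Y b k i (block_adaptedP b b1)))
  (fun i w => pYh_S b k i w) (fun i w => pY_S b k i w).
apply: le_trans step _; rewrite exprS EFinM -muleA.
apply: lee_wpmul2l; first by rewrite lee_fin.
by apply: IH; apply: leq_trans kT; rewrite addnS.
Qed.

Lemma EE_residual_iter b k : (1 <= b)%N -> (b.-1 * L + L1 + k <= T)%N ->
  (EE (fun w => sqs (fun i => pres b i w - pR b k i w))%R <=
   ((1 - om) ^+ k)%:E * EE (fun w => sqs (fun i => pres b i w))%R)%E.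
Proof.
move=> b1; elim: k => [|k IH] kT.
  rewrite expr0 mul1e; apply: EE_le => w; first exact: sqs_ge0.
  rewrite le_eqVlt; apply/orP; left; apply/eqP; apply: eq_bigr => i _.
  by rewrite pR0 subr0.
have kT' : (b.-1 * L + L1 + k < b.-1 * L + L1 + k.+1 <= T)%N by rewrite kT addnS leqnn.
have ares i : adapted (b.-1 * L + L1 + k) (pres b i).
  by apply: past_fun_mono (adapted_res b i (block_adaptedP b b1)); exact: leq_addr.
have step := compress_residual mu Pr T u xi om C n2 T_gt0 mu_ mxi indep om01 Ccontr mC
  (b.-1 * L + L1 + k) (b.-1 * L + L1 + k.+1) (pres b) (pR b k) kT' ares
  (fun i => adapted_R b k i (block_adaptedP b b1)).
apply: le_trans step _; rewrite exprS EFinM -muleA.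
apply: lee_wpmul2l; first by rewrite lee_fin.
by apply: IH; apply: leq_trans kT; rewrite [leqRHS]addnS.
Qed.

(** After the gradient step the error is at most 2 q^2 + 4 n q^2 <= 5 n q^2, as n >= 2; the gossip
    rounds divide it by 14 n. *)
Lemma EE_PHI_block b : (2 <= b)%N -> (b * L <= T)%N -> (EE (SS b) <= (q ^+ 2)%:E)%E ->
  (EE (PHI b L1) <= (5 / 14 * q ^+ 2)%:E)%E.
Proof.
move=> b2 bT hS.
have b1 : (1 <= b)%N by apply: ltnW.
have bb : (b.-1 * L + L1 <= T)%N.
  by apply: leq_trans bT; case: b b1 {b2 hS} => // b _; rewrite mulSn addnC leq_add2r leq_addr.
have q0 := sqr_ge0 q.
have h0 : (EE (PHI b 0) <= (2 * q ^+ 2 + 4 * n%:R * q ^+ 2)%:E)%E.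
  apply: (@le_trans _ _ (EE (fun w => 2 * SS b w + 4 * n%:R * q ^+ 2))).
    by apply: EE_le => w; [exact: PHI_ge0|exact: PHI0_le].
  rewrite (EE_D Pr (fun w => 2 * SS b w) (fun=> 4 * n%:R * q ^+ 2)); first last.
  - by apply: nnm_cst; rewrite mulr_ge0// mulr_ge0.
  - by apply: nnmZ => //; exact: nnm_SS.
  rewrite (EE_Z Pr 2 (SS b))//; last exact: nnm_SS.
  rewrite EE_cst [X in (_ <= X)%E]EFinD; apply: leeD => //.
  by rewrite EFinM; apply: lee_wpmul2l => //; rewrite lee_fin.
apply: le_trans (EE_PHI_iter b L1 b1 bb) _.
apply: (@le_trans _ _ ((14 * n%:R)^-1%:E * (2 * q ^+ 2 + 4 * n%:R * q ^+ 2)%:E)%E).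
  apply: lee_pmul; [by rewrite lee_fin exprn_ge0| |by rewrite lee_fin|exact: h0].
  by apply: EE_ge0 => w; exact: PHI_ge0.
rewrite -EFinM lee_fin -ler_pdivlMl ?invr_gt0 ?mulr_gt0// invrK.
have n2R : 2 <= n%:R :> R by rewrite ler_nat.
have : 2 * q ^+ 2 <= n%:R * q ^+ 2 by rewrite ler_wpM2r.
lra.
Qed.

(** The residual, reduced by 8 n, contributes at most c + q^2 / 4 with c the consensus error, which
    gives 2 PHI + q^2 / 4. The invariant closes because 2 * 5/14 + 1/4 = 27/28 <= 1. *)
Lemma EE_SS_next b : (2 <= b)%N -> (b * L <= T)%N -> (EE (PHI b L1) <= (5 / 14 * q ^+ 2)%:E)%E ->
  (EE (SS b.+1) <= (q ^+ 2)%:E)%E.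
Proof.
move=> b2 bT hP.
have b1 : (1 <= b)%N by apply: ltnW.
have bb : (b.-1 * L + L1 + L2 <= T)%N.
  by apply: leq_trans bT; case: b b1 {b2 hP} => // b _; rewrite /= -addnA mulSn addnC.
have q0 := sqr_ge0 q.
have n2R : 2 <= n%:R :> R by rewrite ler_nat.
pose rr w := sqs (fun i => pres b i w - pR b L2 i w).
have nrr : nnm rr by apply: nnm_diff => i; [exact: mrow_pres|exact: mrow_pR].
have nr : nnm (fun w => sqs (fun i => pres b i w)) by apply: nnm_sqs => i; exact: mrow_pres.
pose k8 : R := (8 * n%:R)^-1.
have k80 : 0 <= k8 by rewrite invr_ge0 mulr_ge0.
have hrr : (EE rr <= k8%:E * EE (fun w => sqs (fun i => pres b i w))%R)%E.
  apply: le_trans (EE_residual_iter b L2 b1 bb) _.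
  apply: lee_wpmul2r; last by rewrite lee_fin.
  by apply: EE_ge0 => w; exact: sqs_ge0.
pose CE w := sqs (fun i => pY b L1 i w - avg (fun i => pY b L1 i w))
   + 2 * sqs (fun i => pY b L1 i w - pYh b L1 i w).
have nCE : nnm CE.
  apply: nnmD; first by apply: nnm_dev => i; exact: mrow_pY.
  by apply: nnmZ => //; apply: nnm_diff => i; [exact: mrow_pY|exact: mrow_pYh].
apply: (@le_trans _ _ (EE (fun w => CE w + 2 * rr w))).
  by apply: EE_le => w; [exact: SS_ge0|exact: SS_next].
rewrite (EE_D Pr CE (fun w => 2 * rr w))//; last exact: nnmZ.
rewrite (EE_Z Pr 2 rr)//.
apply: (@le_trans _ _ (EE CE + 2%:E * (k8%:E * EE (fun w => sqs (fun i => pres b i w))%R))%E).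
  by apply: leeD => //; apply: lee_wpmul2l => //; rewrite lee_fin.
rewrite muleA -EFinM -EE_Z//; last by rewrite mulr_ge0.
rewrite -EE_D//; last by apply: nnmZ => //; rewrite mulr_ge0.
apply: (@le_trans _ _ (EE (fun w => 2 * PHI b L1 w + q ^+ 2 / 4))).
  apply: EE_le => w; first by rewrite addr_ge0 ?mulr_ge0 ?sqs_ge0// addr_ge0 ?mulr_ge0 ?sqs_ge0.
  have := pres_sqs b w; rewrite /CE /PHI.
  set p := sqs (fun i => pres b i w); set c := sqs (fun i => pY b L1 i w - avg _); set e := sqs _ => pc.
  have c0 : 0 <= c by exact: sqs_ge0.
  have h1 : k8 * p <= k8 * c + q ^+ 2 / 8.
    apply: le_trans (ler_wpM2l k80 pc) _; rewrite mulrDr lerD2l.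
    by rewrite le_eqVlt /k8; apply/orP; left; apply/eqP; field; rewrite gt_eqF.
  have : k8 * c <= 1 / 2 * c.
    by rewrite ler_wpM2r// /k8 div1r lef_pV2 ?posrE ?mulr_gt0//; lra.
  lra.
rewrite (EE_D Pr (fun w => 2 * PHI b L1 w) (fun=> q ^+ 2 / 4)); first last.
- by apply: nnm_cst; apply: divr_ge0.
- by apply: nnmZ => //; exact: nnm_PHI.
rewrite (EE_Z Pr 2 (PHI b L1))//; last exact: nnm_PHI.
rewrite EE_cst; apply: (@le_trans _ _ (2%:E * (5 / 14 * q ^+ 2)%:E + (q ^+ 2 / 4)%:E)%E).
  by apply: leeD => //; apply: lee_wpmul2l => //; rewrite lee_fin.
by rewrite -EFinM -EFinD lee_fin; lra.
Qed.

Lemma EE_SS_le b : (1 <= b)%N -> (b.-1 * L <= T)%N -> (EE (SS b) <= (q ^+ 2)%:E)%E.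
Proof.
have q0 := sqr_ge0 q.
(* In the first two blocks iterates and copies are all 0, so there is no error. *)
have small b' : (b' <= 2)%N -> (EE (SS b') <= (q ^+ 2)%:E)%E.
  move=> b2; rewrite -(EE_cst Pr); apply: EE_le => w; first exact: SS_ge0.
  have avg0 : avg (fun i => px b' i w) = 0.
    by rewrite /avg big1 ?scaler0// => i _; exact: px_le2.
  have h1 : sqs (fun i => px b' i w - avg (fun i => px b' i w)) = 0.
    by rewrite /sqs big1// => i _; rewrite avg0 px_le2// subr0 enorm0 expr0n.
  have h2 : sqs (fun i => px b' i w - pxh b' i w) = 0.
    by rewrite /sqs big1// => i _; rewrite px_le2// pxh_le2// subr0 enorm0 expr0n.
  by rewrite /SS h1 h2 addr0.
elim: b => // b IH _ bT.
have [b2|b2] := leqP b.+1 2; first exact: small.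
have bL : (b.-1 * L <= T)%N by apply: leq_trans bT; rewrite leq_mul2r leq_pred orbT.
have b1 : (1 <= b)%N by rewrite ltnW.
apply: EE_SS_next => //; apply: EE_PHI_block => //; exact: IH.
Qed.

Lemma EE_PHI_le b : (2 <= b)%N -> (b * L <= T)%N -> (EE (PHI b L1) <= (5 / 14 * q ^+ 2)%:E)%E.
Proof.
move=> b2 bT; apply: EE_PHI_block => //; apply: EE_SS_le; first exact: ltnW.
by apply: leq_trans bT; rewrite leq_mul2r leq_pred orbT.
Qed.

(** * Descent inequality and regret *)

Variables (Rad : R) (Mf : nat -> 'I_n -> R) (xs : 'rV[R]_d).
Hypotheses (d_gt0 : (0 < d)%N) (XRad : forall x, X x -> enorm x <= Rad) (Kxs : K xs).
Hypothesis fM : forall t i x, `|f t i x| <= Mf t i.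
Hypothesis fcvx : forall t i a b (s : R), X a -> X b -> 0 <= s <= 1 ->
  f t i (s *: a + (1 - s) *: b) <= s * f t i a + (1 - s) * f t i b.

Lemma K_sub_X x : K x -> X x.
Proof. by move=> Kx; have := KX x 0 Kx; rewrite scaler0 addr0; apply; rewrite enorm0. Qed.

Lemma K_Rad x : K x -> enorm x <= Rad.
Proof. by move=> /K_sub_X; exact: XRad. Qed.

Lemma K_dist x y : K x -> K y -> enorm (x - y) <= 2 * Rad.
Proof.
move=> Kx Ky; apply: le_trans (enormB _ _) _.
by have := K_Rad x Kx; have := K_Rad y Ky; lra.
Qed.

Definition PA b w : R := sqs (fun i => px b i w - xs).
(** Block 1 performs no gossip, hence the value 0 there. *)
Definition PD b w : R := if (b <= 1)%N then 0 else PHI b L1 w.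
Definition PW b w : R := PD b.+1 w + SS b w + PD b w.

(** This is the price of the one-block delay: gradients are taken at x_i(b) but act on the average
    of x(b+1). The averages are compared through y(b), using that the average of x(b) is in [K] and
    is fixed by the projection. *)
Lemma sqs_drift b w : (1 <= b)%N ->
  sqs (fun i => px b i w - avg (fun i => px b.+1 i w)) <= SS b w + PD b w + n%:R * q ^+ 2.
Proof.
move=> b1; have nq : 0 <= n%:R * q ^+ 2 by rewrite mulr_ge0 ?sqr_ge0.
rewrite (sqs_split n_gt0) -[leRHS]addrA; apply: lerD; first by rewrite /SS lerDl sqs_ge0.
rewrite enorm_distC; apply: le_trans (sqs_avg_dist n_gt0 _ _) _; rewrite /PD.
case: ifPn => b2.
  have b3 : (b.+1 <= 2)%N by [].
  have avg0 : avg (fun i => px b i w) = 0.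
    by rewrite /avg big1 ?scaler0// => i _; apply: px_le2; exact: ltnW.
  have -> : sqs (fun i => px b.+1 i w - avg (fun i => px b i w)) = 0.
    by rewrite /sqs big1// => i _; rewrite avg0 px_le2// subr0 enorm0 expr0n.
  by rewrite add0r.
rewrite -ltnNge in b2.
apply: (@le_trans _ _ (sqs (fun i => pY b L1 i w - avg (fun i => px b i w)))).
  apply: ler_sum => i _; rewrite ler_sqr ?nnegrE ?enorm_ge0// px_S//.
  by apply: eproj_le => //; exact: avg_px_in.
apply: le_trans (sqs_dist_prev b L1 w) _; rewrite lerD2r /PHI lerDl; exact: sqs_ge0.
Qed.

(** [pz b.+1] is z(b), applied in block b + 1. Gossip leaves the average of y equal to the average
    of x(b+1) minus the mean step, and the square of its distance to [xs] is expanded. The three n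
    q^2 come from the squared mean step, from replacing the average by x_i(b), and from
    [sqs_drift]. *)
Lemma descent_step b w : (1 <= b)%N ->
  PA b.+2 w + 2 * \sum_i dot (eta *: pz b.+1 i w) (px b i w - xs) <=
  PA b.+1 w + 3 * n%:R * q ^+ 2 + PW b w.
Proof.
move=> b1; set m := avg (fun i => eta *: pz b.+1 i w).
set xb := avg (fun i => px b.+1 i w).
have h1 : PA b.+2 w <= sqs (fun i => pY b.+1 L1 i w - xs).
  apply: ler_sum => i _; rewrite ler_sqr ?nnegrE ?enorm_ge0// px_S//.
  exact: eproj_le.
have h2 : sqs (fun i => pY b.+1 L1 i w - xs) <= PD b.+1 w + n%:R * enorm (xb - m - xs) ^+ 2.
  have -> : PD b.+1 w = PHI b.+1 L1 w by rewrite /PD leqNgt ltnS b1.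
  have -> : xb - m = avg (fun i => pY b.+1 L1 i w) by rewrite pY_avg.
  by rewrite (sqs_split n_gt0 _ xs) lerD2r /PHI lerDl sqs_ge0.
have h3 : n%:R * enorm (xb - m - xs) ^+ 2 =
    n%:R * enorm (xb - xs) ^+ 2 - 2 * \sum_i dot (eta *: pz b.+1 i w) (xb - xs) + n%:R * enorm m ^+ 2.
  have -> : xb - m - xs = (xb - xs) - 1 *: m by rewrite scale1r addrAC.
  rewrite !enorm_sqr dot_sqrBZ -dot_suml avg_sum// -/m dotZl (dotC m).
  by ring.
have h4 : n%:R * enorm (xb - xs) ^+ 2 <= PA b.+1 w by exact: sqs_avg_dist.
have h5 : n%:R * enorm m ^+ 2 <= n%:R * q ^+ 2.
  by rewrite ler_wpM2l// ler_sqr ?nnegrE ?enorm_ge0 ?q_ge0//; exact: eta_z_avg.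
(* The change of evaluation point is absorbed by 2 <a, b> <= |a|^2 + |b|^2. *)
have h6 : 2 * \sum_i dot (eta *: pz b.+1 i w) (px b i w - xs) <=
    2 * \sum_i dot (eta *: pz b.+1 i w) (xb - xs) + n%:R * q ^+ 2 + sqs (fun i => px b i w - xb).
  rewrite -addrA -lerBlDl -mulrBr -sumrB mulr_sumr.
  apply: (@le_trans _ _ (\sum_(i < n) (q ^+ 2 + enorm (px b i w - xb) ^+ 2))); last first.
    by rewrite big_split /= sumr_const card_ord mulr_natl.
  apply: ler_sum => i _; rewrite -(dotC (px b i w - xs)) -(dotC (xb - xs)).
  have -> : dot (px b i w - xs) (eta *: pz b.+1 i w) - dot (xb - xs) (eta *: pz b.+1 i w) =
     dot (eta *: pz b.+1 i w) (px b i w - xb).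
    rewrite -dotNl -dotDl dotC; congr dot; apply/rowP => k; rewrite !mxE; ring.
  have := dot_ge0 (eta *: pz b.+1 i w - 1 *: (px b i w - xb)).
  rewrite dot_sqrBZ -!enorm_sqr.
  have : enorm (eta *: pz b.+1 i w) ^+ 2 <= q ^+ 2.
    by rewrite ler_sqr ?nnegrE ?enorm_ge0 ?q_ge0//; exact: pz_norm.
  rewrite expr1n; lra.
have h7 := sqs_drift b w b1; rewrite -/xb in h7.
rewrite /PW; lra.
Qed.

(** Telescoping of [descent_step] from block 2, where all iterates are 0 and the distance to [xs] is
    at most [Rad]. *)
Lemma descent_total (B : nat) w :
  2 * \sum_(1 <= b < B) \sum_i dot (eta *: pz b.+1 i w) (px b i w - xs) <=
  n%:R * Rad ^+ 2 + \sum_(1 <= b < B) (3 * n%:R * q ^+ 2 + PW b w).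
Proof.
have A0 b : 0 <= PA b w by exact: sqs_ge0.
suff H k : PA k.+2 w + 2 * \sum_(1 <= b < k.+1) \sum_i dot (eta *: pz b.+1 i w) (px b i w - xs) <=
  n%:R * Rad ^+ 2 + \sum_(1 <= b < k.+1) (3 * n%:R * q ^+ 2 + PW b w).
  case: B => [|k]; last by have := H k; have := A0 k.+2; lra.
  by rewrite !big_geq// mulr0 addr0 mulr_ge0 ?sqr_ge0.
elim: k => [|k IH].
  rewrite !big_geq// mulr0 !addr0 /PA /sqs.
  apply: (@le_trans _ _ (\sum_(i < n) Rad ^+ 2)); last by rewrite sumr_const card_ord mulr_natl.
  apply: ler_sum => i _; rewrite px_le2// sub0r enormN ler_sqr ?nnegrE ?enorm_ge0//.
    exact: K_Rad.
  exact: le_trans (enorm_ge0 xs) (K_Rad xs Kxs).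
rewrite big_nat_recr//= [in X in _ <= X]big_nat_recr//=.
have := descent_step k.+1 w isT; move: IH; lra.
Qed.

Definition nuP : probability (Rvec R d) R := nu Pr u n_gt0 mu_.
Local Notation ci := (cinv nuP).

Let nuPE : forall A, measurable A -> nuP A = (unif_ball A)%:E.
Proof. exact: (nuE mu Pr T u xi n_gt0 T_gt0 mu_ indep). Qed.

Definition gap t b i w : R := ci * dot (gest (f t i) eps (px b i w) (cu w t i)) (px b i w - xs).
(** Loss gap minus its linear lower bound; by [gest_mean_ge] its mean given the past is at most 0.
    [CM] bounds its absolute value, so that [CM + Mterm] is a nonnegative function. *)
Definition Mterm t b i w : R := f t i (px b i w) - f t i xs - 2 * G * eps - gap t b i w.
Definition CM : R := ci * (d%:R * G * (2 * Rad)) + 2 * G * Rad + 2 * G * eps.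

Let ci_gt0 : 0 < ci. Proof. exact: (cinv_gt0 nuP d_gt0 nuPE). Qed.

Let Rad_ge0 : 0 <= Rad. Proof. exact: le_trans (enorm_ge0 xs) (K_Rad xs Kxs). Qed.

Lemma gest_gap_bound t i x v : K x -> enorm v <= 1 ->
  `|f t i x - f t i xs - 2 * G * eps - ci * dot (gest (f t i) eps x v) (x - xs)| <= CM.
Proof.
move=> Kx v1; apply: le_trans (ler_normB _ _) _; rewrite addrC.
have h1 : `|ci * dot (gest (f t i) eps x v) (x - xs)| <= ci * (d%:R * G * (2 * Rad)).
  rewrite normrM (gtr0_norm ci_gt0) ler_pM2l//; apply: le_trans (dot_abs_le _ _) _.
  by apply: ler_pM; [exact: enorm_ge0|exact: enorm_ge0|exact: gest_norm|exact: K_dist].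
have h2 : `|f t i x - f t i xs - 2 * G * eps| <= 2 * G * Rad + 2 * G * eps.
  apply: le_trans (ler_normB _ _) _; apply: lerD; last first.
    by rewrite ger0_norm// !mulr_ge0// ltW.
  apply: le_trans (flip t i _ _ (K_sub_X x Kx) (K_sub_X xs Kxs)) _.
  by rewrite -mulrA mulrCA ler_pM2l//; exact: K_dist.
rewrite /CM; lra.
Qed.

Lemma nnm_Mterm t b i : (1 <= b)%N -> nnm (fun w => CM + Mterm t b i w).
Proof.
move=> b1; split=> [|w]; last first.
  have := gest_gap_bound t i _ _ (px_in b i w) (clip_le1 (u t i w)).
  by rewrite ler_norml => /andP[h _]; rewrite /Mterm /gap /cu; lra.
have mx := mrow_px b i b1.
have mcu : mrow (fun w => cu w t i) by exact: (measurableT_comp (@measurable_clip R d) (mu_ t i)).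
have mfc V : mrow V -> measurable_fun setT (fun w : Omega => f t i (V w)) by exact: mrow_comp (mf t i).
apply: measurable_funD; first exact: measurable_cst.
apply: measurable_funB.
  by do 2 apply: measurable_funB => //; exact: mfc.
apply: measurable_funM => //; apply: mrow_dot.
  apply: mrow_scale => //; apply: measurable_funM => //; apply: measurable_funB.
    by apply: (mfc (fun w => px b i w + eps *: cu w t i)); apply: mrowD => //; exact: mrowZ.
  by apply: (mfc (fun w => px b i w - eps *: cu w t i)); apply: mrowB => //; exact: mrowZ.
by apply: mrowB => //; exact: mrow_cst.
Qed.

(** x_i(b) depends only on rounds before block b, so the direction of round t can be averaged first,
    and [gest_mean_ge] applies with the iterate frozen. *)
Lemma EE_Mterm t b i : (1 <= b)%N -> (b.-1 * L < t <= T)%N ->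
  (EE (fun w => CM + Mterm t b i w)%R <= CM%:E)%E.
Proof.
move=> b1 tT; pose s := (b.-1 * L)%N.
pose W := g_sigma_algebraType (past u xi s).
have [ax _ _] := block_adaptedP b b1 i.
have mx : mrow (fun p : W * Rvec R d => px b i p.1) by exact: (measurableT_comp ax measurable_fst).
have mv : mrow (fun p : W * Rvec R d => clip p.2).
  exact: (measurableT_comp (@measurable_clip R d) measurable_snd).
have mfc V : mrow V -> measurable_fun setT (fun p : W * Rvec R d => f t i (V p)) by exact: mrow_comp (mf t i).
pose H (x v : 'rV[R]_d) : R := ci * dot (gest (f t i) eps x (clip v)) (x - xs) - (f t i x - f t i xs - 2 * G * eps).
have HCM x v : K x -> `|H x v| <= CM.
  move=> Kx; rewrite /H -normrN opprB; exact: gest_gap_bound (clip_le1 v).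
pose Psi (p : W * Rvec R d) : \bar R := (CM - H (px b i p.1) p.2)%:E.
have mgest : forall dV (V : measurableType dV) (x v : V -> 'rV[R]_d), mrow x -> mrow v ->
    measurable_fun setT (fun p => H (x p) (v p)).
  move=> dV V x v mrx mrv; have mcv : mrow (fun p => clip (v p)) by exact: (measurableT_comp (@measurable_clip R d) mrv).
  have mfV y : mrow y -> measurable_fun setT (fun p : V => f t i (y p)) by exact: mrow_comp (mf t i).
  apply: measurable_funB; last by do 2 apply: measurable_funB => //; exact: mfV.
  apply: measurable_funM => //; apply: mrow_dot.
    apply: mrow_scale => //; apply: measurable_funM => //; apply: measurable_funB.
      by apply: (mfV (fun p => x p + eps *: clip (v p))); apply: mrowD => //; exact: mrowZ.
    by apply: (mfV (fun p => x p - eps *: clip (v p))); apply: mrowB => //; exact: mrowZ.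
  by apply: mrowB => //; exact: mrow_cst.
have -> : EE (fun w => CM + Mterm t b i w)%R = (\int[Pr]_w Psi (w, u t i w))%E.
  apply: eq_integral => w _; rewrite /Psi /H /Mterm /gap /cu /=; congr EFin; ring.
rewrite (u_tonelli mu Pr T u xi n_gt0 T_gt0 mu_ mxi indep s t i Psi)//; first last.
- move=> p; rewrite lee_fin; have := HCM _ p.2 (px_in b i p.1).
  by rewrite ler_norml => /andP[_ h]; lra.
- apply/measurable_EFinP; apply: measurable_funB => //.
  apply: (mgest _ _ (fun p : W * Rvec R d => px b i p.1) (fun p : W * Rvec R d => p.2)) => //.
  exact: measurable_snd.
rewrite -(EE_cst Pr CM); apply: (@ge0_le_integral_sup R _ Omega Pr
   (fun w => (\int[nuP]_y Psi (w, y))%E) (fun=> CM%:E)) => w.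
  apply: integral_ge0 => y _; rewrite lee_fin.
  have := HCM _ y (px_in b i w); rewrite ler_norml => /andP[_ h]; lra.
have iH : nuP.-integrable setT (EFin \o (fun y : Rvec R d => H (px b i w) y)).
  apply: (@bounded_integrable _ _ _ nuP _ CM); last by move=> y; exact: HCM (px_in b i w).
  by apply: (mgest _ _ (fun=> px b i w) (fun y : Rvec R d => y)); [exact: mrow_cst|exact: measurable_id].
have -> : (\int[nuP]_y Psi (w, y) = \int[nuP]_y (CM%:E - (EFin \o (fun y : Rvec R d => H (px b i w) y)) y))%E.
  by apply: eq_integral => y _; rewrite /Psi EFinB.
rewrite integralB//; last exact: finite_measure_integrable_cst.
rewrite ae_integral_cst -[X in (_ <= X)%E]sube0; apply: leeB => //.
apply: (gest_mean_ge nuP d_gt0 nuPE X (f t i) G eps (Mf t i) (px b i w) xs (mf t i) (fM t i)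
  (ltW G_gt0) eps_gt0 (fcvx t i) (flip t i)).
- by move=> v hv; apply: KX => //; exact: px_in.
- by move=> v hv; exact: KX.
Qed.

Hypothesis (eta_gt0 : 0 < eta) (L_gt0 : (0 < L)%N) (B : nat) (TB : T = (B * L)%N).

Let q_gt0 : 0 < q.
Proof. by rewrite mulr_gt0// !mulr_gt0// ltr0n. Qed.

Let L_R : 0 < L%:R :> R. Proof. by rewrite ltr0n. Qed.

Definition round_loss b i t j w : R :=
  (f t j (px b i w + eps *: cu w t i) + f t j (px b i w - eps *: cu w t i)) / 2 - f t j xs.

Lemma round_loss_le b i t j w : round_loss b i t j w <= f t j (px b i w) - f t j xs + G * eps.
Proof.
have Kx := px_in b i w; have v1 : enorm (cu w t i) <= 1 := clip_le1 _.
have vN1 : enorm (- cu w t i) <= 1 by rewrite enormN.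
have h (v : 'rV[R]_d) : enorm v <= 1 -> f t j (px b i w + eps *: v) <= f t j (px b i w) + G * eps.
  move=> hv; have := flip t j _ _ (KX _ _ Kx hv) (K_sub_X _ Kx).
  have -> : px b i w + eps *: v - px b i w = eps *: v by rewrite addrC addKr.
  rewrite enormZ (gtr0_norm eps_gt0) ler_norml => /andP[_ h'].
  have : G * (eps * enorm v) <= G * eps by rewrite ler_pM2l// ler_piMr// ltW.
  lra.
have := h _ v1; have := h _ vN1; rewrite scalerN /round_loss; lra.
Qed.

(** Used for the final block, whose gradients would act only in a later block and are not covered by
    the descent inequality. *)
Lemma round_loss_last b i t j w : round_loss b i t j w <= 2 * G * Rad + G * eps.
Proof.
apply: le_trans (round_loss_le b i t j w) _; rewrite lerD2r.
have := flip t j _ _ (K_sub_X _ (px_in b i w)) (K_sub_X _ Kxs).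
rewrite ler_norml => /andP[_ h]; apply: le_trans h _.
by rewrite -mulrA mulrCA ler_pM2l//; apply: K_dist => //; exact: px_in.
Qed.

(** Only the mean of the squared error [SS] is controlled, so distances are converted to squares by
    the arithmetic-geometric inequality. The scale [q] is the expected size of the error, which
    makes both terms of order n q. *)
Lemma spread_le b i w :
  \sum_j enorm (px b i w - px b j w) <= n%:R * q + n%:R / q * SS b w.
Proof.
set xb := avg (fun i => px b i w).
have S0 : sqs (fun i => px b i w - xb) <= SS b w by rewrite /SS lerDl sqs_ge0.
have Si : enorm (px b i w - xb) ^+ 2 <= SS b w.
  apply: le_trans S0; rewrite /sqs (bigD1 i)//= lerDl.
  by apply: sumr_ge0 => j _; exact: sqr_ge0.
have q2 : 0 <= (2 * q)^-1 by rewrite invr_ge0 mulr_ge0// ltW.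
apply: (@le_trans _ _ (\sum_(j < n) (q + SS b w / (2 * q) + enorm (px b j w - xb) ^+ 2 / (2 * q)))).
  apply: ler_sum => j _; apply: le_trans (enorm_triangle xb _ _) _.
  have := amgm_half q (enorm (px b i w - xb)) q_gt0; have := amgm_half q (enorm (px b j w - xb)) q_gt0.
  have := ler_wpM2r q2 Si; rewrite (enorm_distC xb); lra.
rewrite big_split /= sumr_const card_ord -mulr_natl -mulr_suml -/(sqs _).
have n1 : 1 <= n%:R :> R by rewrite ler1n.
have := ler_wpM2r q2 S0.
have : SS b w / (2 * q) <= n%:R * (SS b w / (2 * q)).
  by rewrite ler_peMl// divr_ge0 ?SS_ge0// mulr_ge0// ltW.
have -> : n%:R / q * SS b w = 2 * (n%:R * (SS b w / (2 * q))) by field; rewrite gt_eqF.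
lra.
Qed.

(** Learner i is charged for all losses, but the estimator of f_j is taken at x_j: the Lipschitz
    bound moves from x_i to x_j. One G eps comes from the perturbation of the played points and two
    from [Mterm]. *)
Lemma round_sum_le b i t w :
  \sum_j round_loss b i t j w <=
  \sum_j Mterm t b j w + \sum_j gap t b j w + 3 * n%:R * G * eps
  + G * (n%:R * q + n%:R / q * SS b w).
Proof.
apply: (@le_trans _ _ (\sum_(j < n) (Mterm t b j w + gap t b j w + 3 * G * eps
    + G * enorm (px b i w - px b j w)))).
  apply: ler_sum => j _; apply: le_trans (round_loss_le b i t j w) _.
  have := flip t j _ _ (K_sub_X _ (px_in b i w)) (K_sub_X _ (px_in b j w)).
  rewrite ler_norml => /andP[_ h]; rewrite /Mterm; lra.
rewrite 3!big_split /= sumr_const card_ord -[_ *+ n]mulr_natl -[X in _ + _ + _ + X <= _]mulr_sumr.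
by have := ler_wpM2l (ltW G_gt0) (spread_le b i w); lra.
Qed.

Definition block_rounds b := index_iota (b.-1 * L).+1 (b * L).+1.

Lemma size_block b : (1 <= b)%N -> size (block_rounds b) = L.
Proof. by case: b => // b _; rewrite size_iota subSS -mulnBl subSnn mul1n. Qed.

Lemma block_gap b j w : (1 <= b)%N ->
  \sum_(t <- block_rounds b) gap t b j w = ci / eta * dot (eta *: pz b.+1 j w) (px b j w - xs).
Proof.
move=> b1; rewrite /gap -mulr_sumr dotZl pz_S// dot_suml.
by rewrite mulrA divfK// gt_eqF.
Qed.

(** The nonnegative random part of a block's regret. Its [PW] term anticipates the remainder in
    [descent_total], and its constants [CM] make the martingale-like terms nonnegative;
    [block_regret] subtracts both again. *)
Definition NN b w : R := ci / (2 * eta) * PW b w + L%:R * G * n%:R / q * SS b w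
  + \sum_(t <- block_rounds b) \sum_j (CM + Mterm t b j w).

Lemma block_regret b i w : (1 <= b)%N ->
  \sum_(t <- block_rounds b) \sum_j round_loss b i t j w <=
  ci / eta * (\sum_j dot (eta *: pz b.+1 j w) (px b j w - xs)) - ci / (2 * eta) * PW b w
  + NN b w + L%:R * n%:R * (3 * G * eps + G * q - CM).
Proof.
move=> b1.
have sumc (c : R) : \sum_(t <- block_rounds b) c = L%:R * c.
  by rewrite big_const_seq count_predT size_block// iter_addr_0 mulr_natl.
apply: (@le_trans _ _ (\sum_(t <- block_rounds b) (\sum_j Mterm t b j w + \sum_j gap t b j w
    + (3 * n%:R * G * eps + G * (n%:R * q + n%:R / q * SS b w))))).
  by apply: ler_sum => t _; have := round_sum_le b i t w; lra.
rewrite 2!big_split /= sumc [X in _ + X + _ <= _]exchange_big /=.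
rewrite (eq_bigr (fun j => ci / eta * dot (eta *: pz b.+1 j w) (px b j w - xs))); last first.
  by move=> j _; exact: block_gap.
rewrite -[X in _ + X + _ <= _]mulr_sumr.
rewrite /NN; have -> : \sum_(t <- block_rounds b) \sum_j (CM + Mterm t b j w) =
    L%:R * (n%:R * CM) + \sum_(t <- block_rounds b) \sum_j Mterm t b j w.
  rewrite -sumc -big_split; apply: eq_bigr => t _.
  by rewrite big_split /= sumr_const card_ord mulr_natl.
set Z := \sum_(j < n) dot _ _; set Y := \sum_(t <- _) _.
have qn : q != 0 by rewrite gt_eqF.
have en : eta != 0 by rewrite gt_eqF.
rewrite /NN; move: (q) qn => q' qn; move: (PW b w) (SS b w) => W1 W2.
rewrite le_eqVlt; apply/orP; left; apply/eqP; field.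
by rewrite qn en.
Qed.

Lemma sum_blocks (F : nat -> R) k :
  \sum_(1 <= t < (k * L).+1) F t = \sum_(1 <= b < k.+1) \sum_(t <- block_rounds b) F t.
Proof.
elim: k => [|k IH]; first by rewrite mul0n !big_geq.
rewrite [RHS]big_nat_recr//= -IH -big_cat_nat//=.
by rewrite ltnS leq_mul2r leqnSn orbT.
Qed.

Lemma block_ofE b t : (1 <= b)%N -> t \in block_rounds b -> block_of L t = b.
Proof.
move=> b1; rewrite mem_index_iota ltnS => /andP[h1 h2]; rewrite /block_of.
case: b b1 h1 h2 => // b _ /=; case: t => // t; rewrite ltnS /= => h1 h2.
congr _.+1; apply/eqP; rewrite eqn_leq leq_divRL// h1 andbT -ltnS ltn_divLR//.
Qed.

Definition RG i w : R :=
  \sum_(1 <= t < T.+1) \sum_j round_loss (block_of L t) i t j w.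

Definition c0 : R := ci / (2 * eta) * (n%:R * Rad ^+ 2 + (B.-1)%:R * (3 * n%:R * q ^+ 2))
  + (B.-1)%:R * (L%:R * n%:R * (3 * G * eps + G * q - CM)) + L%:R * n%:R * (2 * G * Rad + G * eps).

Let B_gt0 : (0 < B)%N. Proof. by move: T_gt0; rewrite TB muln_gt0 => /andP[]. Qed.

Let cie : 0 <= ci / (2 * eta).
Proof. by apply: divr_ge0; [exact: ltW|apply: mulr_ge0 => //; exact: ltW]. Qed.

Let LGq : 0 <= L%:R * G * n%:R / q.
Proof.
apply: divr_ge0; last exact: ltW.
by apply: mulr_ge0 => //; apply: mulr_ge0 => //; exact: ltW.
Qed.

(** Half of ci / eta times [descent_total] replaces the inner products by constants and [PW], which
    cancels the [PW] subtracted in [block_regret]. The last block is bounded separately. *)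
Lemma RG_le i w : RG i w <= c0 + \sum_(1 <= b < B) NN b w.
Proof.
rewrite /RG TB sum_blocks.
have -> : \sum_(1 <= b < B.+1) \sum_(t <- block_rounds b) \sum_j round_loss (block_of L t) i t j w =
    \sum_(1 <= b < B.+1) \sum_(t <- block_rounds b) \sum_j round_loss b i t j w.
  rewrite !big_nat; apply: eq_bigr => b /andP[b1 _]; rewrite !big_seq; apply: eq_bigr => t tb.
  by rewrite (block_ofE b).
rewrite big_nat_recr//=.
have hlast : \sum_(t <- block_rounds B) \sum_j round_loss B i t j w <= L%:R * n%:R * (2 * G * Rad + G * eps).
  apply: (@le_trans _ _ (\sum_(t <- block_rounds B) n%:R * (2 * G * Rad + G * eps))).
    apply: ler_sum => t _; apply: (@le_trans _ _ (\sum_(j < n) (2 * G * Rad + G * eps))).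
      by apply: ler_sum => j _; exact: round_loss_last.
    by rewrite sumr_const card_ord -[_ *+ n]mulr_natl.
  by rewrite big_const_seq count_predT size_block// iter_addr_0 -[_ *+ L]mulr_natl mulrA.
have hmain : \sum_(1 <= b < B) \sum_(t <- block_rounds b) \sum_j round_loss b i t j w <=
   \sum_(1 <= b < B) (ci / eta * (\sum_j dot (eta *: pz b.+1 j w) (px b j w - xs)) - ci / (2 * eta) * PW b w
  + NN b w + L%:R * n%:R * (3 * G * eps + G * q - CM)).
  rewrite !big_nat; apply: ler_sum => b /andP[b1 _]; exact: block_regret.
have hd := descent_total B w.
rewrite [in leRHS]big_split sumr_const_nat subn1 -[_ *+ B.-1]mulr_natl /= in hd.
rewrite 3!big_split /= sumrN -[X in _ <= X - _ + _ + _]mulr_sumr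
  -[X in _ <= _ - X + _ + _]mulr_sumr sumr_const_nat subn1 -[_ *+ B.-1]mulr_natl in hmain.
have := ler_wpM2l cie hd; move: hmain; rewrite /c0.
set Z := \sum_(1 <= b < B) \sum_(j < n) dot _ _.
have -> : ci / eta * Z = ci / (2 * eta) * (2 * Z) by field; rewrite gt_eqF.
move=> h1 h2; lra.
Qed.

Definition NNmean : R := ci / (2 * eta) * (2 * q ^+ 2) + L%:R * G * n%:R * q + L%:R * (n%:R * CM).

Lemma block_le_T b : (b < B)%N -> (b * L <= T)%N.
Proof. by move=> bB; rewrite TB leq_mul2r ltnW ?orbT. Qed.

Lemma nnm_PD b : nnm (PD b).
Proof.
rewrite /PD; case: (leqP b 1) => b1; first exact: nnm_cst.
by apply: nnm_PHI; exact: ltnW.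
Qed.

Lemma EE_PD b : (b * L <= T)%N -> (EE (PD b) <= (5 / 14 * q ^+ 2)%:E)%E.
Proof.
move=> bT; rewrite /PD; case: (leqP b 1) => b1; last exact: EE_PHI_le.
by rewrite EE_cst lee_fin mulr_ge0 ?sqr_ge0.
Qed.

Lemma nnm_PW b : (1 <= b)%N -> nnm (PW b).
Proof.
move=> b1; apply: nnmD; last exact: nnm_PD.
by apply: nnmD; [exact: nnm_PD|exact: nnm_SS].
Qed.

Lemma EE_PW b : (1 <= b < B)%N -> (EE (PW b) <= (2 * q ^+ 2)%:E)%E.
Proof.
move=> /andP[b1 bB].
rewrite (EE_D Pr (fun w => PD b.+1 w + SS b w) (PD b)); first last.
- exact: nnm_PD.
- by apply: nnmD; [exact: nnm_PD|exact: nnm_SS].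
rewrite (EE_D Pr (PD b.+1) (SS b)); [|exact: nnm_PD|exact: nnm_SS].
apply: (@le_trans _ _ ((5 / 14 * q ^+ 2)%:E + (q ^+ 2)%:E + (5 / 14 * q ^+ 2)%:E)%E).
  apply: leeD; last by apply: EE_PD; exact: block_le_T.
  apply: leeD; first by apply: EE_PD; rewrite TB leq_mul2r bB orbT.
  apply: EE_SS_le => //; apply: leq_trans (block_le_T b bB).
  by rewrite leq_mul2r leq_pred orbT.
by rewrite -!EFinD lee_fin; have := sqr_ge0 q; lra.
Qed.

Lemma nnm_Msum b : (1 <= b)%N -> nnm (fun w => \sum_(t <- block_rounds b) \sum_j (CM + Mterm t b j w)).
Proof.
move=> b1; split=> [|w].
  by apply: measurable_sum => t; apply: measurable_sum => j; case: (nnm_Mterm t b j b1).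
by apply: sumr_ge0 => t _; apply: sumr_ge0 => j _; case: (nnm_Mterm t b j b1).
Qed.

Lemma EE_Msum b : (1 <= b < B)%N ->
  (EE (fun w => \sum_(t <- block_rounds b) \sum_j (CM + Mterm t b j w))%R <= (L%:R * (n%:R * CM))%:E)%E.
Proof.
move=> /andP[b1 bB].
have nM t : nnm (fun w => \sum_j (CM + Mterm t b j w)) by apply: nnm_sum => j; exact: nnm_Mterm.
rewrite (EE_sum_nat Pr _ _ (fun t w => \sum_j (CM + Mterm t b j w)))//.
apply: (@le_trans _ _ (\sum_(t <- block_rounds b) (n%:R * CM)%:E)%E).
  rewrite !big_seq; apply: lee_sum => t; rewrite mem_index_iota ltnS => /andP[t1 t2].
  rewrite EE_sum; last by move=> j; exact: nnm_Mterm.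
  apply: (@le_trans _ _ (\sum_(j < n) CM%:E)%E).
    by apply: lee_sum => j _; apply: EE_Mterm => //; rewrite t1 (leq_trans t2)// block_le_T.
  by rewrite sumEFin lee_fin sumr_const card_ord mulr_natl.
by rewrite sumEFin lee_fin big_const_seq count_predT size_block// iter_addr_0 -[_ *+ L]mulr_natl.
Qed.

Lemma nnm_NN b : (1 <= b)%N -> nnm (NN b).
Proof.
move=> b1; apply: nnmD; last exact: nnm_Msum.
apply: nnmD; apply: nnmZ; [|exact: nnm_PW| |exact: nnm_SS].
  exact: cie.
exact: LGq.
Qed.

Lemma EE_NN b : (1 <= b < B)%N -> (EE (NN b) <= NNmean%:E)%E.
Proof.
move=> bB; have /andP[b1 bB'] := bB.
have c1 := cie.
have c2 := LGq.
pose F1 w := ci / (2 * eta) * PW b w; pose F2 w := L%:R * G * n%:R / q * SS b w.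
have n1 : nnm F1 by apply: nnmZ => //; exact: nnm_PW.
have n2' : nnm F2 by apply: nnmZ => //; exact: nnm_SS.
rewrite (EE_D Pr (fun w => F1 w + F2 w) (fun w => \sum_(t <- block_rounds b) \sum_j (CM + Mterm t b j w))); first last.
- exact: nnm_Msum.
- exact: nnmD.
rewrite (EE_D Pr F1 F2)// (EE_Z Pr _ (PW b))//; last exact: nnm_PW.
rewrite (EE_Z Pr _ (SS b))//; last exact: nnm_SS.
rewrite /NNmean 2!EFinD; apply: leeD; last exact: EE_Msum.
apply: leeD.
  rewrite [leRHS]EFinM; apply: lee_wpmul2l; [by rewrite lee_fin; exact: cie|exact: EE_PW].
have -> : (L%:R * G * n%:R * q)%:E = ((L%:R * G * n%:R / q)%:E * (q ^+ 2)%:E)%E.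
  by rewrite -EFinM; congr EFin; field; rewrite gt_eqF.
apply: lee_wpmul2l; first by rewrite lee_fin.
apply: EE_SS_le => //; apply: leq_trans (block_le_T b bB').
by rewrite leq_mul2r leq_pred orbT.
Qed.

Lemma EE_NN_total :
  nnm (fun w => \sum_(0 <= b < B.-1) NN b.+1 w) /\
  (EE (fun w => \sum_(0 <= b < B.-1) NN b.+1 w)%R <= ((B.-1)%:R * NNmean)%:E)%E.
Proof.
split.
  split=> [|w]; first by apply: measurable_sum => b; case: (nnm_NN b.+1 isT).
  by apply: sumr_ge0 => b _; case: (nnm_NN b.+1 isT).
rewrite (EE_sum_nat Pr _ _ (fun b => NN b.+1)); last by move=> b; exact: nnm_NN.
apply: (@le_trans _ _ (\sum_(0 <= b < B.-1) NNmean%:E)%E).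
  rewrite !big_nat; apply: lee_sum => b /andP[_ bB]; apply: EE_NN.
  by rewrite ltnS leq0n /=; move: bB; case: B B_gt0.
by rewrite sumEFin lee_fin sumr_const_nat subn0 mulr_natl.
Qed.

Definition regret_bound : R :=
  3 / (2 * eta) * (n%:R * Rad ^+ 2 + (B.-1)%:R * (4 * n%:R * q ^+ 2))
  + (B.-1)%:R * (L%:R * n%:R * (3 * G * eps + 2 * G * q)) + L%:R * n%:R * (2 * G * Rad + G * eps).

(** A majorant and its mean are returned, instead of a bound on the mean of [RG], because the final
    statement compares pathwise. The [CM] contributions to [kap] and [a] cancel, and 2 q^2 <= n q^2
    turns the constant 3 into 4. *)
Lemma RG_expect i : exists (k : Omega -> R) (a kap : R),
  [/\ nnm k, (EE k <= kap%:E)%E, forall w, RG i w <= k w + a & kap + a <= regret_bound].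
Proof.
have [nk Ek] := EE_NN_total.
exists (fun w => \sum_(0 <= b < B.-1) NN b.+1 w), c0, ((B.-1)%:R * NNmean); split=> //.
  move=> w; rewrite addrC; apply: le_trans (RG_le i w) _; rewrite lerD2l.
  by rewrite -[in leLHS](prednK B_gt0) big_add1.
rewrite /c0 /NNmean /regret_bound.
have n2R : 2 <= n%:R :> R by rewrite ler_nat.
have q2 : 2 * q ^+ 2 <= n%:R * q ^+ 2 by rewrite ler_wpM2r ?sqr_ge0.
have B0 : 0 <= (B.-1)%:R :> R by [].
have := ler_wpM2l (mulr_ge0 B0 cie) q2.
have ci3 : ci / (2 * eta) <= 3 / (2 * eta).
  rewrite ler_wpM2r ?(cinv_le3 nuP d_gt0 nuPE)// invr_ge0.
  by apply: mulr_ge0 => //; exact: ltW.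
have nq0 : 0 <= n%:R * Rad ^+ 2 + (B.-1)%:R * (4 * n%:R * q ^+ 2).
  by apply: addr_ge0; apply: mulr_ge0 => //; rewrite ?sqr_ge0// mulr_ge0 ?sqr_ge0// mulr_ge0.
have := ler_wpM2r nq0 ci3.
lra.
Qed.

End Processes.

(** * Reduction to measurable losses and constants *)

Section AlmostSureBound.
Context {R : realType} {dO : measure_display} {Omega : measurableType dO}.
Variable Pr : probability Omega R.
Local Open Scope ereal_scope.

(* No measurability of [h] is required: its positive and negative parts are
   compared with those of a measurable majorant, outside a null set. *)
Lemma expectation_le_as (D : set Omega) (h k : Omega -> R) (a kap : R) :
  measurable D -> Pr (~` D) = 0 -> nnm k -> EE Pr k <= kap%:E ->
  (forall w, D w -> (h w <= k w + a)%R) -> 'E_Pr[h] <= (kap + a)%:E.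
Proof.
move=> mD D0 [mk k0] Ek hk; rewrite unlock.
pose g w : \bar R := (k w + a)%:E.
have ik : Pr.-integrable setT (EFin \o k).
  apply/integrableP; split; first exact/measurable_EFinP.
  rewrite (eq_integral (fun w => (k w)%:E)) => [|w _]; last by rewrite /= ger0_norm.
  exact: le_lt_trans Ek (ltry _).
have ia : Pr.-integrable setT (cst a%:E) by exact: finite_measure_integrable_cst.
have ig : Pr.-integrable setT g.
  rewrite (_ : g = (EFin \o k) \+ cst a%:E); first exact: integrableD.
  by apply/funext.
have gE : \int[Pr]_w g w <= (kap + a)%:E.
  rewrite (_ : \int[Pr]_w g w = \int[Pr]_w ((EFin \o k) \+ cst a%:E) w) // integralD// EFinD.
  rewrite [X in _ + X <= _]integral_cst// (_ : _ setT = 1) ?mule1 ?leeD2r//.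
  exact: probability_setT.
have mg := measurable_int _ ig.
apply: le_trans gE; rewrite [leLHS]integralE [leRHS]integralE; apply: leeB.
  (* Infinite on the null set and 0 elsewhere: adding it leaves the integral unchanged but makes the
     majorisation hold at every point. *)
  pose V w : \bar R := if w \in D then 0 else +oo.
  have VE : V = (cst +oo) \_ (~` D).
    by apply/funext => w; rewrite /V patchE in_setC; case: (w \in D).
  have mV : measurable_fun setT V.
    by rewrite VE; apply/(measurable_restrictT _ (measurableC mD)); exact: measurable_cst.
  have V0 w : 0 <= V w by rewrite /V; case: ifP.
  have iV : \int[Pr]_w V w = 0.
    rewrite VE -integral_mkcond integral_cst; last exact: measurableC.
    by rewrite (_ : _ (~` D) = 0) ?mule0.
  have -> : \int[Pr]_w g^\+ w = \int[Pr]_w (g^\+ w + V w).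
    by rewrite ge0_integralD ?iV ?adde0//; exact: measurable_funepos.
  apply: ge0_le_integral_sup => w; first exact: funepos_ge0.
  rewrite /V; case: ifPn => [/set_mem Dw|_]; last by rewrite addey ?leey// gt_eqF// (lt_le_trans _ (funepos_ge0 _ _)).
  rewrite adde0 !funeposE ge_max !le_max lexx orbT andbT.
  by rewrite lee_fin hk.
have -> : \int[Pr]_w g^\- w = \int[Pr]_(w in D) g^\- w.
  rewrite (negligible_integral (N := ~` D))//; first by rewrite setTD setCK.
    exact: measurableC.
  exact: integrable_funeneg.
rewrite (integral_mkcond D); apply: ge0_le_integral_sup => w.
  by rewrite patchE; case: ifP.
rewrite patchE; case: ifPn => [/set_mem Dw|_]; last exact: funeneg_ge0.
rewrite !funenegE ge_max !le_max lexx orbT andbT.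
by rewrite leeN2 lee_fin hk.
Qed.

End AlmostSureBound.

Section RunCongruence.
Context {R : realType} {n d : nat} {S : Type}.
Variables (E : rel 'I_n) (P : 'M[R]_n) (C : S -> 'rV[R]_d -> 'rV[R]_d).
Variables (f f' : nat -> 'I_n -> 'rV[R]_d -> R) (g eta zeta eps : R) (L1 L2 : nat).
Variables (X : set 'rV[R]_d) (u u' : nat -> 'I_n -> 'rV[R]_d) (xi : nat -> 'I_n -> S) (T : nat).
Local Notation L := (L1 + L2)%N.
Local Notation x' b i := ((run E P C f' g eta zeta eps L1 L2 X u' xi b).1.1 i).

(** Equality of the estimators is required only at the iterates of the second run, which suffices
    because the induction has already identified the iterates of the two runs. *)
Lemma run_congr b :
  (forall t i b, (1 <= t <= T)%N -> ghat f eps u t i (x' b i) = ghat f' eps u' t i (x' b i)) ->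
  (b.-1 * L <= T)%N ->
  run E P C f g eta zeta eps L1 L2 X u xi b = run E P C f' g eta zeta eps L1 L2 X u' xi b.
Proof.
move=> eqg; elim: b => [|[|b] IH] // bT.
have {}IH : run E P C f g eta zeta eps L1 L2 X u xi b.+1 =
            run E P C f' g eta zeta eps L1 L2 X u' xi b.+1.
  by apply: IH; apply: leq_trans bT; rewrite leq_mul2r leqnSn orbT.
have eqz : zsum f eps L1 L2 u b.+1 (fun i => x' b.+1 i) = zsum f' eps L1 L2 u' b.+1 (fun i => x' b.+1 i).
  apply/funext => i; rewrite /zsum !big_nat; apply: eq_bigr => t /andP[t1 t2].
  by apply: eqg; rewrite (leq_ltn_trans _ t1)// (leq_trans _ bT)//.
pose step (Z : ('I_n -> 'rV[R]_d) -> 'I_n -> 'rV[R]_d)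
    (s : ('I_n -> 'rV[R]_d) * ('I_n -> 'rV[R]_d) * ('I_n -> 'rV[R]_d)) :=
  let '(x, xh, zp) := s in
  let '(y, yh) := if b.+1 == 1%N then ((fun _ : 'I_n => 0 : 'rV[R]_d), (fun _ : 'I_n => 0 : 'rV[R]_d))
    else block_update E P C g eta zeta L1 L2 X xi b.+1 x xh zp in (y, yh, Z x).
rewrite -[LHS]/(step (zsum f eps L1 L2 u b.+1) (run E P C f g eta zeta eps L1 L2 X u xi b.+1)).
rewrite -[RHS]/(step (zsum f' eps L1 L2 u' b.+1) (run E P C f' g eta zeta eps L1 L2 X u' xi b.+1)).
rewrite IH; move: eqz; case: (run E P C f' g eta zeta eps L1 L2 X u' xi b.+1) => [[x xh] z] /= eqz.
by rewrite eqz.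
Qed.

End RunCongruence.

Section SamplingEvent.
Context {R : realType} {n d : nat} {dS dO : measure_display}.
Context {S : measurableType dS} {Omega : measurableType dO}.
Variables (mu : probability S R) (Pr : probability Omega R) (T : nat).
Variables (u : nat -> 'I_n -> Omega -> Rvec R d) (xi : nat -> 'I_n -> Omega -> S).
Hypotheses (n_gt0 : (0 < n)%N) (T_gt0 : (0 < T)%N).
Hypothesis mu_ : forall t i, measurable_fun setT (u t i).
Hypothesis mxi : forall t i, measurable_fun setT (xi t i).
Hypothesis indep : indep_randomness mu Pr T u xi.

Definition samples_in_ball : set Omega :=
  [set w | forall t i, (1 <= t <= T)%N -> enorm (u t i w : 'rV[R]_d) <= 1].

Let samples_rect : samples_in_ball = rect_event u xi T (fun _ _ => @eball R d 1) (fun _ _ => setT).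
Proof.
apply/seteqP; split => w h t i tT; first by split=> //; exact: h.
by have [] := h t i tT.
Qed.

Lemma samples_in_ball_measurable : measurable samples_in_ball.
Proof.
apply: (past_measurable u xi mu_ mxi T).
by exists (fun _ _ => @eball R d 1), (fun _ _ => setT); split=> // _ _; exact: measurable_enorm_ball.
Qed.

(** The event is a rectangle all of whose factors have probability [unif_ball] of the ball, which
    equals that of the whole space, namely 1. *)
Lemma samples_in_ballC_null : Pr (~` samples_in_ball) = 0%E.
Proof.
rewrite probability_setC; last exact: samples_in_ball_measurable.
rewrite samples_rect (rect_event_prob mu Pr T u xi indep) => [|_ _|_ _]; [|exact: measurable_enorm_ball|exact: measurableT].
rewrite big1 ?subee// => t _; rewrite big1// => i _.
rewrite (fine_mu_setT mu) mulr1 -[RHS](unif_ballT mu Pr T u xi n_gt0 T_gt0 indep).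
by rewrite /unif_ball setIid setTI.
Qed.

End SamplingEvent.

(** * Numerical constants: numbers of rounds and their decay factors *)

Section Constants.
Context {R : realType}.

Lemma natceil_ge (x : R) : 0 <= x -> x <= (natceil x)%:R.
Proof.
move=> x0; rewrite /natceil natr_absz ger0_norm; first exact: ceil_ge.
by rewrite ceil_ge0 (lt_le_trans _ x0)// ltrN10.
Qed.

Lemma natceil_le (x : R) : 0 <= x -> (natceil x)%:R <= x + 1.
Proof.
move=> x0; rewrite /natceil natr_absz ger0_norm; last by rewrite ceil_ge0 (lt_le_trans _ x0)// ltrN10.
by have := ceilB1_lt x; rewrite intrB; move=> h; rewrite -lerBlDr ltW.
Qed.

(** From 1 - x <= exp (- x). *)
Lemma expr_decay (x a : R) k : 0 <= x <= 1 -> 0 < a -> ln a <= k%:R * x -> (1 - x) ^+ k <= a^-1.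
Proof.
move=> /andP[x0 x1] a0 h; apply: (@le_trans _ _ (expR (- x) ^+ k)).
  by rewrite lerXn2r ?nnegrE ?expR_ge0 ?subr_ge0//; exact: expR_ge1Dx.
rewrite -expRM_natl -[a^-1]lnK ?posrE ?invr_gt0// ler_expR lnV ?posrE//.
by rewrite mulrN lerN2.
Qed.

Lemma ln_nat_ge_half n : (2 <= n)%N -> 1 / 2 <= ln n%:R :> R.
Proof.
move=> n2; have n0 : 0 < n%:R :> R by rewrite ltr0n ltnW.
have n2' : 2 <= n%:R :> R by rewrite ler_nat.
have i1 : n%:R^-1 <= 2^-1 :> R by rewrite lef_pV2 ?posrE.
have i0 : 0 < n%:R^-1 :> R by rewrite invr_gt0.
have := @le_ln1Dx R (n%:R^-1 - 1).
have -> : 1 + (n%:R^-1 - 1) = n%:R^-1 :> R by ring.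
rewrite lnV ?posrE// => h; have {}h := h ltac:(lra).
lra.
Qed.

(** As n >= 2, a <= 2^k <= n^k, so a n <= n^(k+1). *)
Lemma ln_mul_le (a : R) n k : (2 <= n)%N -> 0 < a -> a <= 2 ^+ k -> ln (a * n%:R) <= k.+1%:R * ln n%:R :> R.
Proof.
move=> n2 a0 ak; have n0 : 0 < n%:R :> R by rewrite ltr0n ltnW.
rewrite mulr_natl -lnXn// ler_ln ?posrE ?mulr_gt0 ?exprn_gt0// exprSr ler_pM2r//.
by apply: le_trans ak _; rewrite lerXn2r ?nnegrE// ler_nat.
Qed.

Variables (om rho beta : R) (n : nat).
Hypotheses (om01 : 0 < om <= 1) (rho_p : 0 < rho) (rho1 : rho <= 1)
  (rho_beta : rho <= beta) (beta2 : beta <= 2) (n2 : (2 <= n)%N).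
Local Notation g := (gossip_gamma om rho beta).
Local Notation L1 := (natceil (2 * ln (14 * n%:R) / (g * rho))).
Local Notation L2 := (natceil (ln (8 * n%:R) / om)).

Let n0 : 0 < n%:R :> R. Proof. by rewrite ltr0n ltnW. Qed.
Let om0 : 0 < om. Proof. by case/andP: om01. Qed.
Let om1 : om <= 1. Proof. by case/andP: om01. Qed.
Let g0 : 0 < g. Proof. exact: gamma_gt0. Qed.
Let gr0 : 0 < g * rho. Proof. exact: mulr_gt0. Qed.
Let n1 : 1 <= n%:R :> R. Proof. by rewrite ler1n ltnW. Qed.
Let ln14 : 0 <= ln (14 * n%:R) :> R. Proof. by rewrite ln_ge0//; have := n1; lra. Qed.
Let ln8 : 0 <= ln (8 * n%:R) :> R. Proof. by rewrite ln_ge0//; have := n1; lra. Qed.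
Let x1 : 0 <= 2 * ln (14 * n%:R) / (g * rho) :> R.
Proof. by apply: divr_ge0; [apply: mulr_ge0|exact: ltW]. Qed.
Let x2 : 0 <= ln (8 * n%:R) / om :> R.
Proof. by apply: divr_ge0; [|exact: ltW]. Qed.

Lemma gossip_rounds_decay : (1 - g * rho / 2) ^+ L1 <= (14 * n%:R)^-1.
Proof.
apply: expr_decay; first by have := gamma_rho_le om rho beta om01 rho_p rho_beta; have := om1; have := gr0; lra.
  exact: mulr_gt0.
have := natceil_ge _ x1; rewrite ler_pdivrMr//; lra.
Qed.

Lemma residual_rounds_decay : (1 - om) ^+ L2 <= (8 * n%:R)^-1.
Proof.
apply: expr_decay; first by rewrite (ltW om0).
  exact: mulr_gt0.
by have := natceil_ge _ x2; rewrite ler_pdivrMr.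
Qed.

(** With rho <= 1 and beta <= 2 the four summands are at most 8, 16, 16 and 1. *)
Lemma gossip_den_le : gossip_den om rho beta <= 41.
Proof.
have b0 : 0 <= beta by apply: le_trans rho_beta; exact: ltW.
have b4 : beta ^+ 2 <= 4.
  have -> : 4 = 2 ^+ 2 :> R by ring.
  by rewrite lerXn2r ?nnegrE.
have r1 : rho ^+ 2 <= 1 by rewrite expr_le1 // ltW.
have bb : 0 <= beta ^+ 2 + 2 * beta by rewrite addr_ge0 ?sqr_ge0 ?mulr_ge0.
have h1 : 2 * rho * beta ^+ 2 <= 8.
  have -> : 8 = 2 * 1 * 4 :> R by ring.
  apply: ler_pM => //; first by rewrite mulr_ge0 ?(ltW rho_p).
    exact: sqr_ge0.
  by rewrite ler_pM2l.
have h2 : (2 - om) * (beta ^+ 2 + 2 * beta) * rho <= 16.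
  have -> : 16 = 2 * 8 * 1 :> R by ring.
  have o2 : 0 <= 2 - om by have := om1; lra.
  apply: ler_pM => //; [by rewrite mulr_ge0|exact: ltW|].
  have := om0 => o0.
  apply: ler_pM => //.
    lra.
  by have := beta2; lra.
rewrite /gossip_den; lra.
Qed.

(** 418 = 410 + 4 + 4: the gossip rounds give 2 * 41 * 5 since ln (14 n) <= 5 ln n, the residual
    rounds give 4 since ln (8 n) <= 4 ln n, and each of the two ceilings adds 1, at most 2 ln n /
    (om rho^2). *)
Lemma rounds_le : (L1 + L2)%:R <= 418 * (ln n%:R / (om * rho ^+ 2)) :> R.
Proof.
have l2 := ln_nat_ge_half n n2; have l0 : 0 < ln n%:R :> R by lra.
have r2 : 0 < om * rho ^+ 2 by rewrite mulr_gt0 ?exprn_gt0.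
have o0 := om0.
have or1 : om * rho ^+ 2 <= 1.
  by rewrite mulr_ile1 ?(ltW o0) ?sqr_ge0 ?om1// expr_le1 // ltW.
have v1 : 1 <= 2 * (ln n%:R / (om * rho ^+ 2)).
  by rewrite mulrA ler_pdivlMr// mul1r; lra.
have h1 : 2 * ln (14 * n%:R) / (g * rho) <= 410 * (ln n%:R / (om * rho ^+ 2)).
  have -> : 2 * ln (14 * n%:R) / (g * rho) =
      2 * (gossip_den om rho beta * (ln (14 * n%:R) / (om * rho ^+ 2))).
    rewrite /gossip_gamma; field.
    by rewrite ?gt_eqF// gossip_den_gt0.
  have -> : 410 * (ln n%:R / (om * rho ^+ 2)) = 2 * (41 * ((4.+1%:R * ln n%:R) / (om * rho ^+ 2))).
    by field; rewrite !gt_eqF.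
  rewrite ler_pM2l//; apply: ler_pM; [|by rewrite divr_ge0 ?(ltW r2)|exact: gossip_den_le|].
    by apply: ltW; exact: gossip_den_gt0.
  by rewrite ler_pM2r ?invr_gt0//; apply: ln_mul_le => //; rewrite -natrX ler_nat.
have h2 : ln (8 * n%:R) / om <= 4 * (ln n%:R / (om * rho ^+ 2)).
  rewrite mulrA; apply: ler_pM; rewrite ?invr_ge0 ?(ltW o0)//.
    by apply: ln_mul_le => //; rewrite -natrX ler_nat.
  by rewrite lef_pV2 ?posrE// ler_piMr ?(ltW o0)// expr_le1 // ltW.
have := natceil_le _ x1; have := natceil_le _ x2; rewrite natrD; lra.
Qed.

End Constants.

Section TotalBound.
Context {R : realType} {n d : nat}.
Variables (G Rad r c : R) (L1 L2 B T : nat).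
Local Notation L := (L1 + L2)%N.
Local Notation eps := (c / Num.sqrt T%:R).
Local Notation s := (Num.sqrt ((L * T)%:R : R)).
Local Notation eta := (Rad / (d%:R * G * s)).
Hypotheses (G0 : 0 < G) (r0 : 0 < r) (c0 : 0 < c) (rRad : r <= Rad) (d0 : (0 < d)%N).
Hypotheses (L0 : (0 < L)%N) (T0 : (0 < T)%N) (TB : T = (B * L)%N) (epsr : eps <= r).

Definition regret_const : R := 15 / 2 * G * Rad + 3 * G * c + 5 * G * Rad + G * c * Rad / r.

Let Rad0 : 0 < Rad. Proof. exact: lt_le_trans r0 rRad. Qed.
Let a0 : 0 < Num.sqrt T%:R :> R. Proof. by rewrite sqrtr_gt0 ltr0n. Qed.
Let s0 : 0 < s. Proof. by rewrite sqrtr_gt0 ltr0n muln_gt0 L0. Qed.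
Let dR : 1 <= d%:R :> R. Proof. by rewrite ler1n. Qed.
Let dp : 0 < d%:R :> R. Proof. exact: lt_le_trans dR. Qed.
Let e0 : 0 < eps. Proof. exact: divr_gt0. Qed.
Let eta0 : 0 < eta. Proof. by apply: divr_gt0 => //; apply: mulr_gt0 => //; exact: mulr_gt0. Qed.
Let a2 : Num.sqrt T%:R ^+ 2 = T%:R :> R. Proof. exact: sqr_sqrtr. Qed.
Let s2 : s ^+ 2 = L%:R * T%:R :> R. Proof. by rewrite sqr_sqrtr// natrM. Qed.
Let LT : (L <= T)%N.
Proof.
by rewrite TB leq_pmull//; move: T0; rewrite TB muln_gt0 => /andP[].
Qed.
Let Ls : L%:R <= s.
Proof.
rewrite -(@ler_pXn2r _ 2)// ?nnegrE ?(ltW s0)// s2 expr2.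
by rewrite ler_wpM2l// ler_nat.
Qed.
Let as_ : Num.sqrt T%:R <= s.
Proof. by rewrite ler_wsqrtr// ler_nat leq_pmull. Qed.
Let BL : (B.-1)%:R * L%:R <= T%:R :> R.
Proof. by rewrite -natrM ler_nat TB leq_mul2r leq_pred orbT. Qed.

Local Notation q := (eta * (L%:R * d%:R * G)).

Let qE : q = Rad * L%:R / s.
Proof. by field; rewrite !gt_eqF. Qed.

(** The choice of eta gives q^2 = Rad^2 L / T, while there are fewer than T / L blocks to sum over;
    hence the accumulated errors match the initial squared distance. *)
Let Bq : (B.-1)%:R * q ^+ 2 <= Rad ^+ 2.
Proof.
have -> : (B.-1)%:R * q ^+ 2 = Rad ^+ 2 * ((B.-1)%:R * L%:R / T%:R).
  have Ln : L%:R != 0 :> R by rewrite pnatr_eq0 -lt0n.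
  have Tn : T%:R != 0 :> R by rewrite pnatr_eq0 -lt0n.
  rewrite qE expr_div_n s2 exprMn.
  by move: (L%:R) (T%:R) Ln Tn => l t ln tn; field; rewrite ln tn.
by rewrite ler_piMr ?sqr_ge0// ler_pdivrMr ?ltr0n// mul1r.
Qed.

(** The parts of [regret_const] are, in order: descent (15/2 = 3/2 * (1 + 4)), perturbation of the
    points, spread of the learners together with the last block (2 + 3), and shrinking of the
    comparator. The last block is affordable since L <= sqrt (L T). *)
Lemma total_bound : regret_bound (n := n) (d := d) G eta eps L1 L2 Rad B
    + n%:R * T%:R * (G * (eps / r * Rad)) <= regret_const * (n%:R * d%:R * s).
Proof.
have n0 : 0 <= n%:R :> R by [].
have sd : s <= d%:R * s by rewrite ler_peMl// ltW.
have ad : Num.sqrt T%:R <= d%:R * s by exact: le_trans as_ sd.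
have h1 : 3 / (2 * eta) * (n%:R * Rad ^+ 2 + (B.-1)%:R * (4 * n%:R * q ^+ 2)) <=
    15 / 2 * G * Rad * (n%:R * (d%:R * s)).
  apply: (@le_trans _ _ (3 / (2 * eta) * (n%:R * Rad ^+ 2 + 4 * n%:R * Rad ^+ 2))).
    apply: ler_wpM2l; first by apply: divr_ge0 => //; apply: mulr_ge0 => //; exact: ltW.
    by rewrite lerD2l mulrCA ler_wpM2l// mulr_ge0.
  rewrite le_eqVlt; apply/orP; left; apply/eqP; field.
  by rewrite ?gt_eqF.
have q0 : 0 <= q by apply: mulr_ge0; [exact: ltW|rewrite !mulr_ge0// ltW].
have Tq : T%:R * q = Rad * s.
  have -> : T%:R * q = Rad * (L%:R * T%:R) / s by rewrite qE; ring.
  by rewrite -s2; field; rewrite gt_eqF.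
have Te : T%:R * eps = c * Num.sqrt T%:R 
    by have := a2; have := a0; move: (Num.sqrt T%:R) => a ha <-; field; rewrite gt_eqF.
have h2 : (B.-1)%:R * (L%:R * n%:R * (3 * G * eps + 2 * G * q)) <=
    (3 * G * c + 2 * G * Rad) * (n%:R * (d%:R * s)).
  have e3 : 0 <= 3 * G * eps + 2 * G * q.
    by apply: addr_ge0; apply: mulr_ge0 => //; first [exact: ltW|apply: mulr_ge0 => //; exact: ltW].
  apply: (@le_trans _ _ (T%:R * (n%:R * (3 * G * eps + 2 * G * q)))).
    by rewrite -[in leLHS](mulrA L%:R) mulrA ler_wpM2r// mulr_ge0.
  have -> : T%:R * (n%:R * (3 * G * eps + 2 * G * q)) =
      n%:R * (3 * G * (T%:R * eps) + 2 * G * (T%:R * q)) by ring.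
  rewrite Te Tq.
  have -> : (3 * G * c + 2 * G * Rad) * (n%:R * (d%:R * s)) =
     n%:R * (3 * G * c * (d%:R * s) + 2 * G * Rad * (d%:R * s)) by ring.
  rewrite ler_wpM2l// lerD//.
    by rewrite mulrA ler_wpM2l// !mulr_ge0// ltW.
  by rewrite mulrA ler_wpM2l// !mulr_ge0// ltW.
have h3 : L%:R * n%:R * (2 * G * Rad + G * eps) <= 3 * G * Rad * (n%:R * (d%:R * s)).
  have -> : 3 * G * Rad * (n%:R * (d%:R * s)) = (d%:R * s) * n%:R * (3 * G * Rad) by ring.
  have eR : eps <= Rad by exact: le_trans epsr rRad.
  have Ge : G * eps <= G * Rad by rewrite ler_pM2l.
  have GR : 0 <= G * Rad by rewrite mulr_ge0 ?ltW.
  have Ge0 : 0 <= G * eps by rewrite mulr_ge0 ?ltW.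
  apply: ler_pM; [exact: mulr_ge0|lra| |lra].
  by rewrite ler_wpM2r//; exact: le_trans Ls sd.
have h4 : n%:R * T%:R * (G * (eps / r * Rad)) <= G * c * Rad / r * (n%:R * (d%:R * s)).
  have -> : n%:R * T%:R * (G * (eps / r * Rad)) = G * c * Rad / r * (n%:R * Num.sqrt T%:R).
    have -> : n%:R * T%:R * (G * (eps / r * Rad)) = (T%:R * eps) * (G * Rad / r) * n%:R by ring.
    by rewrite Te; ring.
  by rewrite ler_wpM2l ?ler_wpM2l// !mulr_ge0 ?invr_ge0// ltW.
have -> : regret_const * (n%:R * d%:R * s) =
  15 / 2 * G * Rad * (n%:R * (d%:R * s)) + (3 * G * c + 2 * G * Rad) * (n%:R * (d%:R * s))
  + 3 * G * Rad * (n%:R * (d%:R * s)) + G * c * Rad / r * (n%:R * (d%:R * s)).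
  by rewrite /regret_const; ring.
rewrite /regret_bound.
apply: lerD; last exact: h4.
apply: lerD; last exact: h3.
apply: lerD; last exact: h2.
exact: h1.
Qed.

End TotalBound.

Section Reduction.
Context {R : realType} {n d : nat} {dS dO : measure_display}.
Context {S : measurableType dS} {Omega : measurableType dO}.
Variables (T : nat) (u : nat -> 'I_n -> Omega -> Rvec R d) (xi : nat -> 'I_n -> Omega -> S).
Variables (E : rel 'I_n) (P : 'M[R]_n) (om : R) (C : S -> 'rV[R]_d -> 'rV[R]_d).
Variables (X : set 'rV[R]_d) (f : nat -> 'I_n -> 'rV[R]_d -> R).
Variables (G eta zeta eps Rad : R) (L1 L2 : nat).
Local Notation K := (shrink zeta X).
Local Notation g := (gossip_gamma om (1 - singval P 1) (singval (1%:M - P) 0)).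
Local Notation L := (L1 + L2)%N.
Hypotheses (zeta_ge0 : 0 <= zeta) (G_ge0 : 0 <= G).
Hypotheses (cK : compact K) (K0 : K 0).
Hypothesis KX : forall x v, K x -> enorm v <= 1 -> X (x + eps *: v).
Hypothesis XRad : forall x, X x -> enorm x <= Rad.
Hypothesis flip : forall t i x y, X x -> X y -> `|f t i x - f t i y| <= G * enorm (x - y).

(* Outside X the loss is arbitrary, hence possibly not measurable; it is only
   evaluated in X, except on a null set. *)
Definition restricted_loss t i : 'rV[R]_d -> R := (f t i) \_ X.
Local Notation f' := restricted_loss.

Lemma restricted_lossE t i x : X x -> f' t i x = f t i x.
Proof. by move=> Xx; rewrite /f' patchE mem_set. Qed.

Lemma run_restricted b w : samples_in_ball T u w -> (b.-1 * L <= T)%N ->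
  run E P C f g eta zeta eps L1 L2 X (fun t j => u t j w) (fun t j => xi t j w) b =
  RUN u xi E P om C X f' eta zeta eps L1 L2 b w.
Proof.
move=> uw bT; apply: run_congr bT => t i b' tT.
have Kx := px_in u xi E P om C X f' eta zeta eps L1 L2 cK K0 b' i w.
have v1 := uw t i tT; have vN1 : enorm (- (u t i w : 'rV[R]_d)) <= 1 by rewrite enormN.
rewrite /ghat /cu /clip v1 -/(RUN u xi E P om C X f' eta zeta eps L1 L2 b' w).
by rewrite !restricted_lossE//; rewrite -?scalerN; exact: KX.
Qed.

(** Replacing the minimiser by (1 - zeta) xm, which lies in the shrunken set, costs at most G zeta
    Rad per loss. On the event the played points stay in X, where restricted and original losses
    agree. *)
Lemma regret2_le xm i w : X xm ->
  (forall y, X y -> \sum_(1 <= t < T.+1) \sum_(j < n) f t j xm <= \sum_(1 <= t < T.+1) \sum_(j < n) f t j y) ->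
  samples_in_ball T u w ->
  regret2 E P C f g eta zeta eps L1 L2 X (fun t j => u t j w) (fun t j => xi t j w) T i <=
  RG T u xi E P om C X f' eta zeta eps L1 L2 ((1 - zeta) *: xm) i w
  + n%:R * T%:R * (G * (zeta * Rad)).
Proof.
move=> Xm minm uw; have Km : K ((1 - zeta) *: xm) by exists xm.
have K_sub x : K x -> X x.
  by move=> Kx; have := KX x 0 Kx; rewrite scaler0 addr0; apply; rewrite enorm0.
have infm : \sum_(1 <= t < T.+1) \sum_(j < n) f t j xm <=
    inf [set (\sum_(1 <= t < T.+1) \sum_(j < n) f t j x) | x in X].
  apply: lb_le_inf; first by exists (\sum_(1 <= t < T.+1) \sum_(j < n) f t j xm), xm.
  by move=> _ [y Xy <-]; exact: minm.
rewrite /regret2; apply: le_trans (lerB (lexx _) infm) _.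
rewrite lerBlDr /RG.
have -> : n%:R * T%:R * (G * (zeta * Rad)) =
    \sum_(1 <= t < T.+1) \sum_(j < n) G * (zeta * Rad).
  rewrite sumr_const card_ord sumr_const_nat subn1 /= -[_ *+ n]mulr_natl -[_ *+ T]mulr_natl; ring.
rewrite -!big_split /= !big_nat; apply: ler_sum => t tT.
rewrite -!big_split /=; apply: ler_sum => j _.
have bT : ((block_of L t).-1 * L <= T)%N.
  apply: leq_trans (leq_trunc_div _ _) _; apply: leq_trans (leq_pred _) _.
  by case/andP: tT.
have v1 := uw t i tT; have vN1 : enorm (- (u t i w : 'rV[R]_d)) <= 1 by rewrite enormN.
rewrite /xblock run_restricted// -/(px u xi E P om C X f' eta zeta eps L1 L2 (block_of L t) i w).
have Kx := px_in u xi E P om C X f' eta zeta eps L1 L2 cK K0 (block_of L t) i w.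
rewrite /round_loss /cu /clip v1.
have Xp := KX _ _ Kx v1; have Xn := KX _ _ Kx vN1; rewrite scalerN in Xn.
have Xs := K_sub _ Km; rewrite !restricted_lossE//.
have := flip t j _ _ (K_sub _ Km) Xm; rewrite ler_norml => /andP[_ h].
have e : (1 - zeta) *: xm - xm = - (zeta *: xm) by rewrite scalerBl scale1r addrAC subrr sub0r.
have h2 : G * enorm ((1 - zeta) *: xm - xm) <= G * (zeta * Rad).
  rewrite e enormN enormZ (ger0_norm zeta_ge0) ler_wpM2l// ler_wpM2l//; exact: XRad.
lra.
Qed.

End Reduction.

Section ConvexityBridge.
Context {R : realType} {d : nat}.
Implicit Types (X : set 'rV[R]_d) (f : 'rV[R]_d -> R).

Lemma convex_set_cvx X : convex_set X -> cvx_set X.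
Proof.
move=> cX x y t Xx Xy /andP[t0 t1].
have := cX x y (Itv01 t0 t1) (mem_set Xx) (mem_set Xy).
by move=> /set_mem.
Qed.

Lemma convex_function_cvx X f : convex_function X f ->
  forall a b (s : R), X a -> X b -> 0 <= s <= 1 -> f (s *: a + (1 - s) *: b) <= s * f a + (1 - s) * f b.
Proof.
move=> cf a b s Xa Xb /andP[s0 s1].
exact: (cf (Itv01 s0 s1) a b (mem_set Xa) (mem_set Xb)).
Qed.

Lemma ball_radius_le (r Rad : R) X : (0 < d)%N -> 0 <= r ->
  @eball R d r `<=` X -> X `<=` @eball R d Rad -> r <= Rad.
Proof.
move=> d0 r0 rX XR; pose v : 'rV[R]_d := r *: delta_mx 0 (Ordinal d0).
have nv : enorm v = r.
  rewrite enormZ (ger0_norm r0) /enorm (bigD1 (Ordinal d0))//= big1 => [|j jn].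
    by rewrite mxE !eqxx /= expr1n addr0 sqrtr1 mulr1.
  by rewrite mxE eqxx /= (negbTE jn) expr0n.
by have := XR v (rX v _); rewrite /eball/= nv; apply.
Qed.

Lemma sum_minimizer (X : set 'rV[R]_d) (n T : nat) (f : nat -> 'I_n -> 'rV[R]_d -> R) :
  compact X -> X !=set0 -> (forall t i x, X x -> {for x, continuous (f t i)}) ->
  exists2 xm, X xm & forall y, X y ->
    \sum_(1 <= t < T.+1) \sum_(j < n) f t j xm <= \sum_(1 <= t < T.+1) \sum_(j < n) f t j y.
Proof.
move=> cX X0 cf.
have [|xm /set_mem Xm minm] := @EVT_min_rV R d
    (fun x => \sum_(1 <= t < T.+1) \sum_(j < n) f t j x) X X0 cX; last first.
  by exists xm => // y Xy; apply: minm; exact: mem_set.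
apply: continuous_in_subspaceT => x /set_mem Xx.
have addc : continuous (fun z : R * R => z.1 + z.2) by move=> z; exact: add_continuous.
apply: (cvg_big addc (nbhs_filter x)) => t _.
by apply: (cvg_big addc (nbhs_filter x)) => j _; exact: cf.
Qed.

End ConvexityBridge.

Theorem theorem7 (R : realType) (G Rad r c : R) :
  0 < G -> 0 < r -> 0 < c ->
  exists K : R,
  forall (n d : nat) (E : rel 'I_n) (P : 'M[R]_n) (om : R)
    (dS : measure_display) (S : measurableType dS) (mu : probability S R)
    (C : S -> 'rV[R]_d -> 'rV[R]_d)
    (X : set 'rV[R]_d) (f : nat -> 'I_n -> 'rV[R]_d -> R) (T : nat)
    (dO : measure_display) (Omega : measurableType dO) (Pr : probability Omega R)
    (u : nat -> 'I_n -> Omega -> Rvec R d) (xi : nat -> 'I_n -> Omega -> S),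
  (2 <= n)%N -> (0 < d)%N ->
  (* undirected graph *)
  symmetric E ->
  (* (A1) communication matrix *)
  comm_matrix E P ->
  (* omega-contractive compressor, fresh independent randomness at each use *)
  0 < om <= 1 ->
  contractive_compressor mu C om ->
  measurable_fun setT (fun p : S * Rvec R d => (C p.1 p.2 : Rvec R d)) ->
  (* the decision set: closed convex, (A6) r B <= X <= Rad B *)
  closed X -> convex_set X ->
  @eball R d r `<=` X -> X `<=` @eball R d Rad ->
  (* (A2) convex losses, (A4) bounded gradients on X *)
  (forall t i, convex_function X (f t i)) ->
  (forall t i x, X x -> differentiable (f t i) x /\ enorm (grad (f t i) x) <= G) ->
  let rho := 1 - singval P 1 in
  let beta := singval (1%:M - P) 0 in
  let gamma := om * rho /
      (2 * rho * beta ^+ 2 + 4 * beta ^+ 2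
       + (2 - om) * (beta ^+ 2 + 2 * beta) * rho + rho ^+ 2) in
  let L1 := natceil (2 * ln (14 * n%:R) / (gamma * rho)) in
  let L2 := natceil (ln (8 * n%:R) / om) in
  let L := (L1 + L2)%N in
  (0 < T)%N -> (L %| T)%N ->
  let eps := c / Num.sqrt T%:R in
  eps <= r ->
  let eta := Rad / (d%:R * G * Num.sqrt (L * T)%:R) in
  let zeta := eps / r in
  (* the sampled directions u_{t,i} (uniform on the unit ball) and the
     compressor seeds xi_{t,i} (law mu) are mutually independent *)
  (forall t i, measurable_fun setT (u t i)) ->
  (forall t i, measurable_fun setT (xi t i)) ->
  indep_randomness mu Pr T u xi ->
  forall i : 'I_n,
  ('E_Pr[fun w => regret2 E P C f gamma eta zeta eps L1 L2 X
                    (fun t j => (u t j w : 'rV[R]_d)) (fun t j => xi t j w) T i]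
   <= (K / Num.sqrt om / rho * d%:R * n%:R * Num.sqrt (ln n%:R)
         * Num.sqrt T%:R)%:E)%E.
Proof.
(* The factor sqrt 418 comes from [rounds_le] through sqrt (L T). *)
move=> G0 r0 c0; exists (regret_const G Rad r c * Num.sqrt 418).
move=> n d E P om dS S mu C X f T dO Omega Pr u xi n2 d0 symE cP om01 Cc mC clX cvX rX XR cf df.
move=> rho beta gamma L1 L2 L T0 LdvdT eps epsr eta zeta mu_ mxi indep i.
have rRad : r <= Rad by exact: ball_radius_le d0 (ltW r0) rX XR.
have Rad0 : 0 < Rad by exact: lt_le_trans r0 rRad.
have n0 : (0 < n)%N by exact: ltnW.
have X0 : X 0 by apply: rX; rewrite /eball/= enorm0 ltW.
have XRad x : X x -> enorm x <= Rad by exact: XR.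
have cvxX : cvx_set X by exact: convex_set_cvx.
have cX : compact X by exact: (enorm_bounded_compact X Rad).
have fcvx t j := convex_function_cvx X (f t j) (cf t j).
have flip t j x y : X x -> X y -> `|f t j x - f t j y| <= G * enorm (x - y).
  by apply: convex_lipschitz; [move=> a b s; exact: fcvx|exact: df].
have fcont t j x : X x -> {for x, continuous (f t j)}.
  by move=> /(df t j)[dx _]; exact: differentiable_continuous.
have [xm Xm minm] := sum_minimizer X n T f cX (ex_intro _ 0 X0) fcont.
have rho_p : 0 < rho := rho_pos E P cP.
have rho_b : rho <= beta := rho_beta_le E P n2 cP.
have rho1 : rho <= 1 by exact: rho_le1.
have beta2 : beta <= 2.
  by case: cP => -[sP _ rP _] [_ _ s1]; exact: beta_le2.
have om0 : 0 < om by case/andP: om01.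
have rate1 := gossip_rounds_decay om rho beta n om01 rho_p rho_b n2.
have rate2 := residual_rounds_decay om n om01 n2.
have Lle := rounds_le om rho beta n om01 rho_p rho1 rho_b beta2 n2.
rewrite -/gamma -/L1 -/L2 -/L in rate1 rate2 Lle.
(* A divisor of the positive number [T] is positive. *)
have L0 : (0 < L)%N.
  by rewrite lt0n; apply: contraTneq LdvdT => ->; rewrite dvd0n -lt0n.
have TB : T = ((T %/ L) * L)%N by rewrite divnK.
have a0 : 0 < Num.sqrt T%:R :> R by rewrite sqrtr_gt0 ltr0n.
have eps0 : 0 < eps by exact: divr_gt0.
have zeta0 : 0 <= zeta by apply: divr_ge0; exact: ltW.
have zeta01 : 0 <= zeta <= 1 by rewrite zeta0 /= ler_pdivrMr// mul1r.
have zr : zeta * r = eps by rewrite divfK// gt_eqF.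
have eta0 : 0 < eta.
  apply: divr_gt0 => //; apply: mulr_gt0; last by rewrite sqrtr_gt0 ltr0n muln_gt0 L0.
  by apply: mulr_gt0 => //; rewrite ltr0n.
have K0 : shrink zeta X 0 by exists 0; rewrite ?scaler0.
have KX x v : shrink zeta X x -> enorm v <= 1 -> X (x + eps *: v).
  by rewrite -zr; exact: shrink_ball.
have cK := shrink_compact X zeta cX.
pose f' := restricted_loss X f; pose xs := (1 - zeta) *: xm.
have f'E t j x : X x -> f' t j x = f t j x by exact: restricted_lossE.
have Kxs : shrink zeta X xs by exists xm.
have mf' t j : measurable_fun setT (f' t j : Rvec R d -> R).
  by apply: continuous_in_restrict_measurable => // x; exact: fcont.
have flip' t j x y : X x -> X y -> `|f' t j x - f' t j y| <= G * enorm (x - y).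
  by move=> Xx Xy; rewrite !f'E//; exact: flip.
(* The restricted loss is 0 outside [X] and Lipschitz on it, so it is bounded on the whole space, as
   integration against the ball law requires. *)
have fM t j x : `|f' t j x| <= `|f t j 0| + G * Rad.
  rewrite /f' /restricted_loss patchE; case: ifPn => [/set_mem Xx|_]; last first.
    by rewrite normr0 addr_ge0// mulr_ge0 ?ltW.
  have := flip t j x 0 Xx X0; rewrite subr0 => h.
  have hG : G * enorm x <= G * Rad by rewrite ler_pM2l//; exact: XRad.
  rewrite (_ : f t j x = f t j 0 + (f t j x - f t j 0)); last by rewrite addrC subrK.
  apply: le_trans (ler_normD _ _) _; rewrite lerD2l; exact: le_trans h hG.
have fcvx' t j a b s : X a -> X b -> 0 <= s <= 1 ->
    f' t j (s *: a + (1 - s) *: b) <= s * f' t j a + (1 - s) * f' t j b.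
  by move=> Xa Xb s01; rewrite !f'E//; [exact: fcvx|exact: cvxX].
have [k [a [kap [nk Ek kle bound]]]] := RG_expect mu Pr T u xi E P om C n2 T0 mu_ mxi indep
  cP om01 Cc mC X f' G eta zeta eps L1 L2 mf' G0 (ltW eta0) eps0 flip' cK
  (shrink_convex X zeta cvxX) K0 KX rate1 rate2 Rad _ xs d0 XRad Kxs fM fcvx' eta0 L0 _ TB i.
apply: (@le_trans _ _ ((kap + (a + n%:R * T%:R * (G * (zeta * Rad))))%:E)).
  apply: (expectation_le_as Pr (samples_in_ball T u) _ k) => //.
  - exact: (samples_in_ball_measurable T u xi mu_ mxi).
  - exact: (samples_in_ballC_null mu Pr T u xi n0 T0 mu_ mxi indep).
  move=> w Dw; rewrite addrA; apply: le_trans (lerD (kle w) (lexx _)).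
  exact: (regret2_le T u xi E P om C X f G eta zeta eps Rad L1 L2 zeta0 (ltW G0) cK K0 KX XRad flip xm i w Xm minm Dw).
rewrite lee_fin addrA; apply: le_trans (lerD bound (lexx _)) _.
apply: le_trans (total_bound G Rad r c L1 L2 (T %/ L) T G0 r0 c0 rRad d0 L0 T0 TB epsr) _.
have rc0 : 0 <= regret_const G Rad r c.
  by rewrite /regret_const !addr_ge0 ?mulr_ge0 ?invr_ge0// ltW.
(* The bound on L by a multiple of ln n / (om rho^2) is where the dependence on om, rho and n under
   the root arises. *)
have sb : Num.sqrt (L * T)%:R <= Num.sqrt 418 * (Num.sqrt (ln n%:R) / (Num.sqrt om * rho)) * Num.sqrt T%:R.
  have l0 : 0 <= ln n%:R :> R by rewrite ln_ge0// ler1n.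
  have -> : Num.sqrt (ln n%:R) / (Num.sqrt om * rho) = Num.sqrt (ln n%:R / (om * rho ^+ 2)).
    have o2 : 0 <= om * rho ^+ 2 by apply: mulr_ge0; [exact: ltW|exact: sqr_ge0].
    by rewrite (sqrtrM _ l0) (sqrtrV o2) (sqrtrM _ (ltW om0)) sqrtr_sqr gtr0_norm.
  have v0 : 0 <= ln n%:R / (om * rho ^+ 2) by rewrite divr_ge0// mulr_ge0 ?sqr_ge0 ?ltW.
  have v1 : 0 <= 418 * (ln n%:R / (om * rho ^+ 2)) by apply: mulr_ge0.
  rewrite -(sqrtrM _ (ler0n R 418)) -(sqrtrM _ v1).
  rewrite ler_wsqrtr// natrM.
  by rewrite ler_wpM2r.
have nd0 : 0 <= n%:R * d%:R :> R by exact: mulr_ge0.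
apply: (@le_trans _ _ (regret_const G Rad r c * (n%:R * d%:R *
   (Num.sqrt 418 * (Num.sqrt (ln n%:R) / (Num.sqrt om * rho)) * Num.sqrt T%:R)))).
  by rewrite ler_wpM2l// ler_wpM2l.
rewrite le_eqVlt; apply/orP; left; apply/eqP.
have so : Num.sqrt om != 0 by rewrite gt_eqF// sqrtr_gt0.
have rn : rho != 0 by rewrite gt_eqF.
by field; rewrite so rn.
Qed.
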